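(* Let $n\ge 1$ and let $f\colon\mathbb{R}\to\mathbb{R}$ be locally Lipschitz continuous and non-decreasing with $f(0)=0$. Put $\ell(s)=\sup_{0<|t|\le s}\frac{f(t)}{t}$ for $s>0$, $\ell(0)=0$, and suppose that $$\int_1^\infty s^{-(1+2/n)}\ell(s)\,ds<\infty .$$ Let $B$ be any bounded subset of $L^1(\mathbb{R}^n)$. Then there exists $T_B>0$ such that for all $\phi\in B$ there exist classical $L^1$-solutions $\underline{u}(t;\phi)$ and $\overline{u}(t;\phi)$ of $$u_t=\Delta u+f(u),\qquad u(0)=\phi,$$ on $[0,T_B)$ with $\underline{u}(t;\phi)\le\overline{u}(t;\phi)$ on $[0,T_B)$. Furthermore, for all $\phi\in B$, $$\lim_{t\to 0}t^{n/2}\|\underline{u}(t;\phi)\|_\infty=\lim_{t\to 0}t^{n/2}\|\overline{u}(t;\phi)\|_\infty=0 .$$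
   Context: $\|\cdot\|_q$ denotes the norm of $L^q(\mathbb{R}^n)$. For $T>0$ set $Q_T=\mathbb{R}^n\times(0,T)$. A function $u$ is a classical $L^1$-solution of $u_t=\Delta u+f(u)$, $u(0)=\phi\in L^1(\mathbb{R}^n)$, on $[0,T)$ if $u$ satisfies the equation in the classical sense in $Q_T$ (i.e. $u\in C^{2,1}(Q_T)$ and the equation holds pointwise), $u\in C([0,T),L^1(\mathbb{R}^n))\cap L^\infty_{\rm loc}((0,T),L^\infty(\mathbb{R}^n))$, and $u(0)=\phi$. *)

(* Defs.v *)
From HB Require Import structures.
From mathcomp Require Import all_boot all_order all_algebra.
From mathcomp Require Import all_classical all_reals all_analysis.

Set Implicit Arguments.
Unset Strict Implicit.
Unset Printing Implicit Defensive.

Import Order.TTheory GRing.Theory Num.Theory.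
Import numFieldNormedType.Exports.

Local Open Scope classical_set_scope.
Local Open Scope ring_scope.

(* R^n is 'rV[R]_n, with the product of the Borel sigma-algebras of the
   coordinates (the same construction as for n.-tuple in the library). *)
Section measurable_rV.
Context {R : realType} (n : nat).

Definition rV_coord (i : 'I_n) (x : 'rV[R]_n) : measurableTypeR R := x ord0 i.

Let rV_set0 : g_sigma_preimage rV_coord set0.
Proof. exact: sigma_algebra0. Qed.

Let rV_setC A : g_sigma_preimage rV_coord A ->
  g_sigma_preimage rV_coord (~` A).
Proof. exact: sigma_algebraC. Qed.

Let rV_bigcup (F : (set 'rV[R]_n)^nat) :
  (forall i, g_sigma_preimage rV_coord (F i)) ->
  g_sigma_preimage rV_coord (\bigcup_i (F i)).
Proof. exact: sigma_algebra_bigcup. Qed.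

HB.instance Definition _ := @isMeasurable.Build
  (measure_tuple_display default_measure_display) 'rV[R]_n
  (g_sigma_preimage rV_coord) rV_set0 rV_setC rV_bigcup.

End measurable_rV.

Section lebesgue_rV.
Context {R : realType}.

Definition cons_rV n (z : measurableTypeR R * 'rV[R]_n) : 'rV[R]_n.+1 :=
  row_mx z.1%:M z.2.

Definition uncons_rV n (x : 'rV[R]_n.+1) : measurableTypeR R * 'rV[R]_n :=
  (x ord0 ord0, \row_i x ord0 (lift ord0 i)).

Lemma measurable_rV_coord n (i : 'I_n) :
  measurable_fun [set: 'rV[R]_n] (rV_coord i).
Proof.
move=> _ Y mY; rewrite setTI; apply: sub_sigma_algebra => /=.
rewrite -bigcup_seq/=; exists i => /=; first by rewrite mem_index_enum.
by exists Y => //; rewrite setTI.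
Qed.

Lemma measurable_fun_rVP d (T : measurableType d) n (f : T -> 'rV[R]_n) :
  measurable_fun [set: T] f <->
  forall i, measurable_fun [set: T] (rV_coord i \o f).
Proof.
split=> [mf i|mf].
  by apply: measurableT_comp => //; exact: measurable_rV_coord.
move=> _ Y mY; rewrite setTI.
have sF : sigma_algebra setT [set B : set 'rV[R]_n | measurable (f @^-1` B)].
  split => /=.
  - by rewrite preimage_set0.
  - by move=> A mA; rewrite setTD preimage_setC; exact: measurableC.
  - by move=> F mF; rewrite preimage_bigcup; exact: bigcup_measurable.
apply: (mY [set B | measurable (f @^-1` B)]); split => //.
move=> B; rewrite -bigcup_seq => -[i _ [C mC <-]] /=.
by rewrite setTI -comp_preimage -[_ @^-1` _]setTI; exact: mf.
Qed.

Lemma cons_rV0 n z : @cons_rV n z ord0 ord0 = z.1.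
Proof.
rewrite /cons_rV (_ : (ord0 : 'I_n.+1) = lshift n (ord0 : 'I_1)); last exact/val_inj.
by rewrite (@row_mxEl _ 1 1 n) mxE eqxx mulr1n.
Qed.

Lemma cons_rVS n z i : @cons_rV n z ord0 (lift ord0 i) = z.2 ord0 i.
Proof.
rewrite /cons_rV (_ : lift ord0 i = rshift 1 i); last exact/val_inj.
by rewrite (@row_mxEr _ 1 1 n).
Qed.

Lemma cons_rVK n : cancel (@cons_rV n) (@uncons_rV n).
Proof.
move=> [a v]; rewrite /uncons_rV cons_rV0; congr (_, _).
by apply/rowP => i; rewrite mxE cons_rVS.
Qed.

Lemma uncons_rVK n : cancel (@uncons_rV n) (@cons_rV n).
Proof.
move=> x; apply/rowP => i; case: (unliftP ord0 i) => [j|] ->.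
  by rewrite cons_rVS mxE.
by rewrite cons_rV0.
Qed.

Lemma measurable_cons_rV n : measurable_fun setT (@cons_rV n).
Proof.
apply/measurable_fun_rVP => i; case: (unliftP ord0 i) => [j|] ->.
  rewrite (_ : _ \o _ = rV_coord j \o snd).
    by apply: measurableT_comp => //; exact: measurable_rV_coord.
  by apply/funext => z /=; rewrite /rV_coord cons_rVS.
rewrite (_ : _ \o _ = fst)//.
by apply/funext => z /=; rewrite /rV_coord cons_rV0.
Qed.

Lemma measurable_uncons_rV n : measurable_fun setT (@uncons_rV n).
Proof.
apply/measurable_fun_pairP; split; first exact: measurable_rV_coord.
apply/measurable_fun_rVP => i.
rewrite (_ : _ \o _ = rV_coord (lift ord0 i)); first exact: measurable_rV_coord.
by apply/funext => z /=; rewrite /rV_coord mxE.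
Qed.

Section lebesgue_consE.
Variables (n : nat) (mu : {sigma_finite_measure set 'rV[R]_n -> \bar R}).

Definition lebesgue_cons : set 'rV[R]_n.+1 -> \bar R :=
  pushforward (@lebesgue_measure R \x mu)%E (@cons_rV n).

Let lebesgue_cons0 : lebesgue_cons set0 = 0%E.
Proof. by rewrite /lebesgue_cons /pushforward preimage_set0 measure0. Qed.

Let lebesgue_cons_ge0 A : (0 <= lebesgue_cons A)%E.
Proof. by rewrite /lebesgue_cons /pushforward; exact: measure_ge0. Qed.

Let mcons A : measurable A -> measurable (@cons_rV n @^-1` A).
Proof. by move=> mA; rewrite -[_ @^-1` _]setTI; exact: measurable_cons_rV. Qed.

Let lebesgue_cons_sigma_additive : semi_sigma_additive lebesgue_cons.
Proof.
move=> F mF tF mUF; rewrite /lebesgue_cons /pushforward preimage_bigcup.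
apply: (@measure_semi_sigma_additive _ _ _ (@lebesgue_measure R \x mu)%E).
- by move=> k; exact: mcons.
- apply/trivIsetP => /= i j _ _ ij; rewrite -preimage_setI.
  by move/trivIsetP : tF => /(_ _ _ _ _ ij) ->//; rewrite preimage_set0.
- by rewrite -preimage_bigcup; exact: mcons.
Qed.

HB.instance Definition _ := isMeasure.Build _ _ _ lebesgue_cons
  lebesgue_cons0 lebesgue_cons_ge0 lebesgue_cons_sigma_additive.

Let sigma_finite_lebesgue_cons : sigma_finite setT lebesgue_cons.
Proof.
have /sigma_finiteP[F [TF ndF Foo]] := sigma_finiteT (@lebesgue_measure R).
have /sigma_finiteP[G [TG ndG Goo]] := sigma_finiteT mu.
exists (fun k => @uncons_rV n @^-1` (F k `*` G k)).
  rewrite -preimage_bigcup; apply/esym; rewrite -subTset => x _ /=.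
  have [i _ Fi] : (\bigcup_i F i) (uncons_rV x).1 by rewrite -TF.
  have [j _ Gj] : (\bigcup_i G i) (uncons_rV x).2 by rewrite -TG.
  exists (maxn i j) => //; split.
  - by move: Fi; apply/subsetPset/ndF/leq_maxl.
  - by move: Gj; apply/subsetPset/ndG/leq_maxr.
move=> k; have [mF Fk] := Foo k; have [mG Gk] := Goo k; split.
  rewrite -[_ @^-1` _]setTI; apply: measurable_uncons_rV => //.
  exact: measurableX.
rewrite /lebesgue_cons /pushforward -comp_preimage.
rewrite (_ : _ \o _ = id) ?preimage_id; last first.
  by apply/funext; exact: cons_rVK.
by rewrite product_measure1E// lte_mul_pinfty// ge0_fin_numE.
Qed.

HB.instance Definition _ := Measure_isSigmaFinite.Build _ _ _ lebesgue_cons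
  sigma_finite_lebesgue_cons.

End lebesgue_consE.

(* The Lebesgue measure of R^n, as the n-fold product of that of R. *)
Fixpoint lebesgue_rV n : {sigma_finite_measure set 'rV[R]_n -> \bar R} :=
  match n with
  | 0 => \d_(0 : 'rV[R]_0)
  | m.+1 => lebesgue_cons (lebesgue_rV m)
  end.

Lemma lebesgue_rV_box n (A : 'I_n -> set (measurableTypeR R)) :
  (forall i, measurable (A i)) ->
  lebesgue_rV n [set x | forall i, A i (x ord0 i)] =
  \big[*%E/1%E]_(i < n) lebesgue_measure (A i).
Proof.
elim: n => [|n IH] in A *; move=> mA.
  by rewrite big_ord0 /= diracE mem_set// => -[].
have mB : measurable [set v : 'rV[R]_n | forall i, A (lift ord0 i) (v ord0 i)].
  rewrite [X in measurable X](_ : _ =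
      \bigcap_(i in [set: 'I_n]) (rV_coord i @^-1` A (lift ord0 i))).
    apply: fin_bigcap_measurable => // i _.
    by rewrite -[_ @^-1` _]setTI; exact: measurable_rV_coord.
  by apply/seteqP; split => x /= Ax i; [move=> _|]; exact: Ax.
rewrite big_ord_recl -IH//= /lebesgue_cons /pushforward.
rewrite -product_measure1E//=; congr ((_ \x _)%E _).
apply/seteqP; split => -[a v] /=.
  move=> Aav; split => [|i].
    by have := Aav ord0; rewrite cons_rV0.
  by have := Aav (lift ord0 i); rewrite cons_rVS.
move=> [Aa Av] i; case: (unliftP ord0 i) => [j|] ->.
  by rewrite cons_rVS; exact: Av.
by rewrite cons_rV0.
Qed.

End lebesgue_rV.

Section nonlinearity.
Context {R : realType}.

Definition locally_lipschitz (f : R -> R) :=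
  forall x : R, exists2 U, nbhs x U & [lipschitz f y | y in U].

Definition ell (f : R -> R) (s : R) : R :=
  if s == 0 then 0 else sup [set f t / t | t in [set t | 0 < `|t| <= s]].

End nonlinearity.

(* A function u of space and time is curried with time first, so that u t is
   the spatial profile u(t); its values for t outside the time interval under
   consideration are irrelevant. Elements of L^p are represented by functions
   in [Lfun mu p], and equality in L^p is equality almost everywhere. *)
Section classical_solution.
Context {R : realType} {n : nat}.
Implicit Types (g phi : 'rV[R]_n -> R) (u : R -> 'rV[R]_n -> R) (T : R).

Local Notation mu := (lebesgue_rV n).
Local Notation "'N_ p [ g ]" := ('N[mu]_p [EFin \o g%R])%E.

Definition bounded_in_L1 (B : set ('rV[R]_n -> R)) :=
  B `<=` [set phi | phi \in Lfun mu 1] /\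
  exists M : R, forall phi, B phi -> ('N_1[phi] <= M%:E)%E.

Definition basis_rV (i : 'I_n) : 'rV[R]_n := delta_mx ord0 i.

Definition partial (i : 'I_n) g : 'rV[R]_n -> R := 'D_(basis_rV i) g.

Definition laplacian g (x : 'rV[R]_n) : R :=
  \sum_(i < n) partial i (partial i g) x.

Definition dt u (t : R) (x : 'rV[R]_n) : R := derive1 (u ^~ x) t.

Definition QT T : set ('rV[R]_n * R) := [set: 'rV[R]_n] `*` `]0, T[.

Definition C21 T u :=
  [/\ forall x t, QT T (x, t) ->
        [/\ derivable (u ^~ x) t 1,
            forall i, derivable (u t) x (basis_rV i) &
            forall i j, derivable (partial i (u t)) x (basis_rV j)],
      {within QT T, continuous (fun z => u z.2 z.1)},
      {within QT T, continuous (fun z => dt u z.2 z.1)},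
      forall i, {within QT T, continuous (fun z => partial i (u z.2) z.1)} &
      forall i j, {within QT T,
        continuous (fun z => partial j (partial i (u z.2)) z.1)}].

Definition C_L1 T u :=
  (forall t : R, `[0, T[%classic t -> u t \in Lfun mu 1) /\
  (forall t0 : R, `[0, T[%classic t0 ->
    'N_1[u t \- u t0]%E @[t --> within `[0, T[%classic (nbhs t0)] --> 0%E).

Definition simple_Linfty (s : R -> 'rV[R]_n -> R) :=
  [/\ finite_set (range s),
      forall t, s t \in Lfun mu +oo%E &
      forall g, measurable (s @^-1` [set g])].

(* Strong (Bochner) measurability of an L^oo-valued function on (0, T). *)
Definition strongly_measurable_Linfty T u :=
  exists2 s : nat -> R -> 'rV[R]_n -> R,
    forall k, simple_Linfty (s k) &
    \forall t \ae (@lebesgue_measure R), `]0, T[%classic t ->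
      'N_(+oo)[s k t \- u t]%E @[k --> \oo] --> 0%E.

Definition Linftyloc_Linfty T u :=
  strongly_measurable_Linfty T u /\
  forall K : set R, compact K -> K `<=` `]0, T[ ->
    exists M : R, \forall t \ae (@lebesgue_measure R), K t ->
      u t \in Lfun mu +oo%E /\ ('N_(+oo)[u t] <= M%:E)%E.

Definition classical_L1_solution (f : R -> R) phi T u :=
  [/\ C21 T u,
      forall x t, QT T (x, t) -> dt u t x = laplacian (u t) x + f (u t x),
      C_L1 T u,
      Linftyloc_Linfty T u &
      u 0 = phi %[ae mu]].

End classical_solution.

(* Main.v *)
Require Import Defs.
From HB Require Import structures.
From mathcomp Require Import all_boot all_order all_algebra.
From mathcomp Require Import all_classical all_reals all_analysis.
From mathcomp Require Import measurable_realfun ess_sup_inf.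
From mathcomp Require Import ring lra.

(** The solution is obtained from the mild formulation
      u t = G t * phi + \int_(0 < s < t) G (t - s) * f (u s) ds,
    where G is the Gaussian ([gauss]) and * the convolution ([gconv]).

    Existence. Let V t = G t * |phi|. It is at most a constant times
    t^(-n/2), the constant depending only on a bound m of the L1 norm of phi.
    Hence, whenever |r| <= 2 V s y, one has |f r| <= a s * (2 V s y) for
    a s = ell f (c s^(-n/2)) ([speed], [speed_bound]). The substitution
    r = s^(-n/2) turns the hypothesis on ell into the integrability of a near
    zero ([ge0_integral_growth]), so that the integral of a over ]0, T[ is at
    most 1/2 for some T that depends only on m ([speed_integral]). By the
    semigroup law G (t - s) * V s = V t, the Duhamel term of any U with
    |U| <= 2 V is then at most (\int a) * 2 V t <= V t: the order interval
    between - 2 V and 2 V is stable under the mild formulation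
    ([duhamel_op_bound]). As f is nondecreasing, the Picard iterates started at
    2 V decrease, and by dominated convergence their limit is a fixed point
    ([mild_fixed]), which is used both as lower and as upper solution.

    Regularity. For positive times the solution is bounded, and it may be
    restarted at any time t1 > 0 from its bounded value at t1 ([mild_duhamel]).
    A bounded source makes the solution Lipschitz in space and Hoelder
    continuous of exponent 1/2 in time ([space_lipschitz], [time_holder]);
    then f (u s) is Lipschitz in space as well. The second derivatives of G
    have integral zero, so that tested against a Lipschitz function they are
    O((t - s)^(-1/2)) ([conv_gauss_dd_lip]), which is integrable: the Duhamel
    term can be differentiated twice in space and once in time, and u is a
    classical solution ([solution_C21], [heat_equation]).

    Time zero. G t * phi tends to phi in L1 ([heat_cvg0]), and the Duhamel term
    has L1 norm at most 2 |phi|_1 times the integral of a over ]0, t[, so that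
    u is continuous in L1 up to time zero ([sol_C_L1]). For the decay, |phi| is
    split as a part bounded by k and an excess of small L1 norm: the first
    contributes 2 k t^(n/2) to t^(n/2) |u t|_oo and the second a constant times
    its L1 norm ([Linfty_decay]). *)

Set Implicit Arguments.
Unset Strict Implicit.
Unset Printing Implicit Defensive.

Import Order.TTheory GRing.Theory Num.Theory.
Import numFieldNormedType.Exports.

Local Open Scope classical_set_scope.
Local Open Scope ring_scope.

(** * The Euclidean inner product and the Gaussian *)

Section dot_product.
Context {R : realType} {n : nat}.
Implicit Types v w x y z : 'rV[R]_n.

Definition dot v w : R := \sum_i v ord0 i * w ord0 i.

Lemma dotC v w : dot v w = dot w v.
Proof. by apply: eq_bigr => i _; rewrite mulrC. Qed.

Lemma dotDl u v w : dot (u + v) w = dot u w + dot v w.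
Proof. by rewrite -big_split; apply: eq_bigr => i _; rewrite mxE mulrDl. Qed.

Lemma dotZl (a : R) v w : dot (a *: v) w = a * dot v w.
Proof. by rewrite mulr_sumr; apply: eq_bigr => i _; rewrite mxE mulrA. Qed.

Lemma dotDr u v w : dot w (u + v) = dot w u + dot w v.
Proof. by rewrite dotC dotDl !(dotC w). Qed.

Lemma dotZr (a : R) v w : dot w (a *: v) = a * dot w v.
Proof. by rewrite dotC dotZl (dotC w). Qed.

Lemma dotNN v : dot (- v) (- v) = dot v v.
Proof. by apply: eq_bigr => i _; rewrite !mxE mulrNN. Qed.

Lemma dot_ge0 v : 0 <= dot v v.
Proof. by apply: sumr_ge0 => i _; rewrite -expr2 sqr_ge0. Qed.

Lemma coord_sqr_le_dot v i : v ord0 i ^+ 2 <= dot v v.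
Proof.
rewrite /dot (bigD1 i)//= -expr2 lerDl.
by apply: sumr_ge0 => j _; rewrite -expr2 sqr_ge0.
Qed.

Lemma dot_basis i z : dot (basis_rV i) z = z ord0 i.
Proof.
rewrite /dot (bigD1 i)//= mxE !eqxx mul1r big1 ?addr0// => j ji.
by rewrite mxE (negbTE ji) andbF mul0r.
Qed.

Lemma coord_norm z i : `|z ord0 i| <= `|z|.
Proof. by rewrite [leRHS]/Num.norm/= mx_normrE; apply: (le_bigmax_cond _ (j := (ord0, i)) (fun p => `|z p.1 p.2|)). Qed.

Lemma norm_rV_le z (c : R) : 0 <= c -> (forall i, `|z ord0 i| <= c) -> `|z| <= c.
Proof.
move=> c0 zc; rewrite [leLHS]/Num.norm/= mx_normrE; apply: bigmax_le => // -[a b] _ /=.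
by rewrite (ord1 a).
Qed.

Lemma dot_norm v w : `|dot v w| <= n%:R * (`|v| * `|w|).
Proof.
rewrite (le_trans (ler_norm_sum _ _ _))//.
rewrite (le_trans (y := \sum_(i < n) (`|v| * `|w|)))//.
  by apply: ler_sum => i _; rewrite normrM ler_pM// coord_norm.
by rewrite sumr_const card_ord mulr_natl.
Qed.

(** Trades a factor |z| for the square root of t and a polynomial in
    dot z z / t, of the kind that [gauss_dom] absorbs. *)
Lemma norm_scaled_le (t : R) z : 0 < t -> `|z| <= Num.sqrt t * (1 + dot z z / t).
Proof.
move=> t0; have s0 : 0 < Num.sqrt t by rewrite sqrtr_gt0.
apply: norm_rV_le => [|i].
  by rewrite mulr_ge0 ?sqrtr_ge0// addr_ge0// divr_ge0 ?dot_ge0 ?ltW.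
rewrite -ler_pdivrMl//; set a := _ * _.
have aE : a ^+ 2 = z ord0 i ^+ 2 / t.
  by rewrite exprMn exprVn sqr_sqrtr ?ltW// real_normK ?num_real// mulrC.
rewrite (le_trans (y := 1 + a ^+ 2))//.
  by have := sqr_ge0 (a - 1); have := sqr_ge0 a; nra.
by rewrite lerD2l aE ler_pM2r ?invr_gt0// coord_sqr_le_dot.
Qed.

(** Expanding 0 <= |x + 2 y|^2: a bounded shift costs at most half of the
    quadratic form. *)
Lemma dot_shift x y (r : R) : `|y| <= r -> dot x x / 2 - n%:R * r ^+ 2 <= dot (x + y) (x + y).
Proof.
move=> yr.
have h : dot y y <= n%:R * r ^+ 2.
  rewrite (le_trans (ler_norm _))// (le_trans (dot_norm _ _))// ler_wpM2l ?ler0n//.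
  by rewrite expr2 ler_pM.
have := dot_ge0 (x + 2 *: y).
rewrite !(dotDl, dotDr, dotZl, dotZr) (dotC y x); lra.
Qed.

End dot_product.

Section gauss_kernel.
Context {R : realType} {n : nat}.
Implicit Types (x y z v w : 'rV[R]_n) (t s : R).

Definition peak t : R := (Num.sqrt (4 * pi * t))^-1.

Definition gauss t z : R :=
  if 0 < t then peak t ^+ n * expR (- (dot z z / (4 * t))) else 0.

Lemma gaussE t z : 0 < t -> gauss t z = peak t ^+ n * expR (- (dot z z / (4 * t))).
Proof. by rewrite /gauss => ->. Qed.

Lemma gauss_le0 t z : t <= 0 -> gauss t z = 0.
Proof. by rewrite /gauss ltNge => ->. Qed.

Lemma peak_gt0 t : 0 < t -> 0 < peak t.
Proof. by move=> t0; rewrite invr_gt0 sqrtr_gt0 !mulr_gt0// pi_gt0. Qed.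

Lemma gauss_ge0 t z : 0 <= gauss t z.
Proof.
rewrite /gauss; case: ifP => // t0.
by rewrite mulr_ge0 ?expR_ge0// exprn_ge0// ltW// peak_gt0.
Qed.

Lemma gaussN t z : gauss t (- z) = gauss t z.
Proof. by rewrite /gauss dotNN. Qed.

Lemma gaussC t x y : gauss t (x - y) = gauss t (y - x).
Proof. by rewrite -gaussN opprB. Qed.

Lemma gauss_le t z : 0 < t -> gauss t z <= peak t ^+ n.
Proof.
move=> t0; rewrite gaussE// ler_piMr//; first by rewrite exprn_ge0// ltW// peak_gt0.
by rewrite -[leRHS]expR0 ler_expR oppr_le0 divr_ge0 ?dot_ge0// mulr_ge0// ltW.
Qed.

Lemma peakM t (c : R) : 0 < c -> peak (c ^+ 2 * t) = peak t / c.
Proof.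
move=> c0; rewrite /peak mulrCA sqrtrM ?sqr_ge0// sqrtr_sqr gtr0_norm//.
by rewrite invfM mulrC.
Qed.

(** The factor 16^3 pays for the cubic polynomial of [gauss_dom], and 2^n for
    the ratio of the peaks of the two Gaussians. *)
Definition domC : R := 16 ^+ 3 * 2 ^+ n.

Lemma domC_gt0 : 0 < domC. Proof. by rewrite mulr_gt0// exprn_gt0. Qed.

(** With q = dot z z / t, passing from time t to time 4 t gains a factor
    exp (- 3 q / 16), which beats (1 + q)^3 because 1 + q <= 16 exp (q / 16). *)
Lemma gauss_dom t z : 0 < t ->
  (1 + dot z z / t) ^+ 3 * gauss t z <= domC * gauss (4 * t) z.
Proof.
move=> t0; have t40 : 0 < 4 * t by rewrite mulr_gt0.
rewrite !gaussE//.
have -> : peak t = 2 * peak (4 * t).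
  by rewrite (_ : 4 = 2 ^+ 2 :> R) ?peakM//; [field|rewrite -natrX].
set q := dot z z / t.
have q0 : 0 <= q by rewrite divr_ge0 ?dot_ge0 ?ltW.
have -> : dot z z / (4 * t) = q / 4 by rewrite /q; field; rewrite gt_eqF.
have -> : dot z z / (4 * (4 * t)) = q / 16 by rewrite /q; field; rewrite gt_eqF.
rewrite exprMn /domC.
have -> : expR (- (q / 4)) = expR (- (q / 16)) * (expR (q / 16) ^+ 3)^-1.
  by rewrite -expRM_natl -expRN -expRD; congr expR; field.
have e0 := expR_gt0 (q / 16).
have h : (1 + q) ^+ 3 * (expR (q / 16) ^+ 3)^-1 <= 16 ^+ 3.
  rewrite ler_pdivrMr ?exprn_gt0// -exprMn lerXn2r// ?nnegrE ?addr_ge0// ?mulr_ge0 ?ltW//.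
  by have := expR_ge1Dx (q / 16); lra.
rewrite [leLHS](_ : _ = ((1 + q) ^+ 3 * (expR (q / 16) ^+ 3)^-1) * (2 ^+ n * (peak (4 * t) ^+ n * expR (- (q / 16))))); last by ring.
rewrite -[leRHS]mulrA ler_wpM2r// !mulr_ge0// ?expR_ge0// exprn_ge0// ltW//.
exact: peak_gt0.
Qed.

Lemma gauss_dom_le t z (p c : R) : 0 < t -> 0 <= c ->
  p <= c * (1 + dot z z / t) ^+ 3 ->
  p * gauss t z <= c * domC * gauss (4 * t) z.
Proof.
move=> t0 c0 pc; rewrite (le_trans (ler_wpM2r (gauss_ge0 _ _) pc))//.
rewrite -[leLHS]mulrA -[leRHS]mulrA ler_wpM2l//; exact: gauss_dom.
Qed.

(** One Gaussian dominates all those with time close to t0 and a bounded shift,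
    as dominated convergence requires when time and point vary together. *)
Lemma gauss_locdom t0 (r : R) : 0 < t0 -> 0 <= r -> exists2 C : R, 0 <= C &
  forall t z y, t0 / 2 <= t <= 2 * t0 -> `|y| <= r ->
    gauss (4 * t) (z + y) <= C * gauss (16 * t0) z.
Proof.
move=> t00 r0.
exists ((peak (2 * t0) / peak (16 * t0)) ^+ n * expR (n%:R * r ^+ 2 / (8 * t0))).
  by rewrite mulr_ge0 ?expR_ge0// exprn_ge0// divr_ge0// ltW// peak_gt0// mulr_gt0.
move=> t z y /andP[t1 t2] yr.
have tp : 0 < t by rewrite (lt_le_trans _ t1)// divr_gt0.
have pk : 0 < peak (16 * t0) by rewrite peak_gt0 ?mulr_gt0.
rewrite !gaussE ?mulr_gt0//.
rewrite exprMn (exprVn (peak (16 * t0))) mulrACA mulfVK ?expf_neq0 ?gt_eqF//.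
have pk4 : 0 <= peak (4 * t) by rewrite ltW// peak_gt0// mulr_gt0.
rewrite -expRD ler_pM ?expR_ge0 ?exprn_ge0//.
  rewrite lerXn2r ?nnegrE ?(ltW (peak_gt0 _)) ?mulr_gt0//.
  rewrite lef_pV2 ?posrE ?sqrtr_gt0 ?mulr_gt0 ?pi_gt0// ler_wsqrtr//.
  rewrite ler_pM2l ?mulr_gt0 ?pi_gt0//; lra.
rewrite ler_expR.
have := dot_shift z yr; set A := dot z z; set B := dot (z + y) _ => AB.
have B0 : 0 <= B := dot_ge0 _.
have h1 : B / (4 * (4 * t)) >= B / (32 * t0).
  by rewrite ler_wpM2l// lef_pV2 ?posrE ?mulr_gt0//; lra.
have h2 : (A / 2 - n%:R * r ^+ 2) / (32 * t0) <= B / (32 * t0).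
  by rewrite ler_wpM2r// invr_ge0 mulr_ge0// ltW.
rewrite -subr_ge0.
have -> : n%:R * r ^+ 2 / (8 * t0) - A / (4 * (16 * t0)) - - (B / (4 * (4 * t))) =
   B / (4 * (4 * t)) - (A / 2 - n%:R * r ^+ 2) / (32 * t0) + 3 * (n%:R * r ^+ 2) / (32 * t0).
  field; rewrite !gt_eqF//=.
rewrite addr_ge0// ?subr_ge0; first exact: le_trans h1.
by rewrite divr_ge0 ?mulr_ge0 ?ler0n ?sqr_ge0// ltW.
Qed.

End gauss_kernel.
Arguments domC {R} n.

(** * Measurability and integrals of the Gaussian *)

(** Closes the measurability goals for tuples of components of a point of a
    product space. *)
Ltac mproj := repeat first
  [ exact: measurable_fst | exact: measurable_snd | exact: measurable_id | exact: measurable_cst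
  | apply: measurable_fun_pair | apply: (measurableT_comp measurable_fst)
  | apply: (measurableT_comp measurable_snd) ].

Section measurability.
Context {R : realType}.

Lemma measurable_invr : measurable_fun [set: R] (@GRing.inv R).
Proof.
rewrite (_ : GRing.inv = fun x : R => if 0 <= x then x `^ (-1) else - ((- x) `^ (-1))); last first.
  apply/funext => x; case: leP => x0; first by rewrite powR_inv1.
  by rewrite powR_inv1 ?invrN ?opprK// oppr_ge0 ltW.
apply: measurable_fun_ifT => //.
- exact: measurable_fun_ler.
- apply: measurableT_comp => //.
  by apply: (@measurableT_comp _ _ _ _ _ _ (fun y : R => y `^ (-1))) => //; exact: measurable_powR.
Qed.

Lemma measurable_sqrtr : measurable_fun [set: R] (@Num.sqrt R).
Proof. by apply: nondecreasing_measurable => // x y xy; exact: ler_wsqrtr. Qed.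

Context {n : nat} d (T : measurableType d).
Implicit Types (f : T -> R) (g h : T -> 'rV[R]_n).

Lemma measurable_coord g i : measurable_fun setT g -> measurable_fun setT (fun t => g t ord0 i).
Proof. by move=> mg; exact: ((measurable_fun_rVP g).1 mg i). Qed.

Lemma measurable_rVD g h : measurable_fun setT g -> measurable_fun setT h ->
  measurable_fun setT (fun t => g t + h t).
Proof.
move=> mg mh; apply/measurable_fun_rVP => i.
rewrite (_ : _ \o _ = fun t => g t ord0 i + h t ord0 i).
  by apply: measurable_funD; exact: measurable_coord.
by apply/funext => t; rewrite /rV_coord /= mxE.
Qed.

Lemma measurable_rVN g : measurable_fun setT g -> measurable_fun setT (fun t => - g t).
Proof.
move=> mg; apply/measurable_fun_rVP => i.
rewrite (_ : _ \o _ = fun t => - g t ord0 i).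
  by apply: measurableT_comp => //; exact: measurable_coord.
by apply/funext => t; rewrite /rV_coord /= mxE.
Qed.

Lemma measurable_rVB g h : measurable_fun setT g -> measurable_fun setT h ->
  measurable_fun setT (fun t => g t - h t).
Proof. by move=> mg mh; apply: measurable_rVD => //; exact: measurable_rVN. Qed.

Lemma measurable_dot g h : measurable_fun setT g -> measurable_fun setT h ->
  measurable_fun setT (fun t => dot (g t) (h t)).
Proof.
move=> mg mh; apply: measurable_sum => i.
by apply: measurable_funM; exact: measurable_coord.
Qed.

Lemma measurable_gauss f g : measurable_fun setT f -> measurable_fun setT g ->
  measurable_fun setT (fun t => gauss (f t) (g t)).
Proof.
move=> mf mg; apply: measurable_fun_ifT.
- exact: measurable_fun_ltr.
- apply: measurable_funM.
    apply: measurable_funX; apply: (measurableT_comp measurable_invr).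
    by apply: (measurableT_comp measurable_sqrtr); exact: measurable_funM.
  apply: measurableT_comp => //; apply: measurableT_comp => //.
  apply: measurable_funM; first exact: measurable_dot.
  by apply: (measurableT_comp measurable_invr); exact: measurable_funM.
- exact: measurable_cst.
Qed.

End measurability.

Section gauss_integral.
Context {R : realType}.
Implicit Types (n : nat) (s t : R).
Local Notation leb := (@lebesgue_measure R).

Lemma ge0_integral_cons n (F : 'rV[R]_n.+1 -> \bar R) :
  measurable_fun [set: 'rV[R]_n.+1] F -> (forall x, 0 <= F x)%E ->
  (\int[lebesgue_rV n.+1]_x F x =
   \int[leb]_a \int[lebesgue_rV n]_v F (cons_rV (a, v)))%E.
Proof.
move=> mF F0; rewrite /= ge0_integral_pushforward//; last exact: measurable_cons_rV.
rewrite preimage_setT (fubini_tonelli1 (F \o @cons_rV R n))//; last by move=> z; exact: F0.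
by apply: measurableT_comp => //; exact: measurable_cons_rV.
Qed.

Definition gauss1 t (a : R) : R := peak t * expR (- (a ^+ 2 / (4 * t))).

Lemma gauss1E t a b : 0 < t -> gauss1 t (a - b) = normal_pdf a (Num.sqrt (2 * t)) b.
Proof.
move=> t0; have s0 : Num.sqrt (2 * t) != 0 by rewrite gt_eqF// sqrtr_gt0 mulr_gt0.
rewrite normal_pdfE// /gauss1 /peak /normal_peak /normal_fun !sqr_sqrtr ?mulr_ge0 ?ltW//.
congr (_^-1 * expR _); first by congr Num.sqrt; rewrite -mulr_natr; ring.
by rewrite mulNr -(opprB a) sqrrN -mulr_natr; congr (- (_ / _)); ring.
Qed.

(** The Gaussian is a product over the coordinates; integrals over the space
    reduce by induction on the dimension to one-dimensional ones. *)
Lemma gauss_cons n t a (v : 'rV[R]_n) : 0 < t ->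
  gauss t (cons_rV (a, v)) = gauss1 t a * gauss t v.
Proof.
move=> t0; rewrite !gaussE// /gauss1 mulrACA -exprS -expRD; congr (_ * expR _).
rewrite -opprD -mulrDl; congr (- (_ / _)).
rewrite /dot big_ord_recl cons_rV0 -expr2; congr (_ + _).
by apply: eq_bigr => i _; rewrite cons_rVS.
Qed.

Lemma cons_rVB n (a b : R) (v w : 'rV[R]_n) :
  cons_rV (a, v) - cons_rV (b, w) = cons_rV (a - b, v - w).
Proof.
apply/rowP => i; rewrite [LHS]mxE [X in _ + X]mxE.
case: (unliftP ord0 i) => [j|] ->; last by rewrite !cons_rV0.
by rewrite !cons_rVS /= !mxE.
Qed.

Lemma measurable_gauss1 t a : measurable_fun setT (fun b : R => gauss1 t (a - b)).
Proof.
apply: measurable_funM => //; apply: measurableT_comp => //; apply: measurableT_comp => //.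
by apply: measurable_funM => //; apply: measurable_funX; exact: measurable_funB.
Qed.

Lemma gauss1_ge0 t a : 0 <= gauss1 t a.
Proof. by rewrite mulr_ge0 ?expR_ge0// invr_ge0 sqrtr_ge0. Qed.

Lemma integral_gauss1 t a : 0 < t -> (\int[leb]_b (gauss1 t (a - b))%:E = 1)%E.
Proof.
move=> t0; under eq_integral do rewrite gauss1E//.
exact: integral_normal_pdf.
Qed.

(** Completing the square in the integration variable. *)
Lemma gauss1_conv s t a b : 0 < s -> 0 < t ->
  (\int[leb]_c (gauss1 t (a - c) * gauss1 s (c - b))%:E = (gauss1 (t + s) (a - b))%:E)%E.
Proof.
move=> s0 t0; have st : 0 < t + s by rewrite addr_gt0.
set r := t * s / (t + s); set m := (s * a + t * b) / (t + s).
have r0 : 0 < r by rewrite divr_gt0// mulr_gt0.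
have E c : gauss1 t (a - c) * gauss1 s (c - b) = gauss1 (t + s) (a - b) * gauss1 r (m - c).
  rewrite /gauss1 mulrACA [RHS]mulrACA -!expRD; congr (_ * expR _).
    rewrite /peak -!invfM -!sqrtrM ?mulr_ge0 ?pi_ge0 ?ltW//; congr (Num.sqrt _)^-1.
    by rewrite /r; field; rewrite gt_eqF.
  by rewrite /r /m; field; rewrite !gt_eqF.
under eq_integral do rewrite E EFinM.
rewrite ge0_integralZl_EFin//.
- by rewrite integral_gauss1// mule1.
- by move=> x _; rewrite lee_fin gauss1_ge0.
- by apply/measurable_EFinP; exact: measurable_gauss1.
- exact: gauss1_ge0.
Qed.

Lemma measurable_gaussB n t (x : 'rV[R]_n) : measurable_fun setT (fun y : 'rV[R]_n => gauss t (x - y)).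
Proof. by apply: measurable_gauss => //; exact: measurable_rVB. Qed.

Lemma integral_gauss n t (x : 'rV[R]_n) : 0 < t ->
  (\int[lebesgue_rV n]_y (gauss t (x - y))%:E = 1)%E.
Proof.
move=> t0; elim: n x => [|n IH] x.
  rewrite integral_dirac//; last by apply/measurable_EFinP; exact: measurable_gaussB.
  rewrite diracT mul1e gaussE// expr0 mul1r /dot big_ord0.
  by rewrite mul0r oppr0 expR0.
rewrite ge0_integral_cons//; last 2 first.
- by apply/measurable_EFinP; exact: measurable_gaussB.
- by move=> y; rewrite lee_fin gauss_ge0.
rewrite -[x]uncons_rVK; case: (uncons_rV x) => x0 x'.
under eq_integral => a _.
  under eq_integral do rewrite cons_rVB gauss_cons// EFinM.
  rewrite ge0_integralZl_EFin//; last 3 first.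
  - by move=> y _; rewrite lee_fin gauss_ge0.
  - by apply/measurable_EFinP; exact: measurable_gaussB.
  - exact: gauss1_ge0.
  rewrite IH mule1.
  over.
exact: integral_gauss1.
Qed.

Lemma gauss_conv n s t (x y : 'rV[R]_n) : 0 < s -> 0 < t ->
  (\int[lebesgue_rV n]_z (gauss t (x - z) * gauss s (z - y))%:E =
   (gauss (t + s) (x - y))%:E)%E.
Proof.
move=> s0 t0; have ts0 : 0 < t + s by rewrite addr_gt0.
have mG m (u v : 'rV[R]_m) : measurable_fun setT (fun z : 'rV[R]_m => (gauss t (u - z) * gauss s (z - v))%:E).
  apply/measurable_EFinP; apply: measurable_funM; first exact: measurable_gaussB.
  by apply: measurable_gauss => //; exact: measurable_rVB.
elim: n x y => [|n IH] x y.
  rewrite integral_dirac//; last by exact: mG.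
  rewrite diracT mul1e !gaussE// !expr0 !mul1r /dot !big_ord0.
  by rewrite !mul0r oppr0 expR0 mul1r.
rewrite ge0_integral_cons//; last first.
  by move=> z; rewrite lee_fin mulr_ge0 ?gauss_ge0.
rewrite -[x]uncons_rVK -[y]uncons_rVK.
case: (uncons_rV x) => x0 x'; case: (uncons_rV y) => y0 y'.
under eq_integral => a _.
  under eq_integral do rewrite !cons_rVB !gauss_cons// mulrACA EFinM.
  rewrite ge0_integralZl_EFin//; last 3 first.
  - by move=> z _; rewrite lee_fin mulr_ge0 ?gauss_ge0.
  - exact: mG.
  - by rewrite mulr_ge0 ?gauss1_ge0.
  rewrite IH.
  over.
rewrite ge0_integralZr//; last 3 first.
- apply/measurable_EFinP; apply: measurable_funM; first exact: measurable_gauss1.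
  rewrite (_ : (fun _ => _) = fun c => gauss1 s (y0 - c)); first exact: measurable_gauss1.
  by apply/funext => c; rewrite /gauss1 -(opprB c) sqrrN.
- by move=> c _; rewrite lee_fin mulr_ge0 ?gauss1_ge0.
- by rewrite lee_fin gauss_ge0.
by rewrite gauss1_conv// -EFinM cons_rVB gauss_cons.
Qed.

Lemma integrable_gauss n t (x : 'rV[R]_n) : 0 < t ->
  (lebesgue_rV n).-integrable setT (fun y => (gauss t (x - y))%:E).
Proof.
move=> t0; apply/integrableP; split; first by apply/measurable_EFinP; exact: measurable_gaussB.
under eq_integral do rewrite gee0_abs ?lee_fin ?gauss_ge0//.
by rewrite integral_gauss// ltry.
Qed.

End gauss_integral.

(** * Derivatives of the Gaussian *)

Section kernels.
Context {R : realType} {n : nat}.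
Implicit Types (x y z v w : 'rV[R]_n) (t s : R).

(** The derivatives of the Gaussian along v, along v and then w, and in time. *)
Definition gauss_d v t z : R := - (dot v z / (2 * t)) * gauss t z.

Definition gauss_dd v w t z : R :=
  (dot v z * dot w z / (4 * t ^+ 2) - dot v w / (2 * t)) * gauss t z.

Definition gauss_dt t z : R :=
  (dot z z / (4 * t ^+ 2) - n%:R / (2 * t)) * gauss t z.

Lemma gauss_dtE t z : gauss_dt t z = \sum_i gauss_dd (basis_rV i) (basis_rV i) t z.
Proof.
rewrite -mulr_suml; congr (_ * _); rewrite sumrB -!mulr_suml; congr (_ / _ - _ / _).
  by apply: eq_bigr => i _; rewrite dot_basis.
rewrite (eq_bigr (fun=> 1)) ?sumr_const ?card_ord// => i _.
by rewrite dot_basis mxE !eqxx.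
Qed.

Lemma is_derive_quad (a b c s : R) :
  is_derive s 1 (fun s => a + b * s + c * s ^+ 2) (b + 2 * c * s).
Proof.
rewrite (_ : (fun _ => _) = cst a + b \*: id + c \*: (id ^+ 2)).
  by apply: is_derive_eq; rewrite /GRing.scale/=; ring.
by apply/funext => r; rewrite !fctE.
Qed.

Lemma is_derive_gauss v t z s : 0 < t ->
  is_derive s 1 (fun s => gauss t (z + s *: v)) (gauss_d v t (z + s *: v)).
Proof.
move=> t0.
rewrite (_ : (fun _ => _) = peak t ^+ n \*: (expR \o (fun s => - (dot z z / (4 * t)) +
    - (dot v z / (2 * t)) * s + - (dot v v / (4 * t)) * s ^+ 2))).
  have := is_derive_quad (- (dot z z / (4 * t))) (- (dot v z / (2 * t))) (- (dot v v / (4 * t))) s.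
  move=> ?; apply: is_derive_eq.
  rewrite /gauss_d gaussE// /GRing.scale/= dotDr dotZr.
  rewrite (_ : - (dot (z + s *: v) (z + s *: v) / (4 * t)) = (- (dot z z / (4 * t)) + - (dot v z / (2 * t)) * s + - (dot v v / (4 * t)) * s ^+ 2)).
    by field; rewrite gt_eqF.
  by rewrite !(dotDl, dotDr, dotZl, dotZr) (dotC z v); field; rewrite gt_eqF.
apply/funext => r /=; rewrite gaussE//; congr (_ * expR _).
by rewrite !(dotDl, dotDr, dotZl, dotZr) (dotC z v); field; rewrite gt_eqF.
Qed.

Lemma is_derive_gauss_d v w t z s : 0 < t ->
  is_derive s 1 (fun s => gauss_d v t (z + s *: w)) (gauss_dd v w t (z + s *: w)).
Proof.
move=> t0.
rewrite (_ : (fun _ => _) = (fun s => - (dot v z / (2 * t)) + - (dot v w / (2 * t)) * s + 0 * s ^+ 2) * (fun s => gauss t (z + s *: w))).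
  have := is_derive_quad (- (dot v z / (2 * t))) (- (dot v w / (2 * t))) 0 s.
  have := is_derive_gauss w z s t0.
  move=> ? ?; apply: is_derive_eq.
  rewrite /gauss_dd /gauss_d /GRing.scale/= !(dotDr, dotZr).
  by field; rewrite gt_eqF.
apply/funext => r; rewrite /gauss_d !fctE; congr (_ * _).
by rewrite dotDr dotZr; field; rewrite gt_eqF.
Qed.

Lemma is_derive_gauss_t t z : 0 < t -> is_derive t 1 (gauss ^~ z) (gauss_dt t z).
Proof.
move=> t0.
have pkE (r : R) : 0 < r -> peak r ^+ n = expR (- (n%:R / 2) * ln (4 * pi * r)).
  move=> r0; have p0 : 0 < 4 * pi * r :> R by rewrite !mulr_gt0 ?pi_gt0.
  rewrite /peak exprVn -[in LHS](@lnK _ (4 * pi * r)) ?posrE//.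
  rewrite (_ : expR (ln (4 * pi * r)) = expR (ln (4 * pi * r) / 2) ^+ 2).
    rewrite sqrtr_sqr ger0_norm ?expR_ge0// -expRM_natl -expRN; congr expR; by field.
  by rewrite -expRM_natl; congr expR; field.
have E : \near t, expR (- (n%:R / 2) * ln (4 * pi * t) - dot z z / 4 * t^-1) = gauss t z.
  near=> r; have r0 : 0 < r by near: r; exact: lt_nbhsr.
  rewrite gaussE// pkE// -expRD; congr (expR (_ - _)); field.
  by rewrite gt_eqF.
apply: (near_eq_is_derive E).
rewrite (_ : (fun _ => _) = expR \o ((- (n%:R / 2)) \*: (@ln R \o ((4 * pi) \*: id)) - (dot z z / 4) \*: (fun r => (id r)^-1))); last first.
  by apply/funext => r; rewrite /= !fctE.
have p0 : 0 < 4 * pi * t :> R by rewrite !mulr_gt0 ?pi_gt0.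
have h1 : is_derive (((4 * pi) \*: (id : R -> R)) t) 1 (@ln R) (4 * pi * t)^-1 by exact: is_derive1_ln.
have h2 : is_derive t 1 (fun r : R => (id r)^-1) (- (t ^- 2)).
  apply: is_derive_eq; first by apply: is_deriveV; rewrite gt_eqF.
  by rewrite /GRing.scale/= mulr1.
apply: is_derive_eq.
rewrite /gauss_dt /= -[X in expR X]/(- (n%:R / 2) * ln (4 * pi * t) - dot z z / 4 * t^-1).
rewrite (nbhs_singleton E) /GRing.scale/= mulrC; congr (_ * _).
have := lt0r_neq0 (pi_gt0 R); move: (pi : R) => p p_neq0.
by field; rewrite (lt0r_neq0 t0).
Unshelve. all: by end_near. Qed.

Lemma gauss_bound t z : 0 < t -> `|gauss t z| <= domC n * gauss (4 * t) z.
Proof.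
move=> t0; rewrite ger0_norm ?gauss_ge0// -[leLHS]mul1r -[X in _ <= X * _]mul1r.
apply: gauss_dom_le => //; rewrite mul1r exprn_ege1// lerDl divr_ge0 ?dot_ge0//.
exact: ltW.
Qed.

Let q_ge0 t z : 0 < t -> 0 <= dot z z / t.
Proof. by move=> t0; rewrite divr_ge0 ?dot_ge0 ?ltW. Qed.

Let dot_bnd t v z : 0 < t -> `|dot v z| <= n%:R * `|v| * Num.sqrt t * (1 + dot z z / t).
Proof.
move=> t0; rewrite (le_trans (dot_norm _ _))// -!mulrA ler_wpM2l ?ler0n//.
by rewrite ler_wpM2l// norm_scaled_le.
Qed.

(** The derivatives are bounded by a wider Gaussian, with the power of t that
    the scaling of the Gaussian predicts. *)
Lemma gauss_d_bound v t z : 0 < t ->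
  `|gauss_d v t z| <= n%:R * `|v| / Num.sqrt t * domC n * gauss (4 * t) z.
Proof.
move=> t0; rewrite normrM (ger0_norm (gauss_ge0 _ _)).
have s0 : 0 < Num.sqrt t by rewrite sqrtr_gt0.
have c0 : 0 <= n%:R * `|v| / Num.sqrt t by rewrite divr_ge0// ?mulr_ge0 ?ler0n// ltW.
apply: gauss_dom_le => //.
have t20 : 0 < 2 * t by rewrite mulr_gt0.
rewrite normrN normrM normfV (gtr0_norm t20) ler_pdivrMr//.
rewrite (le_trans (dot_bnd _ _ t0))//.
have := q_ge0 z t0; set q := dot z z / t => q0.
rewrite (_ : n%:R * `|v| * Num.sqrt t = n%:R * `|v| / Num.sqrt t * t); last first.
  by rewrite -{3}(sqr_sqrtr (ltW t0)); field; rewrite gt_eqF.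
rewrite -!mulrA ler_wpM2l ?ler0n// ler_wpM2l// ler_wpM2l ?invr_ge0 ?(ltW s0)//.
rewrite [leRHS](_ : _ = t * (2 * (1 + q) ^+ 3)); last by ring.
by rewrite ler_pM2l//; nra.
Qed.

Let gauss_dd_aux v w t z : 0 < t ->
  `|dot v z * dot w z / (4 * t ^+ 2) - dot v w / (2 * t)| <=
  (n%:R ^+ 2 + n%:R) * `|v| * `|w| / t * (1 + dot z z / t) ^+ 2.
Proof.
move=> t0; rewrite (le_trans (ler_normB _ _))//.
have := q_ge0 z t0; have := dot_bnd v z t0; have := dot_bnd w z t0.
set q := dot z z / t => h1 h2 q0.
have h3 := ler_pM (normr_ge0 _) (normr_ge0 _) h2 h1.
have q1 : 1 <= (1 + q) ^+ 2 by rewrite exprn_ege1// lerDl.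
rewrite !normrM !normfV (gtr0_norm (_ : 0 < 4 * t ^+ 2)) ?mulr_gt0 ?exprn_gt0//.
rewrite (gtr0_norm (_ : 0 < 2 * t)) ?mulr_gt0//.
rewrite [leRHS](_ : _ = n%:R ^+ 2 * (`|v| * `|w|) * (1 + q) ^+ 2 / t +
  n%:R * (`|v| * `|w|) * (1 + q) ^+ 2 / t); last by ring.
rewrite lerD//.
  rewrite ler_pdivrMr ?mulr_gt0 ?exprn_gt0// (le_trans h3)//.
  rewrite [leLHS](_ : _ = n%:R ^+ 2 * (`|v| * `|w|) * (1 + q) ^+ 2 * Num.sqrt t ^+ 2); last by ring.
  rewrite (sqr_sqrtr (ltW t0)).
  rewrite [leRHS](_ : _ = n%:R ^+ 2 * (`|v| * `|w|) * (1 + q) ^+ 2 * (4 * t)); last by field; rewrite gt_eqF.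
  by rewrite ler_wpM2l ?mulr_ge0 ?ler0n ?sqr_ge0 ?addr_ge0// ler_peMl ?(ltW t0)// ler1n.
rewrite ler_pdivrMr ?mulr_gt0// (le_trans (dot_norm _ _))//.
rewrite [leRHS](_ : _ = n%:R * (`|v| * `|w|) * (2 * (1 + q) ^+ 2)); last by field; rewrite gt_eqF.
by rewrite -[leLHS]mulr1 ler_wpM2l ?mulr_ge0 ?ler0n//; lra.
Qed.

Lemma gauss_dd_bound v w t z : 0 < t ->
  `|gauss_dd v w t z| <= (n%:R ^+ 2 + n%:R) * `|v| * `|w| / t * domC n * gauss (4 * t) z.
Proof.
move=> t0; rewrite normrM (ger0_norm (gauss_ge0 _ _)).
have q0 := q_ge0 z t0.
have c0 : 0 <= (n%:R ^+ 2 + n%:R) * `|v| * `|w| / t.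
  by rewrite divr_ge0// ?mulr_ge0 ?addr_ge0 ?sqr_ge0 ?ler0n// ltW.
apply: gauss_dom_le => //; rewrite (le_trans (gauss_dd_aux _ _ _ t0))//.
by rewrite ler_wpM2l// ler_weXn2l// lerDl.
Qed.

(** The additional factor |z| improves the singularity from 1 / t to
    1 / sqrt t, which is integrable. *)
Lemma gauss_dd_bound_norm v w t z : 0 < t -> `|gauss_dd v w t z| * `|z| <=
  (n%:R ^+ 2 + n%:R) * `|v| * `|w| / Num.sqrt t * domC n * gauss (4 * t) z.
Proof.
move=> t0; rewrite normrM (ger0_norm (gauss_ge0 _ _)) mulrAC.
have q0 := q_ge0 z t0; have s0 : 0 < Num.sqrt t by rewrite sqrtr_gt0.
have c0 : 0 <= (n%:R ^+ 2 + n%:R) * `|v| * `|w|.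
  by rewrite ?mulr_ge0 ?addr_ge0 ?sqr_ge0 ?ler0n.
apply: gauss_dom_le => //.
rewrite (le_trans (ler_pM _ _ (gauss_dd_aux _ _ _ t0) (norm_scaled_le z t0)))//.
rewrite [leLHS](_ : _ = (n%:R ^+ 2 + n%:R) * `|v| * `|w| / Num.sqrt t * (1 + dot z z / t) ^+ 3)//.
set q := dot z z / t; rewrite -[in X in _ / X](sqr_sqrtr (ltW t0)).
by field; rewrite gt_eqF.
Qed.

Lemma gauss_dt_bound t z : 0 < t ->
  `|gauss_dt t z| <= n%:R * (n%:R ^+ 2 + n%:R) / t * domC n * gauss (4 * t) z.
Proof.
move=> t0; rewrite gauss_dtE (le_trans (ler_norm_sum _ _ _))//.
apply: (@le_trans _ _ (\sum_(i < n) (n%:R ^+ 2 + n%:R) / t * domC n * gauss (4 * t) z)).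
  apply: ler_sum => i _; rewrite (le_trans (gauss_dd_bound _ _ _ t0))//.
  have b1 : `|basis_rV i| <= 1 :> R.
    apply: norm_rV_le => // j; rewrite mxE eqxx/=.
    by case: (j == i); rewrite ?normr1 ?normr0.
  rewrite -!mulrA ler_wpM2l ?addr_ge0 ?sqr_ge0 ?ler0n// mulrA ler_piMl//.
    by rewrite !mulr_ge0 ?invr_ge0 ?(ltW t0)// ?gauss_ge0// ltW// domC_gt0.
  by rewrite -[1]mulr1 ler_pM.
rewrite sumr_const card_ord.
by rewrite (_ : n%:R * _ / t * _ * _ = ((n%:R ^+ 2 + n%:R) / t * domC n * gauss (4 * t) z) *+ n)// -[RHS]mulr_natl; ring.
Qed.

End kernels.

(** * Integrals depending on a parameter *)

Section parametric_integral.
Context {R : realType} d1 d2 (T1 : measurableType d1) (T2 : measurableType d2).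
Context (m2 : {sigma_finite_measure set T2 -> \bar R}).

Lemma measurable_Rintegral_param (F : T1 * T2 -> R) : measurable_fun setT F ->
  measurable_fun setT (fun x => \int[m2]_y F (x, y)).
Proof.
move=> mF; apply: (@measurableT_comp _ _ _ _ _ _ (@fine R)) => //.
rewrite (_ : (fun _ => _) = fun x =>
   (\int[m2]_y (EFin \o F)^\+ (x, y) - \int[m2]_y (EFin \o F)^\- (x, y))%E); last first.
  apply/funext => x; rewrite [LHS]integralE.
  congr (_ - _)%E; apply: eq_integral => y _.
    exact: (congr1 (@^~ y) (funepos_comp (EFin \o F) (pair x))).
  exact: (congr1 (@^~ y) (funeneg_comp (EFin \o F) (pair x))).
have mF' : measurable_fun setT (EFin \o F) by exact/measurable_EFinP.
apply: emeasurable_funB.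
- by apply: (measurable_fun_fubini_tonelli_F ((EFin \o F)^\+)%E) => //; exact: measurable_funepos.
- by apply: (measurable_fun_fubini_tonelli_F ((EFin \o F)^\-)%E) => //; exact: measurable_funeneg.
Qed.

End parametric_integral.

Section dominated.
Context {R : realType} d (T : measurableType d) (mu : {measure set T -> \bar R}).

Lemma Rintegral_bound (f g : T -> R) (D : set T) : measurable D ->
  measurable_fun D f -> mu.-integrable D (EFin \o g) ->
  (forall x, D x -> `|f x| <= g x) ->
  mu.-integrable D (EFin \o f) /\ `|\int[mu]_(x in D) f x| <= \int[mu]_(x in D) g x.
Proof.
move=> mD mf ig fg.
have i_f : mu.-integrable D (EFin \o f).
  apply: (le_integrable mD _ _ ig); first exact/measurable_EFinP.
  by move=> x Dx; rewrite lee_fin (le_trans (fg _ Dx))// ler_norm.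
split=> //; rewrite (le_trans (le_normr_Rintegral mD i_f))//.
by apply: le_Rintegral => //; exact: integrable_norm.
Qed.

Lemma Rdominated_cvg (f_ : nat -> T -> R) (f g : T -> R) (D : set T) : measurable D ->
  (forall k, measurable_fun D (f_ k)) -> mu.-integrable D (EFin \o g) ->
  (\forall k \near \oo, forall x, D x -> `|f_ k x| <= g x) ->
  (forall x, D x -> f_ k x @[k --> \oo] --> f x) ->
  \int[mu]_(x in D) f_ k x @[k --> \oo] --> \int[mu]_(x in D) f x.
Proof.
move=> mD mf ig [N _ fg] ff.
rewrite -(cvg_shiftn N).
have fg' k x : D x -> `|f_ (k + N)%N x| <= g x by move=> Dx; apply: fg => //=; exact: leq_addl.
have ff' x : D x -> f_ (k + N)%N x @[k --> \oo] --> f x.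
  by move=> Dx; have := ff x Dx; rewrite -(cvg_shiftn N).
have mf' : measurable_fun D f by apply: (measurable_fun_cvg _ ff').
have fgl x : D x -> `|f x| <= g x.
  move=> Dx; have h := cvg_norm (ff' x Dx).
  by apply: (closed_cvg _ (@closed_le R (g x)) _ _ (h _)); apply: nearW => k; exact: fg'.
have [i_f _] := Rintegral_bound mD mf' ig fgl.
apply: fine_cvg; rewrite fineK; last exact: integrable_fin_num.
apply: (@dominated_cvg _ _ _ _ _ mD (fun k x => (f_ (k + N)%N x)%:E) (EFin \o f) (EFin \o g)) => //.
- by move=> k; exact/measurable_EFinP.
- by move=> x Dx; apply: cvg_EFin; [exact: nearW|exact: ff'].
Qed.

Lemma integrable_scale (D : set T) (c : R) (g : T -> R) : measurable D ->
  mu.-integrable D (EFin \o g) -> mu.-integrable D (EFin \o (fun x => c * g x)).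
Proof.
move=> mD ig.
by rewrite (_ : _ \o _ = fun x => (c%:E * (g x)%:E)%E); [exact: integrableZl|exact/funext].
Qed.

(** Differentiation under the integral sign, with the domination required only
    near the point. *)
Lemma is_derive_Rintegral (f df : R -> T -> R) (g : T -> R) (D : set T) (a b s : R) :
  measurable D -> a < s < b -> (forall r, a < r < b -> mu.-integrable D (EFin \o f r)) ->
  (forall r x, a < r < b -> D x -> is_derive r 1 (f ^~ x) (df r x)) ->
  mu.-integrable D (EFin \o g) -> (forall x, 0 <= g x) ->
  (forall r x, a < r < b -> D x -> `|df r x| <= g x) ->
  is_derive s 1 (fun r => \int[mu]_(x in D) f r x) (\int[mu]_(x in D) df s x).
Proof.
move=> mD sab fi fd ig g0 dg.
have I0 : `]a, b[%classic s by rewrite /= in_itv.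
have dE r x : a < r < b -> D x -> partial1of2 f r x = df r x.
  by move=> rab Dx; rewrite partial1of2E; have [_ ->] := fd r x rab Dx.
have H := @cvg_differentiation_under_integral R _ _ mu f D mD s a b I0 _ _ g _ ig _.
suff H' : h^-1 *: (\int[mu]_(x in D) f (h *: 1 + s) x - \int[mu]_(x in D) f s x) @[h --> 0^'] -->
    \int[mu]_(x in D) df s x.
  apply: DeriveDef; first by apply/cvg_ex; exists (\int[mu]_(x in D) df s x).
  exact/cvg_lim.
rewrite (_ : \int[mu]_(x in D) df s x = \int[mu]_(x in D) partial1of2 f s x); last first.
  by apply: eq_Rintegral => x /set_mem Dx; rewrite dE.
rewrite (_ : (fun _ => _) = (fun h : R => h^-1 *: (\int[mu]_(x in D) f (h + s) x - \int[mu]_(x in D) f s x))).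
  apply: H => //.
  - by move=> r x; rewrite /= in_itv/= => rab Dx; have [] := fd r x rab Dx.
  - by move=> r x; rewrite /= in_itv/= => rab Dx; rewrite dE//; exact: dg.
by apply/funext => h; rewrite [h%:A]mulr1.
Qed.

Lemma Rintegral_sum (I : Type) (r : seq I) (F : I -> T -> R) (D : set T) : measurable D ->
  (forall i, mu.-integrable D (EFin \o F i)) ->
  mu.-integrable D (EFin \o (fun x => \sum_(i <- r) F i x)) /\
  \int[mu]_(x in D) (\sum_(i <- r) F i x) = \sum_(i <- r) \int[mu]_(x in D) F i x.
Proof.
move=> mD iF; elim: r => [|i r [IH1 IH2]].
  rewrite big_nil; under [X in EFin \o X]eq_fun do rewrite big_nil.
  split; first exact: integrable0.
  by under eq_Rintegral do rewrite big_nil; rewrite /Rintegral integral0.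
rewrite big_cons -IH2 -RintegralD//.
under [X in EFin \o X]eq_fun do rewrite big_cons.
under eq_Rintegral do rewrite big_cons.
split=> //; move: (integrableD mD (iF i) IH1); exact: eq_integrable.
Qed.

End dominated.

Section derive_line.
Context {R : realType} {V : normedModType R} (F : V -> R) (x v : V).

Let lineE (s : R) :
  (fun h : R => h^-1 *: (((fun s0 => F (x + s0 *: v)) \o shift s) (h *: 1) - F (x + s *: v))) =
  (fun h : R => h^-1 *: ((F \o shift (x + s *: v)) (h *: v) - F (x + s *: v))).
Proof.
apply/funext => h /=; congr (_ *: (F _ - _)).
by rewrite [h%:A]mulr1 scalerDl addrCA.
Qed.

Lemma is_derive_line (s d : R) :
  is_derive (x + s *: v) v F d -> is_derive s 1 (fun s => F (x + s *: v)) d.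
Proof. by move=> [dF <-]; apply: DeriveDef; rewrite /derivable ?/derive lineE. Qed.

Lemma is_derive_of_line (d : R) :
  is_derive (0 : R) 1 (fun s => F (x + s *: v)) d -> is_derive x v F d.
Proof.
move=> [dF <-]; suff: is_derive (x + 0 *: v) v F ('D_1 (fun s : R => F (x + s *: v)) 0).
  by rewrite scale0r addr0.
by apply: DeriveDef; rewrite /derivable ?/derive -lineE.
Qed.

End derive_line.

Section cvge0.
Context {R : realType} {T : Type} (F : set_system T) {FF : Filter F}.

Lemma ge0_cvge0P (u : T -> \bar R) : (forall x, 0 <= u x)%E ->
  u @ F --> 0%E <-> forall e : R, 0 < e -> \forall x \near F, (u x <= e%:E)%E.
Proof.
move=> u0; split=> [/fine_cvgP[fin /cvgrPdist_le h] e e0|h].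
  have he := h e e0; near=> x.
  have fx : u x \is a fin_num by near: x.
  rewrite -(fineK fx) lee_fin (le_trans (ler_norm _))// -[leLHS]normrN -sub0r.
  by near: x.
have fin (e : R) x : (u x <= e%:E)%E -> u x \is a fin_num.
  by move=> ux; rewrite ge0_fin_numE// (le_lt_trans ux)// ltry.
apply/fine_cvgP; split; first by apply: filterS (h 1 ltr01) => x; exact: fin.
apply/cvgrPdist_le => e e0; apply: filterS (h e e0) => x ux.
by rewrite sub0r normrN ger0_norm ?fine_ge0// -lee_fin fineK//; exact: fin ux.
Unshelve. all: by end_near. Qed.

End cvge0.

Section sequential.
Context {R : realType}.

(** Dominated convergence is a statement on sequences; this makes it available
    for continuity. *)
Lemma continuous_at_seq (Z : pseudoMetricType R) (f : Z -> R) (z : Z) :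
  (forall w : nat -> Z, w k @[k --> \oo] --> z -> f (w k) @[k --> \oo] --> f z) ->
  f x @[x --> z] --> f z.
Proof.
move=> h; apply/cvgrPdist_lt => e e0; apply/not_notP => nh.
have H k : exists w, ball z (k.+1%:R^-1) w /\ ~ (`|f z - f w| < e).
  apply/not_existsP => H; apply: nh.
  apply/nbhs_ballP; exists k.+1%:R^-1 => /=; first by rewrite invr_gt0.
  by move=> w zw; apply/not_notP => nw; exact: (H w).
have [w Hw] := choice H.
have wz : w k @[k --> \oo] --> z.
  apply/cvg_ballP => r r0; near=> k.
  apply: (@le_ball _ _ _ k.+1%:R^-1); last by have [] := Hw k.
  by apply: ltW; near: k; exact: near_infty_natSinv_lt (PosNum r0).
have /cvgrPdist_lt /(_ e e0) [N _ hN] := h w wz.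
by have [_] := Hw N; apply; apply: hN => /=.
Unshelve. all: by end_near. Qed.

End sequential.

(** * Convolution with the Gaussian and its derivatives *)

Section gauss_convolution.
Context {R : realType} {n : nat}.
Local Notation mu := (@lebesgue_rV R n).
Implicit Types (x y z v w : 'rV[R]_n) (t s M : R) (h : 'rV[R]_n -> R) (K : R -> 'rV[R]_n -> R).

Definition gconv (k h : 'rV[R]_n -> R) x : R := \int[mu]_y (k (x - y) * h y).

Lemma gconv_gauss_le0 t h x : t <= 0 -> gconv (gauss t) h x = 0.
Proof.
move=> t0; rewrite /gconv; under eq_Rintegral do rewrite gauss_le0// mul0r.
by rewrite /Rintegral integral0.
Qed.

Lemma cvg_exprn (u_ : nat -> R) (u : R) m : u_ k @[k --> \oo] --> u ->
  u_ k ^+ m @[k --> \oo] --> u ^+ m.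
Proof.
move=> hu; elim: m => [|m IH]; first by under eq_cvg do rewrite expr0; exact: cvg_cst.
by rewrite exprS; under eq_cvg do rewrite exprS; exact: cvgM.
Qed.

Lemma dot_cvg (v_ w_ : nat -> 'rV[R]_n) v w : v_ k @[k --> \oo] --> v ->
  w_ k @[k --> \oo] --> w -> dot (v_ k) (w_ k) @[k --> \oo] --> dot v w.
Proof.
move=> hv hw.
have c (u_ : nat -> 'rV[R]_n) (u : 'rV[R]_n) i : u_ k @[k --> \oo] --> u -> u_ k ord0 i @[k --> \oo] --> u ord0 i.
  by move=> hu; apply: (@cvg_comp _ _ _ u_ (fun u : 'rV[R]_n => u ord0 i) _ _ _ hu); exact: coord_continuous.
have : forall s : seq 'I_n, \sum_(i <- s) v_ k ord0 i * w_ k ord0 i @[k --> \oo] -->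
    \sum_(i <- s) v ord0 i * w ord0 i; last by apply.
elim=> [|i s IH]; first by under eq_cvg do rewrite big_nil; rewrite big_nil; exact: cvg_cst.
under eq_cvg do rewrite big_cons; rewrite big_cons.
by apply: cvgD => //; apply: cvgM; exact: c.
Qed.

Lemma gauss_int_bound (F : 'rV[R]_n -> R) t x B : 0 < t ->
  measurable_fun [set: 'rV[R]_n] F -> (forall y, `|F y| <= B * gauss t (x - y)) ->
  mu.-integrable setT (EFin \o F) /\ `|\int[mu]_y F y| <= B.
Proof.
move=> t0 mF FB.
have iG := integrable_gauss x t0.
have iBG : mu.-integrable setT (EFin \o (fun y => B * gauss t (x - y))).
  exact: integrable_scale.
have [iF] := Rintegral_bound measurableT mF iBG (fun y _ => FB y).
rewrite RintegralZl//= [X in B * X](_ : _ = 1) ?mulr1//.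
by rewrite /Rintegral integral_gauss.
Qed.

(** The common features of the Gaussian and of its derivatives on which the
    convolution theorems rest; A is the amplitude, which may blow up at time zero. *)
Definition gkernel K (A : R -> R) :=
  [/\ measurable_fun [set: R * 'rV[R]_n] (fun p => K p.1 p.2),
      forall t z, 0 < t -> `|K t z| <= A t * gauss (4 * t) z,
      forall s t, 0 < s -> s <= t -> 0 <= A t <= A s &
      forall (t_ : nat -> R) (z_ : nat -> 'rV[R]_n) t z, 0 < t ->
        t_ k @[k --> \oo] --> t -> z_ k @[k --> \oo] --> z ->
        K (t_ k) (z_ k) @[k --> \oo] --> K t z].

Lemma measurable_gkernel K A d (T : measurableType d) (f : T -> R) (g : T -> 'rV[R]_n) :
  gkernel K A -> measurable_fun setT f -> measurable_fun setT g ->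
  measurable_fun setT (fun a => K (f a) (g a)).
Proof.
move=> [mK _ _ _] mf mg.
apply: (@measurableT_comp _ _ _ _ _ _ (fun p : R * 'rV[R]_n => K p.1 p.2) _ (fun a => (f a, g a))) => //.
exact: measurable_fun_pair.
Qed.

Lemma measurable_conv_integrand K A t h x : gkernel K A ->
  measurable_fun [set: 'rV[R]_n] h -> measurable_fun [set: 'rV[R]_n] (fun y => K t (x - y) * h y).
Proof.
move=> gK mh; apply: measurable_funM => //.
apply: (measurable_gkernel gK) => //.
by apply: measurable_rVB => //; exact: measurable_cst.
Qed.

Lemma conv_bound K A t h x M : gkernel K A -> 0 < t ->
  measurable_fun [set: 'rV[R]_n] h -> (forall y, `|h y| <= M) ->
  mu.-integrable setT (EFin \o (fun y => K t (x - y) * h y)) /\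
  `|gconv (K t) h x| <= A t * M.
Proof.
move=> gK t0 mh hM; have [_ KA A0 _] := gK.
apply: (@gauss_int_bound _ (4 * t) x) => //; first by rewrite mulr_gt0.
  exact: measurable_conv_integrand gK mh.
move=> y; rewrite normrM mulrAC ler_pM//; exact: KA.
Qed.

Lemma gkernel_locdom K A t r : gkernel K A -> 0 < t -> 0 <= r ->
  exists2 C : R, 0 <= C & forall t' z y, t / 2 <= t' <= 2 * t -> `|y| <= r ->
    `|K t' (z + y)| <= C * gauss (16 * t) z.
Proof.
move=> [_ KA A0 _] t0 r0; have [C C0 HC] := @gauss_locdom R n _ _ t0 r0.
have t20 : 0 < t / 2 by rewrite divr_gt0.
exists (A (t / 2) * C).
  by rewrite mulr_ge0//; have /andP[] := A0 _ _ t20 (lexx _).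
move=> t' z y /andP[t1 t2] yr.
have t'0 : 0 < t' := lt_le_trans t20 t1.
rewrite (le_trans (KA _ _ t'0))// -mulrA ler_pM ?gauss_ge0//.
- by have /andP[] := A0 _ _ t'0 (lexx _).
- by have /andP[] := A0 _ _ t20 t1.
- by apply: HC => //; rewrite t1.
Qed.

Lemma conv_cvg K A (h_ : nat -> 'rV[R]_n -> R) h M (t_ : nat -> R) (x_ : nat -> 'rV[R]_n) t x :
  gkernel K A -> (forall k, measurable_fun [set: 'rV[R]_n] (h_ k)) ->
  (forall k y, `|h_ k y| <= M) -> (forall y, h_ k y @[k --> \oo] --> h y) -> 0 < t ->
  t_ k @[k --> \oo] --> t -> x_ k @[k --> \oo] --> x ->
  gconv (K (t_ k)) (h_ k) (x_ k) @[k --> \oo] --> gconv (K t) h x.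
Proof.
move=> gK mh hM hh t0 tt xx.
have [C C0 HC] := gkernel_locdom gK t0 ler01.
have t160 : 0 < 16 * t by rewrite mulr_gt0.
apply: (@Rdominated_cvg _ _ _ _ _ _ (fun y => C * M * gauss (16 * t) (x - y))) => //.
- by move=> k; exact: measurable_conv_integrand gK (mh k).
- by apply: integrable_scale => //; exact: integrable_gauss.
- have n1 : \forall k \near \oo, `|t - t_ k| < t / 2.
    by move/cvgrPdist_lt : tt; apply; rewrite divr_gt0.
  have n2 : \forall k \near \oo, `|x - x_ k| < 1 by move/cvgrPdist_lt : xx; apply.
  near=> k => y _.
  have h1 : `|t - t_ k| < t / 2 by near: k.
  have h2 : `|x - x_ k| < 1 by near: k.
  rewrite normrM mulrAC ler_pM//.
  rewrite (_ : x_ k - y = (x - y) + (x_ k - x)); last by rewrite [RHS]addrC addrA subrK.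
  apply: HC; last by rewrite distrC ltW.
  by move: h1; rewrite ltr_norml => /andP[? ?]; apply/andP; split; lra.
- move=> y _; apply: cvgM; last exact: hh.
  have [_ _ _ cK] := gK; apply: cK => //.
  by apply: cvgB => //; exact: cvg_cst.
Unshelve. all: by end_near. Qed.

Lemma conv_is_derive K A K' A' v h M t x : gkernel K A -> gkernel K' A' ->
  (forall z s, is_derive s 1 (fun s => K t (z + s *: v)) (K' t (z + s *: v))) ->
  measurable_fun [set: 'rV[R]_n] h -> (forall y, `|h y| <= M) -> 0 < t ->
  is_derive x v (gconv (K t) h) (gconv (K' t) h x).
Proof.
move=> gK gK' dK mh hM t0.
have [C C0 HC] := gkernel_locdom gK' t0 (normr_ge0 v).
have t160 : 0 < 16 * t by rewrite mulr_gt0.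
have M0 : 0 <= M := le_trans (normr_ge0 _) (hM x).
have shf s y : x + s *: v - y = (x - y) + s *: v by rewrite addrAC.
have I0 : -1 < (0 : R) < 1 by rewrite ltrN10 ltr01.
apply: is_derive_of_line; rewrite -[in gconv _ _ x](addr0 x) -(scale0r v).
apply: (@is_derive_Rintegral R _ _ mu (fun s y => K t (x + s *: v - y) * h y)
  (fun s y => K' t (x + s *: v - y) * h y) (fun y => C * M * gauss (16 * t) (x - y)) setT (-1) 1) => //.
- by move=> s _; exact: (conv_bound (x + s *: v) gK t0 mh hM).1.
- move=> s y _ _; rewrite (_ : (fun _ => _) = (h y) \*: (fun s => K t ((x - y) + s *: v))); last first.
    by apply/funext => r; rewrite shf mulrC.
  by apply: is_derive_eq; rewrite shf mulrC.
- by apply: integrable_scale => //; exact: integrable_gauss.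
- by move=> y; rewrite mulr_ge0 ?gauss_ge0// mulr_ge0.
- move=> s y /andP[s1 s2] _; rewrite normrM mulrAC ler_pM// shf; apply: HC.
    by apply/andP; split; lra.
  by rewrite normrZ ler_piMl// ltW// ltr_norml s1.
Qed.

Lemma conv_is_derive_t K A K' A' h M t x : gkernel K A -> gkernel K' A' ->
  (forall z s, 0 < s -> is_derive s 1 (K ^~ z) (K' s z)) ->
  measurable_fun [set: 'rV[R]_n] h -> (forall y, `|h y| <= M) -> 0 < t ->
  is_derive t 1 (fun t => gconv (K t) h x) (gconv (K' t) h x).
Proof.
move=> gK gK' dK mh hM t0.
have [C C0 HC] := gkernel_locdom gK' t0 (lexx 0).
have t160 : 0 < 16 * t by rewrite mulr_gt0.
have M0 : 0 <= M := le_trans (normr_ge0 _) (hM x).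
have I0 : t / 2 < t < 2 * t by apply/andP; split; lra.
have Ipos (s : R) : t / 2 < s < 2 * t -> 0 < s.
  by move=> /andP[+ _]; apply: lt_trans; rewrite divr_gt0.
apply: (@is_derive_Rintegral R _ _ mu (fun s y => K s (x - y) * h y)
  (fun s y => K' s (x - y) * h y) (fun y => C * M * gauss (16 * t) (x - y)) setT (t / 2) (2 * t)) => //.
- by move=> s /Ipos s0; exact: (conv_bound x gK s0 mh hM).1.
- move=> s y /Ipos s0 _; rewrite (_ : (fun _ => _) = (h y) \*: (K ^~ (x - y))); last first.
    by apply/funext => r; rewrite mulrC.
  by have := dK (x - y) s s0 => ?; apply: is_derive_eq; rewrite mulrC.
- by apply: integrable_scale => //; exact: integrable_gauss.
- by move=> y; rewrite mulr_ge0 ?gauss_ge0// mulr_ge0.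
- move=> s y /[dup] /Ipos s0 /andP[s1 s2] _; rewrite normrM mulrAC ler_pM//.
  by have := HC s (x - y) 0; rewrite addr0 normr0; apply => //; rewrite !ltW.
Qed.

Lemma gkernel_gauss : gkernel gauss (fun=> domC n).
Proof.
split.
- exact: measurable_gauss.
- by move=> t z t0; exact: gauss_bound.
- by move=> s t s0 st; rewrite lexx ltW// domC_gt0.
- move=> t_ z_ t z t0 tt zz.
  have ev : \forall k \near \oo, peak (t_ k) ^+ n * expR (- (dot (z_ k) (z_ k) / (4 * t_ k))) = gauss (t_ k) (z_ k).
    near=> k; rewrite gaussE//.
    by near: k; exact: (cvgr_gt t).
  apply: cvg_trans; first exact: (near_eq_cvg ev).
  rewrite gaussE//; apply: cvgM.
    have : peak (t_ k) @[k --> \oo] --> peak t.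
      apply: cvgV; first by rewrite gt_eqF// sqrtr_gt0 !mulr_gt0// pi_gt0.
      apply: continuous_cvg; first exact: sqrt_continuous.
      by apply: cvgM => //; exact: cvg_cst.
    exact: cvg_exprn.
  apply: continuous_cvg; first exact: continuous_expR.
  apply: cvgN; apply: cvgM.
    by apply: dot_cvg.
  apply: cvgV; first by rewrite gt_eqF// mulr_gt0.
  by apply: cvgM => //; exact: cvg_cst.
Unshelve. all: by end_near. Qed.

(** The derivatives are the Gaussian times a factor that is polynomial in z, so
    that only this factor remains to be examined. *)
Lemma gkernel_mul (p : R -> 'rV[R]_n -> R) (A : R -> R) :
  measurable_fun [set: R * 'rV[R]_n] (fun q => p q.1 q.2) ->
  (forall t z, 0 < t -> `|p t z * gauss t z| <= A t * gauss (4 * t) z) ->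
  (forall s t, 0 < s -> s <= t -> 0 <= A t <= A s) ->
  (forall (t_ : nat -> R) (z_ : nat -> 'rV[R]_n) t z, 0 < t ->
        t_ k @[k --> \oo] --> t -> z_ k @[k --> \oo] --> z ->
        p (t_ k) (z_ k) @[k --> \oo] --> p t z) ->
  gkernel (fun t z => p t z * gauss t z) A.
Proof.
move=> mp pA AA pc; have [mG _ _ cG] := gkernel_gauss; split => //.
  exact: measurable_funM.
by move=> t_ z_ t z t0 tt zz; apply: cvgM; [exact: pc|exact: cG].
Qed.

(** Amplitudes, in the sense of [gkernel], of the first, second and time
    derivatives. *)
Definition A1 v t : R := n%:R * `|v| * domC n / Num.sqrt t.
Definition A2 v w t : R := (n%:R ^+ 2 + n%:R) * `|v| * `|w| * domC n / t.
Definition At t : R := n%:R * (n%:R ^+ 2 + n%:R) * domC n / t.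

Let mono_inv (c s t : R) : 0 <= c -> 0 < s -> s <= t -> 0 <= c / t <= c / s.
Proof.
move=> c0 s0 st; have t0 := lt_le_trans s0 st.
by rewrite divr_ge0 ?(ltW t0)//= ler_wpM2l// lef_pV2.
Qed.

Let mz : measurable_fun [set: R * 'rV[R]_n] (fun q : R * 'rV[R]_n => q.2).
Proof. exact: measurable_snd. Qed.

Let mt : measurable_fun [set: R * 'rV[R]_n] (fun q : R * 'rV[R]_n => q.1).
Proof. exact: measurable_fst. Qed.

Lemma gkernel_gauss_d v : gkernel (gauss_d v) (A1 v).
Proof.
apply: (@gkernel_mul (fun t z => - (dot v z / (2 * t)))).
- apply: measurableT_comp => //; apply: measurable_funM; first exact: measurable_dot.
  by apply: (measurableT_comp measurable_invr); exact: measurable_funM.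
- by move=> t z t0; rewrite (le_trans (gauss_d_bound _ _ t0))// /A1 [X in X * _]mulrAC.
- move=> s t s0 st; apply: mono_inv; rewrite ?sqrtr_gt0 ?ler_wsqrtr//.
  by rewrite !mulr_ge0// ?ler0n// ltW// domC_gt0.
- move=> t_ z_ t z t0 tt zz; apply: cvgN; apply: cvgM.
    by apply: dot_cvg => //; exact: cvg_cst.
  apply: cvgV; first by rewrite gt_eqF// mulr_gt0.
  by apply: cvgM => //; exact: cvg_cst.
Qed.

Lemma gkernel_gauss_dd v w : gkernel (gauss_dd v w) (A2 v w).
Proof.
apply: (@gkernel_mul (fun t z => dot v z * dot w z / (4 * t ^+ 2) - dot v w / (2 * t))).
- apply: measurable_funB; apply: measurable_funM.
  + by apply: measurable_funM; exact: measurable_dot.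
  + by apply: (measurableT_comp measurable_invr); apply: measurable_funM => //; exact: measurable_funX.
  + exact: measurable_cst.
  + by apply: (measurableT_comp measurable_invr); exact: measurable_funM.
- by move=> t z t0; rewrite (le_trans (gauss_dd_bound _ _ _ t0))// /A2 [X in X * _]mulrAC.
- move=> s t s0 st; apply: mono_inv => //.
  by rewrite !mulr_ge0// ?addr_ge0 ?sqr_ge0 ?ler0n// ltW// domC_gt0.
- move=> t_ z_ t z t0 tt zz; apply: cvgB; apply: cvgM.
  + by apply: cvgM; apply: dot_cvg => //; exact: cvg_cst.
  + apply: cvgV; first by rewrite gt_eqF// mulr_gt0// exprn_gt0.
    apply: cvgM; first exact: cvg_cst.
    exact: cvg_exprn.
  + exact: cvg_cst.
  + apply: cvgV; first by rewrite gt_eqF// mulr_gt0.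
    by apply: cvgM => //; exact: cvg_cst.
Qed.

Lemma gkernel_gauss_dt : gkernel gauss_dt At.
Proof.
apply: (@gkernel_mul (fun t z => dot z z / (4 * t ^+ 2) - n%:R / (2 * t))).
- apply: measurable_funB; apply: measurable_funM.
  + exact: measurable_dot.
  + by apply: (measurableT_comp measurable_invr); apply: measurable_funM => //; exact: measurable_funX.
  + exact: measurable_cst.
  + by apply: (measurableT_comp measurable_invr); exact: measurable_funM.
- by move=> t z t0; rewrite (le_trans (gauss_dt_bound _ t0))// /At [X in X * _]mulrAC.
- move=> s t s0 st; apply: mono_inv => //.
  by rewrite !mulr_ge0// ?addr_ge0 ?sqr_ge0 ?ler0n// ltW// domC_gt0.
- move=> t_ z_ t z t0 tt zz; apply: cvgB; apply: cvgM.
  + exact: dot_cvg.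
  + apply: cvgV; first by rewrite gt_eqF// mulr_gt0// exprn_gt0.
    apply: cvgM; first exact: cvg_cst.
    exact: cvg_exprn.
  + exact: cvg_cst.
  + apply: cvgV; first by rewrite gt_eqF// mulr_gt0.
    by apply: cvgM => //; exact: cvg_cst.
Qed.

End gauss_convolution.

(** * Convolution estimates for bounded and Lipschitz functions *)

Section mean_value.
Context {R : realType}.

Lemma mvt_bound (f df : R -> R) (a b C : R) : a <= b ->
  (forall x, a <= x <= b -> is_derive x 1 f (df x)) ->
  (forall x, a <= x <= b -> `|df x| <= C) -> `|f b - f a| <= C * (b - a).
Proof.
rewrite le_eqVlt => /predU1P[<-|ab] dfx dfC; first by rewrite !subrr normr0 mulr0.
have H1 x : x \in `]a, b[ -> is_derive x 1 f (df x).
  by rewrite in_itv/= => /andP[ac cb]; apply: dfx; rewrite !ltW.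
have H2 : {within `[a, b], continuous f}.
  apply: derivable_within_continuous => x; rewrite in_itv/= => xab.
  by have [] := dfx x xab.
have [c cab ->] := MVT ab H1 H2.
rewrite normrM (gtr0_norm (_ : 0 < b - a)) ?subr_gt0//.
rewrite ler_wpM2r ?subr_ge0 ?(ltW ab)// dfC//.
by move: cab; rewrite in_itv/= => /andP[ac cb]; rewrite !ltW.
Qed.

End mean_value.

Section conv_estimates.
Context {R : realType} {n : nat}.
Local Notation mu := (@lebesgue_rV R n).
Implicit Types (x y z v w : 'rV[R]_n) (t s M L : R) (h : 'rV[R]_n -> R).

Definition lipschitz_rV h L := forall x y, `|h x - h y| <= L * `|x - y|.

Lemma conv_gauss_cst t x (c : R) : 0 < t -> gconv (gauss t) (fun=> c) x = c.
Proof.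
move=> t0; rewrite /gconv RintegralZr//; last exact: integrable_gauss.
by rewrite [X in X * _](_ : _ = 1) ?mul1r// /Rintegral integral_gauss.
Qed.

Let bnd1 (c : R) (y : 'rV[R]_n) : `|c| <= `|c|. Proof. by []. Qed.

(** The Gaussian has constant mass, hence its derivatives have integral zero. *)
Lemma conv_gauss_d_cst v t x (c : R) : 0 < t -> gconv (gauss_d v t) (fun=> c) x = 0.
Proof.
move=> t0.
have [_ <-] := @conv_is_derive R n _ _ _ _ v (fun=> c) `|c| t x gkernel_gauss
  (gkernel_gauss_d v) (fun z s => is_derive_gauss v z s t0) (measurable_cst _) (bnd1 c) t0.
rewrite (_ : gconv _ _ = cst c) ?derive_cst//.
by apply/funext => y; exact: conv_gauss_cst.
Qed.

Lemma conv_gauss_dd_cst v w t x (c : R) : 0 < t -> gconv (gauss_dd v w t) (fun=> c) x = 0.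
Proof.
move=> t0.
have [_ <-] := @conv_is_derive R n _ _ _ _ w (fun=> c) `|c| t x (gkernel_gauss_d v)
  (gkernel_gauss_dd v w) (fun z s => is_derive_gauss_d v w z s t0) (measurable_cst _) (bnd1 c) t0.
rewrite (_ : gconv _ _ = cst 0) ?derive_cst//.
by apply/funext => y; exact: conv_gauss_d_cst.
Qed.

Lemma conv_gauss_dtE t h x M : 0 < t -> measurable_fun [set: 'rV[R]_n] h ->
  (forall y, `|h y| <= M) ->
  gconv (gauss_dt t) h x = \sum_i gconv (gauss_dd (basis_rV i) (basis_rV i) t) h x.
Proof.
move=> t0 mh hM; rewrite /gconv.
have ii i : mu.-integrable setT (EFin \o (fun y => gauss_dd (basis_rV i) (basis_rV i) t (x - y) * h y)).
  by have [] := conv_bound x (gkernel_gauss_dd (basis_rV i) (basis_rV i)) t0 mh hM.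
rewrite -(Rintegral_sum (index_enum _) measurableT ii).2; apply: eq_Rintegral => y _.
by rewrite gauss_dtE mulr_suml.
Qed.

(** As the kernel has integral zero, h may be replaced by h - h x, whose
    Lipschitz bound cancels half of the singularity ([gauss_dd_bound_norm]). *)
Lemma conv_gauss_dd_lip v w t h x M L : 0 < t -> measurable_fun [set: 'rV[R]_n] h ->
  (forall y, `|h y| <= M) -> lipschitz_rV h L -> 0 <= L ->
  `|gconv (gauss_dd v w t) h x| <= (n%:R ^+ 2 + n%:R) * `|v| * `|w| * domC n * L / Num.sqrt t.
Proof.
move=> t0 mh hM hL L0.
have gK := gkernel_gauss_dd v w.
have [ih _] := conv_bound x gK t0 mh hM.
have [ic _] := @conv_bound R n _ _ t (fun=> h x) x `|h x| gK t0 (measurable_cst _) (bnd1 (h x)).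
rewrite -[gconv _ h x]subr0 -[X in _ - X](conv_gauss_dd_cst v w x (h x) t0) /gconv -RintegralB//.
have -> : (n%:R ^+ 2 + n%:R) * `|v| * `|w| * domC n * L / Num.sqrt t =
   L * ((n%:R ^+ 2 + n%:R) * `|v| * `|w| / Num.sqrt t * domC n) :> R by ring.
apply: (@gauss_int_bound _ _ _ (4 * t) x _ _ _ _).2 => //; first by rewrite mulr_gt0.
  apply: measurable_funB; apply: (measurable_conv_integrand _ _ gK) => //.
move=> y; rewrite -mulrBr normrM (le_trans (ler_wpM2l _ (hL _ _)))//.
rewrite mulrCA -[leRHS]mulrA ler_wpM2l//.
by rewrite -normrN opprB gauss_dd_bound_norm.
Qed.

Lemma conv_gauss_dt_lip t h x M L : 0 < t -> measurable_fun [set: 'rV[R]_n] h ->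
  (forall y, `|h y| <= M) -> lipschitz_rV h L -> 0 <= L ->
  `|gconv (gauss_dt t) h x| <= n%:R * ((n%:R ^+ 2 + n%:R) * domC n * L) / Num.sqrt t.
Proof.
move=> t0 mh hM hL L0; rewrite (conv_gauss_dtE _ t0 mh hM) (le_trans (ler_norm_sum _ _ _))//.
apply: (@le_trans _ _ (\sum_(i < n) (n%:R ^+ 2 + n%:R) * domC n * L / Num.sqrt t)).
  apply: ler_sum => i _; rewrite (le_trans (conv_gauss_dd_lip _ _ _ t0 mh hM hL L0))//.
  have b1 : `|basis_rV i| <= 1 :> R.
    apply: norm_rV_le => // j; rewrite mxE eqxx/=.
    by case: (j == i); rewrite ?normr1 ?normr0.
  rewrite ler_wpM2r ?invr_ge0 ?sqrtr_ge0// ler_wpM2r// ler_wpM2r ?(ltW (@domC_gt0 R n))//.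
  rewrite -mulrA ler_piMr ?addr_ge0 ?sqr_ge0 ?ler0n//.
  by rewrite -[1]mulr1 ler_pM.
by rewrite sumr_const card_ord -[leLHS]mulr_natl mulrA.
Qed.

Lemma conv_gauss_lip t h M x x' : 0 < t -> measurable_fun [set: 'rV[R]_n] h ->
  (forall y, `|h y| <= M) ->
  `|gconv (gauss t) h x' - gconv (gauss t) h x| <= n%:R * domC n * M * `|x' - x| / Num.sqrt t.
Proof.
move=> t0 mh hM; set v := x' - x.
have gK := gkernel_gauss_d v.
have := @mvt_bound R (fun s => gconv (gauss t) h (x + s *: v)) (fun s => gconv (gauss_d v t) h (x + s *: v))
  0 1 (A1 v t * M) ler01.
rewrite scale1r scale0r addr0 subr0 mulr1 (addrC x) subrK => H.
rewrite (le_trans (H _ _))//.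
- move=> s _; apply: is_derive_line.
  exact: (conv_is_derive _ gkernel_gauss gK (fun z s => is_derive_gauss v z s t0) mh hM t0).
- by move=> s _; exact: (conv_bound _ gK t0 mh hM).2.
- by rewrite /A1 le_eqVlt; apply/orP; left; apply/eqP; ring.
Qed.

Lemma conv_gauss_time t t' h M x : 0 < t -> t <= t' -> measurable_fun [set: 'rV[R]_n] h ->
  (forall y, `|h y| <= M) ->
  `|gconv (gauss t') h x - gconv (gauss t) h x| <= @At R n t * M * (t' - t).
Proof.
move=> t0 tt' mh hM.
have M0 : 0 <= M := le_trans (normr_ge0 _) (hM x).
apply: (@mvt_bound R (fun t => gconv (gauss t) h x) (fun t => gconv (gauss_dt t) h x)) => // s /andP[ts _].
  apply: (conv_is_derive_t _ gkernel_gauss gkernel_gauss_dt _ mh hM); last exact: lt_le_trans ts.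
  by move=> z r r0; exact: is_derive_gauss_t.
have s0 := lt_le_trans t0 ts.
rewrite (le_trans (conv_bound _ gkernel_gauss_dt s0 mh hM).2)// ler_wpM2r//.
by have [_ _ /(_ t s t0 ts) /andP[]] := @gkernel_gauss_dt R n.
Qed.

Lemma conv_gauss_near t h x M L : 0 < t -> measurable_fun [set: 'rV[R]_n] h ->
  (forall y, `|h y| <= M) -> lipschitz_rV h L -> 0 <= L ->
  `|gconv (gauss t) h x - h x| <= L * domC n * Num.sqrt t.
Proof.
move=> t0 mh hM hL L0.
have gK := @gkernel_gauss R n.
have [ih _] := conv_bound x gK t0 mh hM.
have [ic _] := @conv_bound R n _ _ t (fun=> h x) x `|h x| gK t0 (measurable_cst _) (bnd1 (h x)).
rewrite -[X in _ - X](conv_gauss_cst x (h x) t0) /gconv -RintegralB//.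
have -> : L * domC n * Num.sqrt t = (L * Num.sqrt t) * domC n by ring.
apply: (@gauss_int_bound _ _ _ (4 * t) x _ _ _ _).2 => //; first by rewrite mulr_gt0.
  by apply: measurable_funB; apply: (measurable_conv_integrand _ _ gK).
move=> y; rewrite -mulrBr normrM (ger0_norm (gauss_ge0 _ _)) mulrC.
apply: gauss_dom_le => //; first by rewrite mulr_ge0 ?sqrtr_ge0.
rewrite (le_trans (hL _ _))// -mulrA ler_wpM2l// distrC.
rewrite (le_trans (norm_scaled_le _ t0))// ler_wpM2l ?sqrtr_ge0//.
have q0 : 0 <= dot (x - y) (x - y) / t by rewrite divr_ge0 ?dot_ge0 ?(ltW t0).
by rewrite -[leLHS]expr1 ler_weXn2l// lerDl.
Qed.

End conv_estimates.

(** * Reflection, and the integral of the inverse square root *)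

Section reflection.
Context {R : realType}.
Local Notation leb := (@lebesgue_measure R).

Lemma lebesgue_measure_reflect (t : R) (A : set (measurableTypeR R)) : measurable A ->
  pushforward leb (fun s : measurableTypeR R => t - s : measurableTypeR R) A = leb A.
Proof.
have mphi : measurable_fun [set: measurableTypeR R] (fun s : measurableTypeR R => t - s : measurableTypeR R).
  exact: measurable_funB.
move=> mA; apply/esym.
apply: (@lebesgue_measure_unique R (pushforward leb (fun s : measurableTypeR R => t - s : measurableTypeR R))) => // _ [[a b]] _ <-.
have preE : (fun s : R => t - s) @^-1` `]a, b]%classic = `[t - b, t - a[%classic.
  apply/seteqP; split => x; rewrite /= !in_itv/= => /andP[? ?]; apply/andP; split; lra.
change (leb `]a, b]%classic = leb ((fun s : R => t - s) @^-1` `]a, b]%classic)).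
rewrite preE !lebesgue_measure_itv/= !lte_fin ltrD2l ltrN2 -!EFinB.
by congr (if _ then _%:E else _); ring.
Qed.

Lemma Rintegral_reflect (t t1 : R) (g : R -> R) : measurable_fun [set: R] g ->
  leb.-integrable `]0, (t - t1)[ (EFin \o (fun r => g (t - r))) ->
  leb.-integrable `]t1, t[ (EFin \o g) /\
  \int[leb]_(s in `]t1, t[) g s = \int[leb]_(r in `]0, (t - t1)[) g (t - r).
Proof.
move=> mg ig.
pose phi (s : measurableTypeR R) : measurableTypeR R := t - s.
have mphi : measurable_fun [set: measurableTypeR R] phi by exact: measurable_funB.
have mg' : measurable_fun [set: measurableTypeR R] (EFin \o g) by exact/measurable_EFinP.
have preE : phi @^-1` `]t1, t[ = `]0, (t - t1)[%classic.
  by apply/seteqP; split => x; rewrite /phi/= !in_itv/= => /andP[? ?]; apply/andP; split; lra.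
have E (f : R -> \bar R) : (\int[leb]_(s in `]t1, t[) f s = \int[pushforward leb phi]_(s in `]t1, t[) f s)%E.
  by apply: eq_measure_integral => A mA _; apply/esym; exact: lebesgue_measure_reflect.
have ig' : leb.-integrable (phi @^-1` `]t1, t[) ((EFin \o g) \o phi) by rewrite preE.
split.
  have /integrableP[_ h] := integrable_pushforward mphi mg' ig' (measurable_itv _).
  by apply/integrableP; split; [exact: measurable_funTS|rewrite E].
by rewrite /Rintegral E integral_pushforward// preE.
Qed.

(** Monotone convergence from intervals [e k, a], on which the antiderivative
    2 sqrt r is available. *)
Lemma integral_invsqrt (a : R) : 0 < a ->
  leb.-integrable `]0, a[ (EFin \o (fun r => (Num.sqrt r)^-1)) /\
  \int[leb]_(r in `]0, a[) (Num.sqrt r)^-1 <= 2 * Num.sqrt a.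
Proof.
move=> a0; pose e k : R := a / k.+2%:R.
have e0 k : 0 < e k by rewrite divr_gt0.
have ea k : e k < a by rewrite ltr_pdivrMr// ltr_pMr// ltr1n.
have mis : measurable_fun [set: R] (fun r : R => (Num.sqrt r)^-1).
  by apply: (measurableT_comp measurable_invr); exact: measurable_sqrtr.
have bnd k : (\int[leb]_(r in `[e k, a]) ((Num.sqrt r)^-1)%:E <= (2 * Num.sqrt a)%:E)%E.
  have ds (x : R) : 0 < x -> is_derive x 1 (2 \*: Num.sqrt) (Num.sqrt x)^-1.
    move=> x0; have := is_derive1_sqrt x0 => ?; apply: is_derive_eq.
    by rewrite [2%:A]mulr1 invfM mulrA mulfV ?mul1r.
  have cs (x : R) : {for x, continuous (2 \*: @Num.sqrt R)}.
    by apply: cvgZr; exact: sqrt_continuous.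
  rewrite (@continuous_FTC2 _ (fun r : R => (Num.sqrt r)^-1) (2 \*: @Num.sqrt R))//.
  - by rewrite -EFinB lee_fin /GRing.scale/= gerBl mulr_ge0 ?sqrtr_ge0.
  - apply: continuous_in_subspaceT => x; rewrite inE/= in_itv/= => /andP[ex _].
    apply: cvgV; last exact: sqrt_continuous.
    by rewrite gt_eqF// sqrtr_gt0 (lt_le_trans _ ex).
  - split.
    + move=> x; rewrite in_itv/= => /andP[ex _].
      by have [] := ds x (lt_trans (e0 k) ex).
    + exact/cvg_at_right_filter/cs.
    + exact/cvg_at_left_filter/cs.
  - move=> x; rewrite in_itv/= => /andP[ex _].
    by have [_] := ds x (lt_trans (e0 k) ex); rewrite derive1E.
have UE : \bigcup_k `[e k, a]%classic = `]0, a]%classic.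
  apply/seteqP; split => x /=.
    by move=> [k _] /=; rewrite !in_itv/= => /andP[/(lt_le_trans (e0 k)) -> ->].
  rewrite in_itv/= => /andP[x0 xa].
  have [N _ HN] := near_infty_natSinv_lt (PosNum (divr_gt0 x0 a0)).
  exists N => //=; rewrite in_itv/= xa andbT /e ler_pdivrMr// -ler_pdivrMl//.
  have /= h := HN N (leqnn N).
  rewrite -ler_pV2 ?inE ?unitfE ?gt_eqF ?mulr_gt0 ?invr_gt0//=.
  rewrite invfM invrK (le_trans _ (ltW h))//.
  by rewrite lef_pV2 ?posrE// ler_nat.
have le : (\int[leb]_(r in `]0%R, a]) ((Num.sqrt r)^-1)%:E <= (2 * Num.sqrt a)%:E)%E.
  rewrite -UE.
  have := @ge0_nondecreasing_set_cvg_integral _ (measurableTypeR R) R (fun k => `[e k, a]%classic) (fun r => ((Num.sqrt r)^-1)%:E) leb.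
  move=> H; apply: (@closed_cvg _ _ _ _ _ (fun y => (y <= (2 * Num.sqrt a)%:E)%E) _ _ _ (H _ _ _ _)).
  - exact: closed_ereal_ge_ereal.
  - by apply: nearW => k; exact: bnd.
  - move=> i j ij; apply/subsetPset => x /=; rewrite !in_itv/= => /andP[ix ->]; rewrite andbT.
    by rewrite (le_trans _ ix)// ler_wpM2l ?(ltW a0)// lef_pV2 ?posrE// ler_nat !ltnS.
  - by move=> k; exact: measurable_itv.
  - by move=> k; apply/measurable_EFinP; exact: measurable_funTS.
  - by move=> k x _; rewrite lee_fin invr_ge0 sqrtr_ge0.
have i1 : leb.-integrable `]0, a] (EFin \o (fun r => (Num.sqrt r)^-1)).
  apply/integrableP; split; first by apply/measurable_EFinP; exact: measurable_funTS.
  under eq_integral do rewrite /= ger0_norm ?invr_ge0 ?sqrtr_ge0//.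
  by rewrite (le_lt_trans le)// ltry.
have i2 : leb.-integrable `]0, a[ (EFin \o (fun r => (Num.sqrt r)^-1)).
  by apply: (integrableS _ _ _ i1) => // x; rewrite /= !in_itv/= => /andP[-> /ltW].
split => //.
rewrite -lee_fin /Rintegral fineK ?(integrable_fin_num _ i2)//.
rewrite (le_trans _ le)//; apply: ge0_subset_integral => //.
- by apply/measurable_EFinP; exact: measurable_funTS.
- by move=> x; rewrite /= !in_itv/= => /andP[-> /ltW].
Qed.

Lemma integral_invsqrt_reflect (t1 t : R) : t1 < t ->
  leb.-integrable `]t1, t[ (EFin \o (fun s => (Num.sqrt (t - s))^-1)) /\
  \int[leb]_(s in `]t1, t[) (Num.sqrt (t - s))^-1 <= 2 * Num.sqrt (t - t1).
Proof.
move=> tt; have tt0 : 0 < t - t1 by rewrite subr_gt0.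
have [i1 i2] := integral_invsqrt tt0.
have E : (fun r => (Num.sqrt (t - (t - r)))^-1) = (fun r => (Num.sqrt r)^-1) :> (R -> R).
  by apply/funext => r; rewrite opprB addrC subrK.
have mg : measurable_fun [set: R] (fun s => (Num.sqrt (t - s))^-1).
  apply: (measurableT_comp measurable_invr); apply: (measurableT_comp measurable_sqrtr).
  exact: measurable_funB.
have ig : leb.-integrable `]0, (t - t1)[ (EFin \o (fun r => (Num.sqrt (t - (t - r)))^-1)).
  by rewrite E.
have [h1 h2] := Rintegral_reflect mg ig.
by split => //; rewrite h2 E.
Qed.

End reflection.

(** * Volterra potentials *)

Section volterra.
Context {R : realType} {n : nat}.
Local Notation mu := (@lebesgue_rV R n).
Local Notation leb := (@lebesgue_measure R).
Implicit Types (x y z v w : 'rV[R]_n) (t s c : R) (K : R -> 'rV[R]_n -> R).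
Context (H : R -> 'rV[R]_n -> R) (t1 T M : R).
Context (mH : measurable_fun [set: R * 'rV[R]_n] (fun p => H p.1 p.2)).
Context (HM : forall s y, t1 < s < T -> `|H s y| <= M).

(** The potential that a kernel K builds from a source H acting since time t1;
    for the Gaussian it is the Duhamel term. *)
Definition volterra K t x : R := \int[leb]_(s in `]t1, t[) gconv (K (t - s)) (H s) x.

(** An integrable singularity at s = t, which makes the potentials converge. *)
Definition sqrt_bounded K c := forall r s x, 0 < r < T - t1 -> t1 < s < T ->
  `|gconv (K r) (H s) x| <= c / Num.sqrt r.

Lemma sqrt_bounded_ge0 K c : sqrt_bounded K c -> t1 < T -> 0 <= c.
Proof.
move=> Kc tT; pose r := (T - t1) / 2.
have rp : 0 < r by rewrite divr_gt0// subr_gt0.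
have h1 : 0 < r < T - t1 by rewrite /r; apply/andP; split; lra.
have h2 : t1 < T - r < T by rewrite /r; apply/andP; split; lra.
have := le_trans (normr_ge0 _) (Kc r (T - r) 0 h1 h2).
by rewrite pmulr_lge0// invr_gt0 sqrtr_gt0.
Qed.

Lemma measurable_slice s : measurable_fun [set: 'rV[R]_n] (H s).
Proof.
apply: (@measurableT_comp _ _ _ _ _ _ (fun p : R * 'rV[R]_n => H p.1 p.2) _ (fun y => (s, y))) => //.
exact: measurable_pair1.
Qed.

Lemma measurable_gconv_param K A d (S : measurableType d) (f g : S -> R) x : gkernel K A ->
  measurable_fun setT f -> measurable_fun setT g ->
  measurable_fun setT (fun a => gconv (K (f a)) (H (g a)) x).
Proof.
move=> gK mf mg.
apply: (@measurable_Rintegral_param R _ _ S _ mu (fun p : S * 'rV[R]_n => K (f p.1) (x - p.2) * H (g p.1) p.2)).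
apply: measurable_funM.
  apply: (measurable_gkernel gK); first by apply: (measurableT_comp mf); mproj.
  by apply: measurable_rVB; mproj.
apply: (@measurableT_comp _ _ _ _ _ _ (fun p : R * 'rV[R]_n => H p.1 p.2) _ (fun p => (g p.1, p.2))) => //.
by apply: measurable_fun_pair; [apply: (measurableT_comp mg)|]; mproj.
Qed.

Let in_itvP t s : t <= T -> `]t1, t[%classic s -> 0 < t - s < T - t1 /\ t1 < s < T.
Proof.
move=> tT; rewrite /= in_itv/= => /andP[? ?].
by split; apply/andP; split; lra.
Qed.

Lemma integrable_volterra K A c t x : gkernel K A -> sqrt_bounded K c -> t1 < t <= T ->
  leb.-integrable `]t1, t[ (EFin \o (fun s => gconv (K (t - s)) (H s) x)) /\
  `|volterra K t x| <= c * (2 * Num.sqrt (t - t1)).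
Proof.
move=> gK Kc /andP[t1t tT]; have [i1 i2] := integral_invsqrt_reflect t1t.
have b0 := sqrt_bounded_ge0 Kc (lt_le_trans t1t tT).
have ic : leb.-integrable `]t1, t[ (EFin \o (fun s => c * (Num.sqrt (t - s))^-1)).
  exact: integrable_scale.
have [] := @Rintegral_bound R _ _ leb (fun s => gconv (K (t - s)) (H s) x) (fun s => c * (Num.sqrt (t - s))^-1) `]t1, t[ (measurable_itv _) _ ic _.
- apply: measurable_funTS; apply: (measurable_gconv_param _ gK) => //.
  exact: measurable_funB.
- by move=> s /(in_itvP tT)[h1 h2]; exact: Kc.
move=> h1 h2.
split=> //; rewrite (le_trans h2)// RintegralZl//.
by rewrite ler_wpM2l.
Qed.

(** Moves the singularity of the kernel to r = 0 for every t, before passing to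
    the limit in t. *)
Lemma volterra_reflect K A c t x : gkernel K A -> sqrt_bounded K c -> t1 < t <= T ->
  volterra K t x = \int[leb]_(r in `]0, (t - t1)[) gconv (K r) (H (t - r)) x.
Proof.
move=> gK Kc /andP[t1t tT]; have tt0 : 0 < t - t1 by rewrite subr_gt0.
have E : (fun r => gconv (K (t - (t - r))) (H (t - r)) x) = (fun r => gconv (K r) (H (t - r)) x).
  by apply/funext => r; rewrite opprB addrC subrK.
have mg : measurable_fun [set: R] (fun s => gconv (K (t - s)) (H s) x).
  by apply: (measurable_gconv_param _ gK) => //; exact: measurable_funB.
have ig : leb.-integrable `]0, (t - t1)[ (EFin \o (fun r => gconv (K (t - (t - r))) (H (t - r)) x)).
  rewrite E; have [i1 _] := integral_invsqrt tt0.
  have ic : leb.-integrable `]0, (t - t1)[ (EFin \o (fun s => c * (Num.sqrt s)^-1)).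
    exact: integrable_scale.
  apply: (Rintegral_bound _ _ ic _).1 => //.
    apply: measurable_funTS; apply: (measurable_gconv_param _ gK) => //.
    exact: measurable_funB.
  move=> r; rewrite /= in_itv/= => /andP[? ?]; apply: Kc; apply/andP; split; lra.
by rewrite /volterra (Rintegral_reflect mg ig).2 E.
Qed.

Lemma volterra_is_derive K A K' A' v c c' t x : gkernel K A -> gkernel K' A' ->
  (forall r z s, 0 < r -> is_derive s 1 (fun s => K r (z + s *: v)) (K' r (z + s *: v))) ->
  sqrt_bounded K c -> sqrt_bounded K' c' -> t1 < t <= T ->
  is_derive x v (volterra K t) (volterra K' t x).
Proof.
move=> gK gK' dK Kc Kc' /[dup] tb /andP[t1t tT].
have c'0 := sqrt_bounded_ge0 Kc' (lt_le_trans t1t tT).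
have [i1 _] := integral_invsqrt_reflect t1t.
have ic := @integrable_scale R _ _ leb _ c' _ (measurable_itv _) i1.
have I0 : -1 < (0 : R) < 1 by rewrite ltrN10 ltr01.
apply: is_derive_of_line; rewrite -[in volterra K' t x](addr0 x) -(scale0r v).
apply: (@is_derive_Rintegral R _ _ leb (fun s r => gconv (K (t - r)) (H r) (x + s *: v))
  (fun s r => gconv (K' (t - r)) (H r) (x + s *: v)) (fun r => c' * (Num.sqrt (t - r))^-1) `]t1, t[ (-1) 1) => //.
- by move=> s _; exact: (integrable_volterra (x + s *: v) gK Kc tb).1.
- move=> s r _ /(in_itvP tT)[/andP[h1 _] h2]; apply: is_derive_line.
  apply: (conv_is_derive _ gK gK' _ (measurable_slice r) (fun y => HM y h2) h1).
  by move=> z q; exact: dK.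
- by move=> r; rewrite mulr_ge0// invr_ge0 sqrtr_ge0.
- by move=> s r _ /(in_itvP tT)[h1 h2]; exact: Kc'.
Qed.

Context (Hc : forall s y, t1 < s < T -> H r y @[r --> s] --> H s y).

(** Dominated convergence after [volterra_reflect], on the fixed interval
    ]0, T - t1[. *)
Lemma volterra_cvg K A c t x (t_ : nat -> R) (x_ : nat -> 'rV[R]_n) :
  gkernel K A -> sqrt_bounded K c -> t1 < t < T ->
  t_ k @[k --> \oo] --> t -> x_ k @[k --> \oo] --> x ->
  volterra K (t_ k) (x_ k) @[k --> \oo] --> volterra K t x.
Proof.
move=> gK Kc /andP[t1t tT] tt xx.
have M0 : 0 <= M by apply: le_trans (normr_ge0 _) (HM 0 (_ : t1 < t < T)); rewrite t1t.
pose F t x r := if r < t - t1 then gconv (K r) (H (t - r)) x else 0.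
have mF u y : measurable_fun [set: R] (F u y).
  apply: measurable_fun_ifT => //; first exact: measurable_fun_ltr.
  by apply: (measurable_gconv_param _ gK) => //; exact: measurable_funB.
have T0 : 0 < T - t1 by lra.
(* At r = t - t1 the cut-off in F jumps, so that this point, a null set, is removed. *)
have VE u y : t1 < u < T -> volterra K u y = \int[leb]_(r in `]0, (T - t1)[ `\ (t - t1)) F u y r.
  move=> /andP[u1 uT]; rewrite (volterra_reflect _ gK Kc) ?u1 ?ltW//.
  have -> : \int[leb]_(r in `]0, (T - t1)[ `\ (t - t1)) F u y r = \int[leb]_(r in `]0, (T - t1)[) F u y r.
    rewrite /Rintegral; congr fine; apply: integral_setD1_EFin; first exact: measurableD.
    by apply: measurable_funTS; exact/measurable_EFinP.
  rewrite Rintegral_mkcond [RHS]Rintegral_mkcond; apply: eq_Rintegral => r _.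
  rewrite /F !patchE.
  have [/set_mem|/negP h1] := boolP (r \in `]0, (u - t1)[%classic).
    rewrite /= in_itv/= => /andP[r0 ru].
    by rewrite mem_set ?ru//= in_itv/= r0/=; lra.
  case: ifPn => // /set_mem; rewrite /= in_itv/= => /andP[r0 rT]; case: ifPn => // ru.
  by exfalso; apply: h1; rewrite mem_set//= in_itv/= r0.
have near_in : \forall k \near \oo, t1 < t_ k < T.
  near=> k; apply/andP; split; near: k; [exact: (cvgr_gt t)|exact: (cvgr_lt t)].
rewrite VE ?t1t//.
apply: (@cvg_trans _ ((fun k => \int[leb]_(r in `]0, (T - t1)[ `\ (t - t1)) F (t_ k) (x_ k) r) @ \oo)).
  by apply: near_eq_cvg; near=> k; rewrite VE//; near: k.
have [i1 _] := integral_invsqrt T0.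
have ic : leb.-integrable (`]0, (T - t1)[ `\ (t - t1)) (EFin \o (fun s => c * (Num.sqrt s)^-1)).
  apply: (@integrableS _ _ _ leb `]0, (T - t1)[) => //.
  - exact: measurableD.
  - exact: integrable_scale.
have c0 := sqrt_bounded_ge0 Kc (lt_trans t1t tT).
apply: (Rdominated_cvg _ _ ic) => //.
- exact: measurableD.
- by move=> k; apply: measurable_funTS; exact: mF.
- near=> k => r [/=]; rewrite in_itv/= => /andP[r0 rT] _; rewrite /F.
  have /andP[h1 h2] : t1 < t_ k < T by near: k.
  case: ifPn => rt; last by rewrite normr0 mulr_ge0// invr_ge0 sqrtr_ge0.
  by apply: Kc; apply/andP; split; lra.
- move=> r [/=]; rewrite in_itv/= => /andP[r0 rT] /eqP rt.
  have [rlt|rge] := ltP r (t - t1).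
    rewrite /F rlt.
    have ev : \forall k \near \oo, r < t_ k - t1 /\ t_ k < T.
      near=> k; split; last by near: k; exact: (cvgr_lt t).
      by rewrite ltrBrDr; near: k; apply: (cvgr_gt t) => //; lra.
    have [N _ HN] := ev.
    rewrite -(cvg_shiftn N).
    have HN' k : r < t_ (k + N)%N - t1 /\ t_ (k + N)%N < T by apply: HN => /=; exact: leq_addl.
    rewrite (_ : (fun _ => _) = (fun k => gconv (K r) (H (t_ (k + N)%N - r)) (x_ (k + N)%N))); last first.
      by apply/funext => k; have [-> _] := HN' k.
    apply: (conv_cvg (t_ := fun=> r) (h_ := fun k => H (t_ (k + N)%N - r)) (M := M) gK) => //.
    + by move=> k; exact: measurable_slice.
    + by move=> k y; have [h1 h2] := HN' k; apply: HM; apply/andP; split; lra.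
    + move=> y; have h : t1 < t - r < T by apply/andP; split; lra.
      have h1 : t_ (k + N)%N - r @[k --> \oo] --> t - r.
        by apply: cvgB; [rewrite (cvg_shiftn N)|exact: cvg_cst].
      exact: (@cvg_comp _ _ _ _ (fun s => H s y) _ _ _ h1 (@Hc _ y h)).
    + exact: cvg_cst.
    + by rewrite (cvg_shiftn N).
  have rgt : t - t1 < r by rewrite lt_neqAle rge andbT eq_sym.
  rewrite /F ltNge ltW//=.
  have ev : \forall k \near \oo, 0 = (if r < t_ k - t1 then gconv (K r) (H (t_ k - r)) (x_ k) else 0).
    near=> k; rewrite ltNge ltW//= ltrBlDr; near: k; apply: (cvgr_lt t) => //; lra.
  by apply: cvg_trans; [exact: (near_eq_cvg ev)|exact: cvg_cst].
Unshelve. all: by end_near. Qed.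

End volterra.

(** * The heat flow of a Lipschitz function up to time zero *)

Section real_fubini.
Context {R : realType} d1 d2 (T1 : measurableType d1) (T2 : measurableType d2).
Context (m1 : {sigma_finite_measure set T1 -> \bar R}) (m2 : {sigma_finite_measure set T2 -> \bar R}).

Lemma Rfubini (Q : T1 * T2 -> R) : (m1 \x m2)%E.-integrable setT (EFin \o Q) ->
  (forall a, m2.-integrable setT (fun b => (Q (a, b))%:E)) ->
  (forall b, m1.-integrable setT (fun a => (Q (a, b))%:E)) ->
  \int[m1]_a \int[m2]_b Q (a, b) = \int[m2]_b \int[m1]_a Q (a, b).
Proof.
move=> iQ i1 i2; rewrite /Rintegral; congr fine.
transitivity (\int[m1]_a \int[m2]_b (Q (a, b))%:E)%E.
  apply: eq_integral => a _; rewrite fineK//.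
  exact: (integrable_fin_num measurableT (i1 a)).
transitivity (\int[m2]_b \int[m1]_a (Q (a, b))%:E)%E.
  by rewrite (integral12_prod_meas1 iQ) -(integral21_prod_meas1 iQ).
apply: eq_integral => b _; rewrite fineK//.
exact: (integrable_fin_num measurableT (i2 b)).
Qed.

Lemma integrable_Rfubini1 (Q : T1 * T2 -> R) : (m1 \x m2)%E.-integrable setT (EFin \o Q) ->
  (forall a, m2.-integrable setT (fun b => (Q (a, b))%:E)) ->
  m1.-integrable setT (EFin \o (fun a => \int[m2]_b Q (a, b))).
Proof.
move=> iQ i1; have := integrable_fubini_F iQ; apply: eq_integrable => // a _.
by rewrite /= /fubini_F /Rintegral fineK//; exact: (integrable_fin_num measurableT (i1 a)).
Qed.

Lemma integrable_Rfubini2 (Q : T1 * T2 -> R) : (m1 \x m2)%E.-integrable setT (EFin \o Q) ->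
  (forall b, m1.-integrable setT (fun a => (Q (a, b))%:E)) ->
  m2.-integrable setT (EFin \o (fun b => \int[m1]_a Q (a, b))).
Proof.
move=> iQ i2; have mQ := measurable_int _ iQ; apply/integrableP; split.
  have := measurable_fubini_G iQ; apply: eq_measurable_fun => b _.
  by rewrite /= /fubini_G /Rintegral fineK//; exact: (integrable_fin_num measurableT (i2 b)).
apply: le_lt_trans ((integrable21ltyP _ _ mQ).1 iQ); apply: ge0_le_integral => //.
- apply: measurableT_comp => //.
  have := measurable_fubini_G iQ; apply: eq_measurable_fun => b _.
  by rewrite /= /fubini_G /Rintegral fineK//; exact: (integrable_fin_num measurableT (i2 b)).
- apply: (@measurable_fun_fubini_tonelli_G _ _ _ _ R m1 (abse \o (EFin \o Q))) => //.
    exact: measurableT_comp.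
  by move=> p; exact: abse_ge0.
- move=> b _; rewrite [in leLHS]/comp /Rintegral fineK; last exact: (integrable_fin_num measurableT (i2 b)).
  by apply: le_abse_integral => //; exact: measurable_int (i2 b).
Qed.

End real_fubini.

Section shift.
Context {R : realType}.
Local Notation leb := (@lebesgue_measure R).

Lemma Rintegral_shift (r t : R) (g : R -> R) : measurable_fun [set: R] g ->
  leb.-integrable `]0, (t - r)[ (EFin \o g) ->
  leb.-integrable `]r, t[ (EFin \o (fun s => g (s - r))) /\
  \int[leb]_(s in `]r, t[) g (s - r) = \int[leb]_(s in `]0, (t - r)[) g s.
Proof.
move=> mg ig.
pose g2 q := g (t - r - q).
have mg2 : measurable_fun [set: R] g2 by apply: measurableT_comp => //; exact: measurable_funB.
have E1 : (fun q => g2 (t - r - q)) = g.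
  by apply/funext => q; rewrite /g2 opprB addrC subrK.
have [i2 e2] : leb.-integrable `]0, (t - r)[ (EFin \o g2) /\
    \int[leb]_(s in `]0, (t - r)[) g2 s = \int[leb]_(s in `]0, (t - r)[) g s.
  have := @Rintegral_reflect R (t - r) 0 g2 mg2; rewrite subr0 E1 => /(_ ig)[h1 h2].
  by split.
have mG : measurable_fun [set: R] (fun s => g (s - r)).
  by apply: measurableT_comp => //; exact: measurable_funB.
have E2 : (fun q => g (t - q - r)) = g2.
  by apply/funext => q; rewrite /g2 addrAC.
have := @Rintegral_reflect R t r (fun s => g (s - r)) mG; rewrite E2 => /(_ i2)[h1 h2].
by split => //; rewrite h2 e2.
Qed.

End shift.

Section heat_ftc.
Context {R : realType} {n : nat}.
Local Notation leb := (@lebesgue_measure R).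

Definition dtC (L : R) : R := n%:R * ((n%:R ^+ 2 + n%:R) * domC n * L).

(** For Lipschitz h the time derivative of the heat flow is O(1 / sqrt s), hence
    integrable up to time zero, where the flow starts at h. *)
Lemma heat_ftc (h : 'rV[R]_n -> R) (M L a : R) x : measurable_fun [set: 'rV[R]_n] h ->
  (forall y, `|h y| <= M) -> lipschitz_rV h L -> 0 <= L -> 0 < a ->
  leb.-integrable `]0, a[ (EFin \o (fun s => gconv (gauss_dt s) h x)) /\
  \int[leb]_(s in `]0, a[) gconv (gauss_dt s) h x = gconv (gauss a) h x - h x.
Proof.
move=> mh hM hL L0 a0; pose g (s : R) : R := gconv (gauss_dt s) h x; pose c := dtC L.
have c0 : 0 <= c by rewrite !mulr_ge0 ?ler0n ?addr_ge0 ?sqr_ge0 ?ler0n// ltW// domC_gt0.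
have gb (s : R) : 0 < s -> `|g s| <= c * (Num.sqrt s)^-1.
  by move=> s0; exact: (conv_gauss_dt_lip _ s0 mh hM hL L0).
have mg : measurable_fun [set: R] g.
  apply: (@measurable_gconv_param R n (fun=> h) _ gauss_dt _ _ R id id x gkernel_gauss_dt) => //.
  by apply: measurableT_comp => //; exact: measurable_snd.
have ib (b : R) : 0 < b -> leb.-integrable `]0, b[ (EFin \o g) /\ `|\int[leb]_(s in `]0, b[) g s| <= c * (2 * Num.sqrt b).
  move=> b0; have [i1 i2] := integral_invsqrt b0.
  have ic := @integrable_scale R _ _ leb _ c _ (measurable_itv _) i1.
  have [] := @Rintegral_bound R _ _ leb g _ `]0, b[ (measurable_itv _) _ ic _.
  - exact: measurable_funTS.
  - by move=> s; rewrite /= in_itv/= => /andP[s0 _]; exact: gb.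
  - move=> h1 h2; split => //; rewrite (le_trans h2)// RintegralZl//.
    by rewrite ler_wpM2l.
split; first exact: (ib a a0).1.
pose F s := gconv (gauss s) h x.
have dF (s : R) : 0 < s -> is_derive s 1 F (g s).
  move=> s0; apply: (conv_is_derive_t _ gkernel_gauss gkernel_gauss_dt _ mh hM s0).
  by move=> z r r0; exact: is_derive_gauss_t.
have cg (s : R) : 0 < s -> {for s, continuous g}.
  move=> s0; apply: (@continuous_at_seq R R g s) => w ws.
  by apply: (conv_cvg gkernel_gauss_dt (M := M)) => //; [move=> y; exact: cvg_cst|exact: cvg_cst].
have cF (s : R) : 0 < s -> {for s, continuous F}.
  by move=> s0; apply: differentiable_continuous; apply/derivable1_diffP; have [] := dF s s0.
(* Cut at e: the fundamental theorem of calculus applies on [e, a], and the rest is O(sqrt e). *)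
have key (e : R) : 0 < e < a -> `|\int[leb]_(s in `]0, a[) g s - (F a - h x)| <= (2 * c + L * domC n) * Num.sqrt e.
  move=> /andP[e0 ea].
  have -> : \int[leb]_(s in `]0, a[) g s = \int[leb]_(s in `]0, e[) g s + (F a - F e).
    rewrite (_ : `]0, a[%classic = `]0, e[ `|` `[e, a[); last first.
      by rewrite -itv_bndbnd_setU// ?bnd_simp// ltW.
    rewrite Rintegral_setU//; last 2 first.
    - rewrite -itv_bndbnd_setU// ?bnd_simp ?(ltW ea)//; exact: (ib a a0).1.
    - by apply/disj_setPS => y [/=]; rewrite !in_itv/= => /andP[_ ye] /andP[]; rewrite leNgt ye.
    congr (_ + _).
    have iea : leb.-integrable `[e, a[ (EFin \o g).
      apply: (integrableS _ _ _ (ib a a0).1) => // y; rewrite /= !in_itv/= => /andP[ey ->].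
      by rewrite (lt_le_trans e0).
    rewrite Rintegral_itv_bndo_bndc// /Rintegral.
    rewrite (@continuous_FTC2 _ g F)//.
    - apply: continuous_in_subspaceT => y; rewrite inE/= in_itv/= => /andP[ey _].
      exact/cg/(lt_le_trans e0).
    - split.
      + by move=> y; rewrite in_itv/= => /andP[ey _]; have [] := dF y (lt_trans e0 ey).
      + exact/cvg_at_right_filter/cF.
      + exact/cvg_at_left_filter/cF.
    - by move=> y; rewrite in_itv/= => /andP[ey _]; have [_] := dF y (lt_trans e0 ey); rewrite derive1E.
  rewrite (_ : _ - _ = \int[leb]_(s in `]0, e[) g s - (F e - h x)); last first.
    by move: (\int[leb]_(s in `]0, e[) g s) (F a) (F e) (h x) => q1 q2 q3 q4; ring.
  rewrite (le_trans (ler_normB _ _))// mulrDl lerD//.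
    by rewrite (le_trans (ib e e0).2)// mulrA (mulrC c).
  exact: conv_gauss_near hL L0.
change (\int[leb]_(s in `]0, a[) g s = F a - h x).
apply/eqP; rewrite -subr_eq0 -normr_le0 leNgt; apply/negP => D0.
set D := `| _ | : R in key D0; set C := 2 * c + L * domC n in key.
have C0 : 0 <= C by rewrite addr_ge0 ?mulr_ge0// ltW// domC_gt0.
pose d := D / (2 * (C + 1)).
have d0 : 0 < d by rewrite divr_gt0// mulr_gt0// ltr_wpDl.
pose e := Num.min (a / 2) (d ^+ 2).
have e0 : 0 < e by rewrite lt_min divr_gt0//= exprn_gt0.
have ea : e < a by rewrite gt_min ltr_pdivrMr// ltr_pMr// ltr1n.
have := key e; rewrite e0 ea => /(_ isT).
rewrite leNgt => /negP; apply.
have sd : Num.sqrt e <= d.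
  by rewrite -[leRHS](ger0_norm (ltW d0)) -sqrtr_sqr ler_wsqrtr// ge_min lexx orbT.
rewrite (le_lt_trans (ler_wpM2l C0 sd))// /d mulrA ltr_pdivrMr ?mulr_gt0 ?ltr_wpDl//.
by nra.
Qed.

End heat_ftc.

(** * The time derivative of the Gaussian potential *)

Lemma integrable_cst_itv {R : realType} (i : interval R) (c : R) :
  (@lebesgue_measure R [set` i] < +oo)%E ->
  (@lebesgue_measure R).-integrable [set` i] (EFin \o (fun=> c)).
Proof.
move=> fi; apply/integrableP; split; first exact: measurable_cst.
by rewrite integral_cst//= lte_mul_pinfty.
Qed.

Lemma integrable_itvS {R : realType} (g : R -> R) (i : interval R) :
  (@lebesgue_measure R).-integrable [set: measurableTypeR R] (EFin \o g) ->
  (@lebesgue_measure R).-integrable [set` i] (EFin \o g).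
Proof. by move=> ig; apply: (integrableS measurableT _ _ ig). Qed.

Lemma Rintegral_itv_supp {R : realType} (g : R -> R) (t1 t : R) :
  (forall r, ~~ (t1 < r < t) -> g r = 0) ->
  \int[@lebesgue_measure R]_(r in `]t1, t[) g r = \int[@lebesgue_measure R]_r g r.
Proof.
move=> g0; rewrite Rintegral_mkcond; apply: eq_Rintegral => r _; rewrite patchE.
case: ifPn => // /negP h; rewrite g0//.
by apply/negP => h'; apply: h; rewrite mem_set//= in_itv.
Qed.

Lemma Rintegral_add_swap {R : realType} (h a b V : R -> R) (t1 t : R) :
  (@lebesgue_measure R).-integrable `]t1, t[ (EFin \o h) ->
  (@lebesgue_measure R).-integrable `]t1, t[ (EFin \o a) ->
  (@lebesgue_measure R).-integrable `]t1, t[ (EFin \o b) ->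
  (forall r, ~~ (t1 < r < t) -> a r = 0) -> (forall r, ~~ (t1 < r < t) -> b r = 0) ->
  \int[@lebesgue_measure R]_r a r = \int[@lebesgue_measure R]_r b r ->
  (forall s, t1 < s < t -> b s = V s) ->
  \int[@lebesgue_measure R]_(r in `]t1, t[) (h r + a r) =
  \int[@lebesgue_measure R]_(r in `]t1, t[) (h r + V r).
Proof.
move=> ih ia ib a0 b0 ab bV.
rewrite RintegralD// (Rintegral_itv_supp a0) ab -(Rintegral_itv_supp b0) -RintegralD//.
by apply: eq_Rintegral => s /set_mem; rewrite /= in_itv/= => ts; rewrite bV.
Qed.

Section volterra_time.
Context {R : realType} {n : nat}.
Local Notation mu := (@lebesgue_rV R n).
Local Notation leb := (@lebesgue_measure R).
Implicit Types (x y z v w : 'rV[R]_n) (t s c : R).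
Context (H : R -> 'rV[R]_n -> R) (t1 T M L : R).
Context (mH : measurable_fun [set: R * 'rV[R]_n] (fun p => H p.1 p.2)).
Context (HM : forall s y, t1 < s < T -> `|H s y| <= M).
Context (HL : forall s, t1 < s < T -> lipschitz_rV (H s) L).
Context (L0 : 0 <= L).
Context (Hc : forall s y, t1 < s < T -> H r y @[r --> s] --> H s y).

Let c := @dtC R n L.

Let c0 : 0 <= c.
Proof. by rewrite !mulr_ge0 ?ler0n ?addr_ge0 ?sqr_ge0 ?ler0n// ltW// domC_gt0. Qed.

Lemma sqrt_bounded_dt : sqrt_bounded H t1 T gauss_dt c.
Proof.
move=> r s x /andP[r0 _] sT.
by apply: (conv_gauss_dt_lip _ r0 (measurable_slice mH s) _ (HL sT) L0) => y; exact: HM.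
Qed.

(** Fubini on the triangle t1 < r < s < t for the time derivative of the
    Gaussian: integrating first in s gives the Gaussian minus the source by
    [heat_ftc], integrating first in r gives the potential of [gauss_dt]. *)
Lemma volterra_integral t x : t1 < t < T ->
  volterra H t1 gauss t x =
  \int[leb]_(s in `]t1, t[) (H s x + volterra H t1 gauss_dt s x).
Proof.
move=> /andP[t1t tT].
have dom r : `]t1, t[%classic r -> t1 < r < T.
  by rewrite /= in_itv/= => /andP[-> rt]/=; exact: lt_trans tT.
(* The first component of p is the source time r, the second the time s. *)
pose Q (p : R * R) : R := if (t1 < p.1) && ((p.1 < p.2) && (p.2 < t)) then gconv (gauss_dt (p.2 - p.1)) (H p.1) x else 0.
have m1 : measurable_fun [set: R * R] (fun p : R * R => p.1) by exact: measurable_fst.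
have m2 : measurable_fun [set: R * R] (fun p : R * R => p.2) by exact: measurable_snd.
have mQ : measurable_fun [set: R * R] Q.
  apply: measurable_fun_ifT => //.
    apply: measurable_and; first exact: measurable_fun_ltr.
    by apply: measurable_and; exact: measurable_fun_ltr.
  apply: (measurable_gconv_param mH _ gkernel_gauss_dt) => //.
  exact: measurable_funB.
have mQ1 r : measurable_fun [set: R] (fun s => Q (r, s)).
  by apply: (@measurableT_comp _ _ _ _ _ _ Q _ (fun s => (r, s))) => //; exact: measurable_pair1.
have mQ2 s : measurable_fun [set: R] (fun r => Q (r, s)).
  by apply: (@measurableT_comp _ _ _ _ _ _ Q _ (fun r => (r, s))) => //; exact: measurable_pair2.
have A r : t1 < r < t -> leb.-integrable `]r, t[ (EFin \o (fun s => gconv (gauss_dt (s - r)) (H r) x)) /\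
   \int[leb]_(s in `]r, t[) gconv (gauss_dt (s - r)) (H r) x = gconv (gauss (t - r)) (H r) x - H r x.
  move=> /andP[tr rt]; have rT : t1 < r < T by rewrite tr (lt_trans rt).
  have tr0 : 0 < t - r by rewrite subr_gt0.
  have [h1 h2] := heat_ftc x (measurable_slice mH r) (fun y => HM y rT) (HL rT) L0 tr0.
  have mg : measurable_fun [set: R] (fun s : R => gconv (gauss_dt s) (H r) x).
    by apply: (measurable_gconv_param mH x gkernel_gauss_dt (f := id) (g := fun=> r)).
  have [h3 h4] := Rintegral_shift mg h1.
  by split; [exact: h3|rewrite -h2; exact: h4].
have AQ r : \int[leb]_s Q (r, s) = \int[leb]_(s in `]t1, t[) Q (r, s).
  rewrite [RHS]Rintegral_mkcond; apply: eq_Rintegral => s _; rewrite patchE /Q/=.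
  case: ifPn => [/and3P[h1 h2 h3]|]; last by case: ifPn.
  by rewrite mem_set//= in_itv/= h3 (lt_trans h1).
have AQ' r : t1 < r < t -> (fun s => Q (r, s)) = (fun s => gconv (gauss_dt (s - r)) (H r) x) \_ `]r, t[.
  move=> /andP[h1 h2]; apply/funext => s; rewrite patchE /Q/= h1/=.
  case: ifPn => [/andP[h3 h4]|h3]; first by rewrite mem_set//= in_itv/= h3.
  by rewrite memNset//= in_itv/=; exact/negP.
have Q0 r : ~~ (t1 < r < t) -> (fun s => Q (r, s)) = cst 0.
  move=> h; apply/funext => s; rewrite /Q/=; case: ifPn => // /and3P[h1 h2 h3].
  by move: h; rewrite h1 (lt_trans h2).
have iQ1 r : leb.-integrable setT (fun s => (Q (r, s))%:E).
  have [tr|/Q0 E] := boolP (t1 < r < t); last first.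
    rewrite (_ : (fun _ => _) = cst 0%E); first exact: integrable0.
    by apply/funext => s; rewrite (congr1 (@^~ s) E).
  rewrite (_ : (fun _ => _) = (EFin \o (fun s => gconv (gauss_dt (s - r)) (H r) x)) \_ `]r, t[).
    by apply/(integrable_mkcond _ _).1 => //; exact: (A r tr).1.
  rewrite restrict_EFin; apply/funext => s /=.
  by rewrite (congr1 (@^~ s) (AQ' r tr)).
have c20 : 0 <= c * (2 * Num.sqrt (t - t1)) by rewrite !mulr_ge0 ?sqrtr_ge0.
have [is1 is2] := integral_invsqrt_reflect t1t.
have Qb r s : `|Q (r, s)| <= (fun s => c * (Num.sqrt (s - r))^-1) s.
  rewrite /Q/=; case: ifPn => [/and3P[h1 h2 h3]|_]; last first.
    by rewrite normr0 mulr_ge0// invr_ge0 sqrtr_ge0.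
  have rT : t1 < r < T by rewrite h1 (lt_trans h2)// (lt_trans h3).
  by apply: sqrt_bounded_dt => //; apply/andP; split; lra.
have VQ s : t1 < s < t -> (fun r => Q (r, s)) = (fun r => gconv (gauss_dt (s - r)) (H r) x) \_ `]t1, s[.
  move=> /andP[h1 h2]; apply/funext => r; rewrite patchE /Q/= h2/= andbT.
  case: ifPn => [/andP[h3 h4]|h3]; first by rewrite mem_set//= in_itv/= h3.
  by rewrite memNset//= in_itv/=; exact/negP.
have Q0' s : ~~ (t1 < s < t) -> (fun r => Q (r, s)) = cst 0.
  move=> h; apply/funext => r; rewrite /Q/=; case: ifPn => // /and3P[h1 h2 h3].
  by move: h; rewrite h3 (lt_trans h1).
have iV s : t1 < s < t -> leb.-integrable `]t1, s[ (EFin \o (fun r => gconv (gauss_dt (s - r)) (H r) x)).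
  move=> /andP[h1 h2].
  have hs : t1 < s <= T by rewrite h1 ltW// (lt_trans h2).
  exact: (integrable_volterra mH x gkernel_gauss_dt sqrt_bounded_dt hs).1.
have iQ2 s : leb.-integrable setT (fun r => (Q (r, s))%:E).
  have [ts|/Q0' E] := boolP (t1 < s < t); last first.
    rewrite (_ : (fun _ => _) = cst 0%E); first exact: integrable0.
    by apply/funext => r; rewrite (congr1 (@^~ r) E).
  rewrite (_ : (fun _ => _) = (EFin \o (fun r => gconv (gauss_dt (s - r)) (H r) x)) \_ `]t1, s[).
    by apply/(integrable_mkcond _ _).1 => //; exact: iV.
  rewrite restrict_EFin; apply/funext => r /=.
  by rewrite (congr1 (@^~ r) (VQ s ts)).
have iQ : (leb \x leb)%E.-integrable setT (EFin \o Q).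
  apply/integrable21ltyP; first exact/measurable_EFinP.
  apply: (@le_lt_trans _ _ (\int[leb]_s ((c * (2 * Num.sqrt (t - t1))) * \1_(`]t1, t[%classic : set R) s)%:E)%E).
    apply: ge0_le_integral => //.
    - by move=> s _; exact: integral_ge0.
    - have mE : measurable_fun [set: measurableTypeR R * measurableTypeR R] (abse \o (EFin \o Q)).
        by apply: measurableT_comp => //; exact/measurable_EFinP.
      exact: (@measurable_fun_fubini_tonelli_G _ _ (measurableTypeR R) (measurableTypeR R) R leb (abse \o (EFin \o Q)) mE (fun p => abse_ge0 _)).
    - by apply/measurable_EFinP; apply: measurable_funM => //; exact: measurable_indic.
    move=> s _.
    have [ts|nts] := boolP (t1 < s < t); last first.
      rewrite indicE memNset ?mulr0; last by rewrite /= in_itv/=; exact/negP.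
      rewrite integral0_eq// => r _; rewrite /= (congr1 (@^~ r) (Q0' s nts))/=.
      by rewrite normr0.
    move/andP : (ts) => [ts1 ts2].
    rewrite indicE mem_set ?mulr1//=.
    have [i1 i2] := integral_invsqrt_reflect ts1.
    have ic := @integrable_scale R _ _ leb _ c _ (measurable_itv _) i1.
    rewrite (_ : (\int[leb]_x0 _)%E = (\int[leb]_(r in `]t1, s[) `|(gconv (gauss_dt (s - r)) (H r) x)%:E|)%E); last first.
      rewrite [RHS]integral_mkcond; apply: eq_integral => r _.
      rewrite (congr1 (@^~ r) (VQ s ts)) !patchE; case: ifP => // _.
      exact: (congr1 EFin (normr0 R)).
    rewrite -(@fineK _ (\int[leb]_(r in _) _)%E); last first.
      apply: integrable_fin_num => //.
      have := iV s ts => /integrable_norm; apply: eq_integrable => // r _.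
    rewrite lee_fin; apply: (@le_trans _ _ (\int[leb]_(r in `]t1, s[) (c * (Num.sqrt (s - r))^-1))).
      apply: le_Rintegral => //.
      - exact/integrable_norm/iV.
      - move=> r; rewrite /= in_itv/= => /andP[tr rs].
        by apply: sqrt_bounded_dt; apply/andP; split; lra.
    rewrite RintegralZl// ler_wpM2l// (le_trans i2)// ler_wpM2l// ler_wsqrtr// lerD2r.
    exact: ltW.
  under eq_integral do rewrite EFinM.
  rewrite ge0_integralZl_EFin//; last first.
    by apply/measurable_EFinP; exact: measurable_indic.
  have lfin : (leb `]t1, t[%classic < +oo)%E.
    by rewrite lebesgue_measure_itv/= lte_fin t1t -EFinD ltry.
  by apply: lte_mul_pinfty; rewrite ?lee_fin// integral_indic// setIT; exact: lfin.
have FQ := Rfubini iQ iQ1 iQ2.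
have iHx : leb.-integrable `]t1, t[ (EFin \o (fun r => H r x)).
  have mHx : measurable_fun [set: R] (fun r => H r x).
    apply: (@measurableT_comp _ _ _ _ _ _ (fun p : R * 'rV[R]_n => H p.1 p.2) _ (fun r => (r, x))) => //.
  have icst : leb.-integrable `]t1, t[ (EFin \o (fun=> M)).
    apply: integrable_cst_itv; rewrite /= lebesgue_measure_itv/= lte_fin t1t.
    by rewrite -EFinD ltry.
  apply: (@Rintegral_bound R _ _ leb (fun r => H r x) _ `]t1, t[ (measurable_itv _) _ icst _).1.
  - exact: measurable_funTS.
  - by move=> r /dom; exact: HM.
pose a (r : R) : R := \int[leb]_s Q (r, s).
pose b (s : R) : R := \int[leb]_r Q (r, s).
have iA' : leb.-integrable [set: measurableTypeR R] (EFin \o a) := integrable_Rfubini1 iQ iQ1.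
have iB' : leb.-integrable [set: measurableTypeR R] (EFin \o b) := integrable_Rfubini2 iQ iQ2.
have iA := integrable_itvS `]t1, t[ iA'.
have iB := integrable_itvS `]t1, t[ iB'.
have VB s : t1 < s < t -> b s = volterra H t1 gauss_dt s x.
  by move=> ts; rewrite /b (VQ s ts) -Rintegral_mkcond.
have a0 r : ~~ (t1 < r < t) -> a r = 0.
  by move=> h; rewrite /a (Q0 r h) /Rintegral integral0.
have b0 s : ~~ (t1 < s < t) -> b s = 0.
  by move=> h; rewrite /b (Q0' s h) /Rintegral integral0.
transitivity (\int[leb]_(r in `]t1, t[) (H r x + a r)).
  apply: eq_Rintegral => r /set_mem; rewrite /= in_itv/= => tr.
  by rewrite /a (AQ' r tr) -Rintegral_mkcond (A r tr).2 [RHS]addrC subrK.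
exact: (Rintegral_add_swap iHx iA iB a0 b0 FQ VB).
Qed.

(** The fundamental theorem of calculus in [volterra_integral], whose integrand
    is continuous in time. *)
Lemma volterra_is_derive_t t x : t1 < t < T ->
  is_derive t 1 (fun t => volterra H t1 gauss t x) (H t x + volterra H t1 gauss_dt t x).
Proof.
move=> /andP[t1t tT]; pose W s := H s x + volterra H t1 gauss_dt s x.
have cW s : t1 < s < T -> {for s, continuous W}.
  move=> sT; apply: cvgD; first exact: Hc.
  apply: (@continuous_at_seq R R (fun s => volterra H t1 gauss_dt s x) s) => w ws.
  by apply: (volterra_cvg mH HM Hc gkernel_gauss_dt sqrt_bounded_dt sT ws); exact: cvg_cst.
pose u := (t + T) / 2.
have tu : t < u by rewrite /u; lra.
have uT : u < T by rewrite /u; lra.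
have dom s : `]t1, u]%classic s -> t1 < s < T.
  by rewrite /= in_itv/= => /andP[-> su]/=; exact: le_lt_trans uT.
have mW : measurable_fun `]t1, u] W.
  apply: (@measurable_funS _ _ _ _ `]t1, T[) => //.
  apply: open_continuous_measurable_fun; first exact: interval_open.
  by move=> s; rewrite inE/= in_itv/=; exact: cW.
have iW : leb.-integrable `]t1, u] (EFin \o W).
  have icst : leb.-integrable `]t1, u] (EFin \o (fun=> M + c * (2 * Num.sqrt (T - t1)))).
    apply: integrable_cst_itv; rewrite /= lebesgue_measure_itv/= lte_fin (lt_trans t1t tu).
    by rewrite -EFinD ltry.
  apply: (@Rintegral_bound R _ _ leb W _ `]t1, u] (measurable_itv _) _ icst _).1 => //.
  move=> s /dom /[dup] sT /andP[s1 s2]; rewrite (le_trans (ler_normD _ _))// lerD ?HM//.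
  have s2' : t1 < s <= T by rewrite s1 ltW.
  rewrite (le_trans (integrable_volterra mH x gkernel_gauss_dt sqrt_bounded_dt s2').2)//.
  by rewrite ler_wpM2l// ler_wpM2l// ler_wsqrtr// lerD2r ltW.
have E : \forall s \near t, \int[leb]_(r in [set` Interval (BRight t1) (BRight s)]) W r = volterra H t1 gauss s x.
  near=> s.
  have s1 : t1 < s by near: s; exact: lt_nbhsr.
  have s2 : s < u by near: s; exact: lt_nbhsl.
  rewrite volterra_integral ?s1 ?(lt_trans s2 uT)//.
  rewrite -Rintegral_itv_bndo_bndc//.
  apply: (integrableS _ _ _ iW) => // r; rewrite /= !in_itv/= => /andP[-> rs]/=.
  by rewrite ltW// (lt_trans rs).
apply: (near_eq_is_derive E).
have sT : t1 < t < T by rewrite t1t.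
have [h1 h2] := continuous_FTC1 tu iW t1t (cW t sT).
by apply: DeriveDef; [exact: h1|exact: (etrans (esym (derive1E _ _)) h2)].
Unshelve. all: by end_near. Qed.

End volterra_time.

(** * Lipschitz and Hoelder bounds for the Gaussian potential *)

Section integral_comparison.
Context {R : realType} d (T : measurableType d) (mu : {measure set T -> \bar R}).

Lemma Rintegral_sub_bound (f1 f2 g : T -> R) (D : set T) : measurable D ->
  mu.-integrable D (EFin \o f1) -> mu.-integrable D (EFin \o f2) ->
  mu.-integrable D (EFin \o g) -> (forall x, D x -> `|f1 x - f2 x| <= g x) ->
  `|\int[mu]_(x in D) f1 x - \int[mu]_(x in D) f2 x| <= \int[mu]_(x in D) g x.
Proof.
move=> mD i1 i2 ig fg; rewrite -RintegralB//.
apply: (@Rintegral_bound R _ _ mu (fun x => f1 x - f2 x) g D mD _ ig fg).2.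
apply: measurable_funB.
  by have /integrableP[/measurable_EFinP] := i1.
by have /integrableP[/measurable_EFinP] := i2.
Qed.

Lemma Rintegral_lin2 (f1 f2 : T -> R) (D : set T) (a b : R) : measurable D ->
  mu.-integrable D (EFin \o f1) -> mu.-integrable D (EFin \o f2) ->
  mu.-integrable D (EFin \o (fun x => a * f1 x + b * f2 x)) /\
  \int[mu]_(x in D) (a * f1 x + b * f2 x) =
  a * \int[mu]_(x in D) f1 x + b * \int[mu]_(x in D) f2 x.
Proof.
move=> mD i1 i2.
have j1 : mu.-integrable D (EFin \o (fun x => a * f1 x)).
  exact: integrable_scale.
have j2 : mu.-integrable D (EFin \o (fun x => b * f2 x)).
  exact: integrable_scale.
split; last by rewrite RintegralD// !RintegralZl.
by move: (integrableD mD j1 j2); apply: eq_integrable.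
Qed.

End integral_comparison.

(** Interpolates between a trivial bound and a bound linear in q. *)
Lemma min_le_sqrt {R : realType} (X a b q : R) : 0 <= a -> 0 <= b -> 0 <= q ->
  X <= a -> X <= b * q -> X <= (a + b) * Num.sqrt q.
Proof.
move=> a0 b0 q0 Xa Xb; rewrite mulrDl.
have [q1|q1] := leP 1 q.
  have s1 : 1 <= Num.sqrt q by rewrite -(sqrtr1 R) ler_wsqrtr.
  apply: (le_trans Xa); rewrite -[leLHS]addr0 lerD ?ler_peMr//.
  by rewrite mulr_ge0 ?sqrtr_ge0.
apply: (le_trans Xb); rewrite -[leLHS]add0r lerD ?mulr_ge0 ?sqrtr_ge0//.
rewrite ler_wpM2l// -[leLHS]sqr_sqrtr// expr2 ler_piMr ?sqrtr_ge0//.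
by rewrite -(sqrtr1 R) ler_wsqrtr// ltW.
Qed.

Section volterra_gauss.
Context {R : realType} {n : nat}.
Local Notation mu := (@lebesgue_rV R n).
Local Notation leb := (@lebesgue_measure R).
Implicit Types (x y z v w : 'rV[R]_n) (t s c : R).
Context (H : R -> 'rV[R]_n -> R) (t1 T M : R).
Context (mH : measurable_fun [set: R * 'rV[R]_n] (fun p => H p.1 p.2)).
Context (HM : forall s y, t1 < s < T -> `|H s y| <= M).

Lemma domC_ge0 : 0 <= @domC R n.
Proof. by rewrite ltW// domC_gt0. Qed.

Lemma volterra_M_ge0 : t1 < T -> 0 <= M.
Proof.
move=> t1T; have h : t1 < (t1 + T) / 2 < T by apply/andP; split; lra.
exact: le_trans (normr_ge0 _) (HM 0 h).
Qed.

Lemma gconv_gauss_le r s x : t1 < s < T -> 0 < r -> `|gconv (gauss r) (H s) x| <= domC n * M.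
Proof.
move=> sT r0.
by apply: (conv_bound x gkernel_gauss r0 (measurable_slice mH s) _).2 => y; exact: HM.
Qed.

Lemma sqrt_bounded_gauss : sqrt_bounded H t1 T gauss (domC n * M * Num.sqrt (T - t1)).
Proof.
move=> r s x /andP[r0 rT] sT.
apply: (le_trans (gconv_gauss_le x sT r0)).
have M0 : 0 <= M by apply: volterra_M_ge0; lra.
rewrite -mulrA ler_peMr// ?mulr_ge0 ?domC_ge0//.
by rewrite ler_pdivlMr ?sqrtr_gt0// mul1r ler_wsqrtr// ltW.
Qed.

Lemma volterra_gauss_lip t x x' : t1 < t <= T ->
  `|volterra H t1 gauss t x' - volterra H t1 gauss t x| <=
  n%:R * domC n * M * `|x' - x| * (2 * Num.sqrt (t - t1)).
Proof.
move=> /[dup] tT /andP[t1t tleT].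
have [i1 _] := integrable_volterra mH x' gkernel_gauss sqrt_bounded_gauss tT.
have [i2 _] := integrable_volterra mH x gkernel_gauss sqrt_bounded_gauss tT.
have [i3 le3] := integral_invsqrt_reflect t1t.
have M0 : 0 <= M by apply: volterra_M_ge0; lra.
have d0 := domC_ge0.
have i4 := @integrable_scale R _ _ leb _ (n%:R * domC n * M * `|x' - x|) _ (measurable_itv _) i3.
apply: (le_trans (@Rintegral_sub_bound R _ _ leb _ _ _ `]t1, t[ (measurable_itv _) i1 i2 i4 _)) => [s|]; last first.
  by rewrite RintegralZl// ler_wpM2l// !mulr_ge0.
rewrite /= in_itv/= => /andP[t1s st].
apply: (conv_gauss_lip _ _ _ (measurable_slice mH s)) => [|y]; first by rewrite subr_gt0.
by apply: HM; rewrite t1s (lt_le_trans st).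
Qed.

(** The Gaussian vanishes at nonpositive times, so that the potentials at two
    times can be compared as integrals over one interval. *)
Lemma volterra_gauss_widen t t' x : t1 < t -> t <= t' ->
  volterra H t1 gauss t x = \int[leb]_(s in `]t1, t'[) gconv (gauss (t - s)) (H s) x.
Proof.
move=> t1t tt'; rewrite /volterra [LHS]Rintegral_mkcond [RHS]Rintegral_mkcond.
apply: eq_Rintegral => s _; rewrite !patchE.
have [st|ts] := ltP s t.
  have E : (s \in `]t1, t[%classic) = (s \in `]t1, t'[%classic).
    by rewrite !mem_setE !in_itv/= st (lt_le_trans st tt').
  by rewrite E.
by rewrite gconv_gauss_le0 ?subr_le0// !if_same.
Qed.

(** The bound of [conv_gauss_time] is not integrable at r = 0; interpolated with
    the trivial one it loses only 1 / sqrt r. *)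
Lemma gauss_conv_holder (r r' : R) (h : 'rV[R]_n -> R) x : 0 < r -> r <= r' -> measurable_fun [set: 'rV[R]_n] h ->
  (forall y, `|h y| <= M) -> 0 <= M ->
  `|gconv (gauss r') h x - gconv (gauss r) h x| <=
  (2 * domC n + n%:R * (n%:R ^+ 2 + n%:R) * domC n) * M * Num.sqrt (r' - r) / Num.sqrt r.
Proof.
move=> r0 rr' mh hM M0; have r'0 := lt_le_trans r0 rr'.
have d0 := domC_ge0.
have b1 : `|gconv (gauss r') h x - gconv (gauss r) h x| <= 2 * domC n * M.
  apply: (le_trans (ler_normB _ _)).
  have := (conv_bound x gkernel_gauss r0 mh hM).2.
  have := (conv_bound x gkernel_gauss r'0 mh hM).2.
  by move=> h1 h2; rewrite -mulrA mulr2n mulrDl mul1r; exact: lerD h1 h2.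
have b2 := conv_gauss_time x r0 rr' mh hM.
set K := n%:R * (n%:R ^+ 2 + n%:R) * domC n in b2 *.
have K0 : 0 <= K by rewrite /K !mulr_ge0 ?addr_ge0 ?sqr_ge0 ?ler0n.
have q0 : 0 <= (r' - r) / r by rewrite divr_ge0 ?subr_ge0// ltW.
have -> : (2 * domC n + K) * M * Num.sqrt (r' - r) / Num.sqrt r =
  (2 * domC n + K) * M * Num.sqrt ((r' - r) / r).
  by rewrite sqrtrM ?subr_ge0// sqrtrV ?(ltW r0)// !mulrA.
have b2' : `|gconv (gauss r') h x - gconv (gauss r) h x| <= K * M * ((r' - r) / r).
  rewrite (_ : K * M * ((r' - r) / r) = @At R n r * M * (r' - r)) //.
  by rewrite /At -/K; ring.
by rewrite (mulrDl _ _ M); apply: min_le_sqrt b1 b2' => //; rewrite !mulr_ge0.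
Qed.

Definition holderC : R :=
  ((2 * domC n + n%:R * (n%:R ^+ 2 + n%:R) * domC n) * M + domC n * M) * (2 * Num.sqrt (T - t1)).

Lemma volterra_gauss_holder t t' x : t1 < t -> t <= t' -> t' <= T ->
  `|volterra H t1 gauss t' x - volterra H t1 gauss t x| <= holderC * Num.sqrt (t' - t).
Proof.
move=> t1t tt' t'T.
have t1t' := lt_le_trans t1t tt'.
have M0 : 0 <= M by apply: volterra_M_ge0; lra.
have d0 := domC_ge0.
have tT : t1 < t <= T by rewrite t1t (le_trans tt').
have t'T' : t1 < t' <= T by rewrite t1t'.
have [i1 _] := integrable_volterra mH x gkernel_gauss sqrt_bounded_gauss t'T'.
have [i2 l2] := integral_invsqrt_reflect t1t.
have [i3 l3] := integral_invsqrt_reflect t1t'.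
set K := (2 * domC n + n%:R * (n%:R ^+ 2 + n%:R) * domC n) * M.
have K0 : 0 <= K by rewrite /K !mulr_ge0 ?addr_ge0 ?mulr_ge0 ?addr_ge0 ?sqr_ge0 ?ler0n.
have E2 : (EFin \o (fun s => (Num.sqrt (t - s))^-1)) \_ `]t1, t[ =
          (EFin \o (fun s => (Num.sqrt (t - s))^-1)) \_ `]t1, t'[.
  apply/funext => s; rewrite !patchE; have [st|ts] := ltP s t.
    by rewrite !mem_setE !in_itv/= st (lt_le_trans st tt').
  by rewrite /= (@ler0_sqrtr _ (t - s)) ?subr_le0// invr0 !if_same.
have i2' : leb.-integrable `]t1, t'[ (EFin \o (fun s => (Num.sqrt (t - s))^-1)).
  apply/integrable_mkcond => //; rewrite -E2.
  by move/integrable_mkcond : i2; exact.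
have l2' : \int[leb]_(s in `]t1, t'[) (Num.sqrt (t - s))^-1 <= 2 * Num.sqrt (T - t1).
  rewrite (_ : \int[leb]_(s in `]t1, t'[) _ = \int[leb]_(s in `]t1, t[) (Num.sqrt (t - s))^-1).
    by apply: (le_trans l2); rewrite ler_wpM2l// ler_wsqrtr// lerD2r; lra.
  by rewrite /Rintegral [in LHS]integral_mkcond [in RHS]integral_mkcond E2.
have l3' : \int[leb]_(s in `]t1, t'[) (Num.sqrt (t' - s))^-1 <= 2 * Num.sqrt (T - t1).
  by apply: (le_trans l3); rewrite ler_wpM2l// ler_wsqrtr// lerD2r; lra.
pose g (s : R) : R := K * Num.sqrt (t' - t) * (Num.sqrt (t - s))^-1 +
  domC n * M * Num.sqrt (t' - t) * (Num.sqrt (t' - s))^-1.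
have [ig Eg] : leb.-integrable `]t1, t'[ (EFin \o g) /\ \int[leb]_(s in `]t1, t'[) g s =
    K * Num.sqrt (t' - t) * (\int[leb]_(s in `]t1, t'[) (Num.sqrt (t - s))^-1) +
    domC n * M * Num.sqrt (t' - t) * \int[leb]_(s in `]t1, t'[) (Num.sqrt (t' - s))^-1.
  exact: (@Rintegral_lin2 R _ _ leb _ _ _ _ _ (measurable_itv _) i2' i3).
have dom s : `]t1, t'[%classic s -> `|gconv (gauss (t' - s)) (H s) x - gconv (gauss (t - s)) (H s) x| <= g s.
  rewrite /= in_itv/= => /andP[t1s st']; have sT : t1 < s < T by rewrite t1s (lt_le_trans st').
  have [st|ts] := ltP s t.
    rewrite /g -[leLHS]addr0 lerD//; last by rewrite !mulr_ge0 ?invr_ge0 ?sqrtr_ge0.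
    rewrite (_ : t' - t = (t' - s) - (t - s)); last by ring.
    apply: gauss_conv_holder => //; [by rewrite subr_gt0|by rewrite lerD2r|exact: measurable_slice|].
    by move=> y; exact: HM.
  rewrite [gconv (gauss (t - s)) _ _]gconv_gauss_le0 ?subr_le0// subr0 /g -[leLHS]add0r lerD//.
    by rewrite mulr_ge0 ?invr_ge0 ?sqrtr_ge0// (mulr_ge0 K0) ?sqrtr_ge0.
  have st0 : 0 < t' - s by rewrite subr_gt0.
  apply: (le_trans (gconv_gauss_le x sT st0)).
  rewrite -mulrA ler_peMr ?mulr_ge0//.
  by rewrite ler_pdivlMr ?sqrtr_gt0// mul1r ler_wsqrtr// lerD2l lerN2.
have i4 : leb.-integrable `]t1, t'[ (EFin \o (fun s => gconv (gauss (t - s)) (H s) x)).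
  have [j _] := integrable_volterra mH x gkernel_gauss sqrt_bounded_gauss tT.
  apply/integrable_mkcond => //.
  have -> : (EFin \o (fun s => gconv (gauss (t - s)) (H s) x)) \_ `]t1, t'[ =
     (EFin \o (fun s => gconv (gauss (t - s)) (H s) x)) \_ `]t1, t[; last first.
    by move/integrable_mkcond : j; exact.
  apply/funext => s; rewrite !patchE; have [st|ts] := ltP s t.
    by rewrite !mem_setE !in_itv/= st (lt_le_trans st tt').
  by rewrite /= gconv_gauss_le0 ?subr_le0// !if_same.
rewrite (volterra_gauss_widen x t1t tt').
apply: (le_trans (@Rintegral_sub_bound R _ _ leb _ _ g `]t1, t'[ (measurable_itv _) i1 i4 ig dom)).
rewrite Eg /holderC -/K.
rewrite mulrAC mulrDl mulrDl lerD//.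
  by rewrite ler_wpM2r ?sqrtr_ge0// (ler_wpM2l K0).
by rewrite [leLHS]mulrAC ler_wpM2r ?sqrtr_ge0// ler_wpM2l// mulr_ge0.
Qed.

End volterra_gauss.

(** * Locally Lipschitz functions *)

Section nonlinearity_facts.
Context {R : realType} (f : R -> R).
Context (f_lip : locally_lipschitz f) (f_mono : {homo f : x y / x <= y}).

(** By compactness of [- M, M] one constant serves for all its points, on balls
    of radius 1 / L. *)
Lemma near_lipschitz (M : R) : exists2 L : R, 0 < L &
  forall a b, `|a| <= M -> `|b - a| <= L^-1 -> `|f b - f a| <= L * `|b - a|.
Proof.
pose P (L : R) (a : R) := forall b, `|b - a| <= L^-1 -> `|f b - f a| <= L * `|b - a|.
have : \forall L \near +oo, `[- M, M]%classic `<=` P L.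
  have /compact_near_coveringP cK := @segment_compact R (- M) M.
  apply: (cK R (pinfty_nbhs R) P).
  move=> x _; have [U nU fU] := f_lip x.
  have [e e0 eU] := (nbhs_ballP _ _).1 nU.
  near=> x' L => b bx'.
  have L0 : 0 < L by near: L; apply: nbhs_pinfty_gt; exact: num_real.
  have Le : 2 / e <= L by near: L; apply: nbhs_pinfty_ge; exact: num_real.
  have x'e : `|x - x'| < e / 2 by near: x'; apply: nbhsx_ballx; rewrite divr_gt0.
  have Ux' : U x' by apply: eU; rewrite /ball/=; apply: (lt_trans x'e); rewrite ltr_pdivrMr// ltr_pMr// ltr1n.
  have Ub : U b.
    apply: eU; rewrite /ball/= (splitr e) -(subrKA x').
    rewrite (le_lt_trans (ler_normD _ _))// ltr_leD// (distrC x').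
    by rewrite (le_trans bx')// -(invf_div 2 e) lef_pV2 ?posrE// divr_gt0.
  have H : forall z, (U `*` U) z -> `|f z.1 - f z.2| <= L * `|z.1 - z.2|.
    by near: L; exact: fU.
  by have := H (b, x') (conj Ub Ux').
move=> H; near (pinfty_nbhs R) => L.
exists L; first by near: L; apply: nbhs_pinfty_gt; exact: num_real.
move=> a b aM; have HL : `[- M, M]%classic `<=` P L by near: L.
by apply: HL; rewrite /= in_itv/= -ler_norml.
Unshelve. all: by end_near. Qed.

(** For points at distance at most 1 / L this is [near_lipschitz]; for the others
    f varies by at most f M - f (- M), by monotonicity. *)
Lemma lipschitz_bounded (M : R) : exists2 L : R, 0 <= L &
  forall a b, `|a| <= M -> `|b| <= M -> `|f b - f a| <= L * `|b - a|.
Proof.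
have [L L0 HL] := near_lipschitz M.
have [M0|M0] := ltP M 0.
  by exists 0 => // a b aM; have := le_lt_trans (le_trans (normr_ge0 _) aM) M0; rewrite ltxx.
(* The largest possible variation of f on [- M, M]. *)
pose D := f M - f (- M).
have D0 : 0 <= D by rewrite subr_ge0 f_mono// lerNl (le_trans _ M0)// oppr_le0.
exists (L * (1 + D)); first exact: (mulr_ge0 (ltW L0) (addr_ge0 ler01 D0)).
move=> a b aM bM.
have [ab|ab] := leP `|b - a| L^-1.
  apply: (le_trans (HL a b aM ab)); rewrite ler_wpM2r// ler_peMr// ?(ltW L0)//.
  by rewrite lerDl.
apply: (@le_trans _ _ D).
  move: aM bM; rewrite !ler_norml => /andP[a1 a2] /andP[b1 b2].
  rewrite /D.
  have := @f_mono _ _ a1; have := @f_mono _ _ a2; have := @f_mono _ _ b1; have := @f_mono _ _ b2.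
  by move=> h1 h2 h3 h4; apply/andP; split; lra.
have h : 1 <= L * `|b - a|.
  by rewrite -(divff (lt0r_neq0 L0)) ler_pM2l// ltW.
rewrite -mulrA mulrCA -[leLHS]mulr1 ler_pM//.
by rewrite lerDr.
Qed.

Lemma lipschitz_continuous (x : R) : {for x, continuous f}.
Proof.
have [L L0 HL] := near_lipschitz `|x|.
apply/cvgrPdist_le => e e0; near=> y.
rewrite distrC; apply: (@le_trans _ _ (L * `|y - x|)).
  apply: HL => //; near: y.
  by apply/nbhs_ballP; exists L^-1; rewrite /= ?invr_gt0// => y; rewrite /ball/= distrC => /ltW.
rewrite mulrC -ler_pdivlMr//; near: y.
by apply/nbhs_ballP; exists (e / L); rewrite /= ?divr_gt0// => y; rewrite /ball/= distrC => /ltW.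
Unshelve. all: by end_near. Qed.

Lemma lipschitz_measurable : measurable_fun [set: R] f.
Proof. by apply: continuous_measurable_fun; exact: lipschitz_continuous. Qed.

End nonlinearity_facts.

(** * Smoothing of bounded mild solutions *)

Section smoothing.
Context {R : realType} {n : nat}.
Implicit Types (x y z v w : 'rV[R]_n) (t s c : R).
Context (f : R -> R) (f_lip : locally_lipschitz f) (f_mono : {homo f : x y / x <= y})
  (f0 : f 0 = 0).
Context (u : R -> 'rV[R]_n -> R) (T : R).
Context (mu_ : measurable_fun [set: R * 'rV[R]_n] (fun p => u p.1 p.2)).
Context (u_bnd : forall t1 : R, 0 < t1 ->
  exists M : R, forall t y, t1 <= t < T -> `|u t y| <= M).
Local Notation H := (fun s y => f (u s y)).
Context (duh : forall t1 t x, 0 < t1 -> t1 < t < T ->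
  u t x = gconv (gauss (t - t1)) (u t1) x + volterra H t1 gauss t x).

Lemma measurable_source : measurable_fun [set: R * 'rV[R]_n] (fun p => f (u p.1 p.2)).
Proof.
by apply: (@measurableT_comp _ _ _ _ _ _ f _ (fun p : R * 'rV[R]_n => u p.1 p.2)) => //; exact: lipschitz_measurable.
Qed.

Lemma source_bound (t1 : R) : 0 < t1 -> exists M : R, forall t y, t1 <= t < T -> `|f (u t y)| <= M.
Proof.
move=> t10; have [M HM] := u_bnd t10.
have [L L0 HL] := lipschitz_bounded f_lip f_mono M.
exists (L * M) => t y tT; have uM := HM t y tT.
have := HL 0 (u t y); rewrite f0 !subr0 normr0 => h.
by rewrite (le_trans (h (le_trans (normr_ge0 _) uM) uM))// ler_wpM2l.
Qed.

(** Restarting at time t1 / 2 leaves the Gaussian a definite time to smooth the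
    free term, and the Duhamel term of a bounded source is Lipschitz. *)
Lemma space_lipschitz (t1 : R) : 0 < t1 < T ->
  exists2 L : R, 0 <= L & forall t, t1 <= t < T -> lipschitz_rV (u t) L.
Proof.
move=> /andP[t10 t1T]; pose t0 : R := t1 / 2.
have t00 : 0 < t0 by rewrite divr_gt0.
have t01 : t0 < t1 by rewrite /t0; lra.
have [M HM] := u_bnd t00; have [N HN] := source_bound t00.
have t0T : t0 <= t0 < T by apply/andP; split => //; lra.
have M0 : 0 <= M := le_trans (normr_ge0 _) (HM t0 0 t0T).
have N0 : 0 <= N := le_trans (normr_ge0 _) (HN t0 0 t0T).
have HN' s y : t0 < s < T -> `|f (u s y)| <= N by move=> /andP[a b]; apply: HN; rewrite ltW.
pose L1 := n%:R * domC n * M / Num.sqrt (t1 - t0).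
pose L2 := n%:R * domC n * N * (2 * Num.sqrt (T - t0)).
have d0 := @domC_ge0 R n.
have L10 : 0 <= L1 by rewrite !mulr_ge0 ?invr_ge0 ?sqrtr_ge0.
have L20 : 0 <= L2 by rewrite !mulr_ge0 ?sqrtr_ge0.
exists (L1 + L2); first exact: addr_ge0.
move=> t /andP[t1t tT] x x'.
have t0t : t0 < t := lt_le_trans t01 t1t.
have tT' : t0 < t < T by rewrite t0t.
have tT'' : t0 < t <= T by rewrite t0t ltW.
have tt0 : 0 < t - t0 by rewrite subr_gt0.
rewrite !(duh _ t00 tT') opprD addrACA.
rewrite (le_trans (ler_normD _ _))// mulrDl lerD//.
  apply: (le_trans (conv_gauss_lip _ _ tt0 (measurable_slice mu_ t0) (fun y => HM t0 y t0T))).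
  rewrite /L1 [leRHS]mulrAC ler_wpM2l ?mulr_ge0//.
  by rewrite lef_pV2 ?posrE ?sqrtr_gt0 ?subr_gt0// ler_wsqrtr// lerD2r.
apply: (le_trans (volterra_gauss_lip measurable_source HN' _ _ tT'')).
rewrite /L2 [leRHS]mulrAC ler_wpM2l ?mulr_ge0//.
by rewrite ler_wpM2l// ler_wsqrtr// lerD2r ltW.
Qed.

(** The same restart as in [space_lipschitz], now with the bounds in time. *)
Lemma time_holder (t1 : R) : 0 < t1 < T ->
  exists2 C : R, 0 <= C & forall t t' x, t1 <= t -> t <= t' -> t' < T ->
    `|u t' x - u t x| <= C * Num.sqrt (t' - t).
Proof.
move=> /andP[t10 t1T]; pose t0 : R := t1 / 2.
have t00 : 0 < t0 by rewrite divr_gt0.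
have t01 : t0 < t1 by rewrite /t0; lra.
have [M HM] := u_bnd t00; have [N HN] := source_bound t00.
have t0T : t0 <= t0 < T by apply/andP; split => //; lra.
have M0 : 0 <= M := le_trans (normr_ge0 _) (HM t0 0 t0T).
have N0 : 0 <= N := le_trans (normr_ge0 _) (HN t0 0 t0T).
have HN' s y : t0 < s < T -> `|f (u s y)| <= N by move=> /andP[a b]; apply: HN; rewrite ltW.
have d0 := @domC_ge0 R n.
have A0 : 0 <= @At R n (t1 - t0).
  by rewrite /At !mulr_ge0 ?addr_ge0 ?sqr_ge0 ?ler0n ?invr_ge0 ?subr_ge0// ltW.
pose C1 := @At R n (t1 - t0) * M * Num.sqrt (T - t0).
have C10 : 0 <= C1 := mulr_ge0 (mulr_ge0 A0 M0) (sqrtr_ge0 _).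
have C20 : 0 <= @holderC R n t0 T N.
  by rewrite /holderC !mulr_ge0 ?sqrtr_ge0// addr_ge0 ?mulr_ge0// addr_ge0 ?mulr_ge0 ?addr_ge0 ?sqr_ge0.
exists (C1 + @holderC R n t0 T N); first exact: addr_ge0.
move=> t t' x t1t tt' t'T.
have t0t : t0 < t := lt_le_trans t01 t1t.
have tT' : t0 < t < T by rewrite t0t (le_lt_trans tt').
have t'T' : t0 < t' < T by rewrite (lt_le_trans t0t).
have tt0 : 0 < t - t0 by rewrite subr_gt0.
rewrite (duh x t00 tT') (duh x t00 t'T') opprD addrACA.
rewrite (le_trans (ler_normD _ _))// mulrDl lerD//; last first.
  exact: (volterra_gauss_holder measurable_source HN' x t0t tt' (ltW t'T)).
have tt'0 : t - t0 <= t' - t0 by rewrite lerD2r.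
apply: (le_trans (conv_gauss_time x tt0 tt'0 (measurable_slice mu_ t0) (fun y => HM t0 y t0T))).
rewrite (_ : t' - t0 - (t - t0) = t' - t); last by ring.
rewrite /C1 -[in leRHS]mulrA ler_pM ?subr_ge0//.
- rewrite mulr_ge0// /At !mulr_ge0 ?addr_ge0 ?sqr_ge0 ?ler0n ?invr_ge0//.
  exact: ltW.
- rewrite ler_wpM2r// /At ler_wpM2l ?mulr_ge0 ?addr_ge0 ?sqr_ge0 ?ler0n//.
  by rewrite lef_pV2 ?posrE ?subr_gt0// lerD2r.
rewrite -{1}(@sqr_sqrtr _ (t' - t)) ?subr_ge0// expr2 ler_wpM2r ?sqrtr_ge0// ler_wsqrtr//.
by rewrite lerB// ltW// (lt_le_trans t0t).
Qed.

Lemma source_lipschitz (t1 : R) : 0 < t1 < T ->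
  exists2 L : R, 0 <= L & forall t, t1 < t < T -> lipschitz_rV (H t) L.
Proof.
move=> /[dup] /andP[t10 t1T] t1T'; have [M HM] := u_bnd t10.
have [L L0 HL] := lipschitz_bounded f_lip f_mono M.
have [L' L'0 HL'] := space_lipschitz t1T'.
exists (L * L'); first exact: mulr_ge0.
move=> t /andP[/ltW t1t tT] x y.
have tT' : t1 <= t < T by rewrite t1t.
by rewrite (le_trans (HL _ _ (HM t y tT') (HM t x tT')))// -mulrA ler_wpM2l// HL'.
Qed.

Lemma solution_time_cvg s y : 0 < s < T -> u r y @[r --> s] --> u s y.
Proof.
move=> /andP[s0 sT]; pose t1 : R := s / 2.
have t10 : 0 < t1 by rewrite divr_gt0.
have t1s : t1 < s by rewrite /t1; lra.
have t1T : 0 < t1 < T by rewrite t10 (lt_trans t1s).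
have [C C0 HC] := time_holder t1T.
apply/cvgrPdist_le => e e0; near=> r.
have t1r : t1 < r by near: r; exact: lt_nbhsr.
have rT : r < T by near: r; exact: lt_nbhsl.
have B : `|u s y - u r y| <= C * Num.sqrt `|s - r|.
  have [sr|rs] := leP s r.
    by rewrite distrC (distrC s) (ger0_norm (_ : 0 <= r - s)) ?subr_ge0// HC// ltW.
  by rewrite (gtr0_norm (_ : 0 < s - r)) ?subr_gt0// HC// ltW.
apply: (le_trans B).
have h : Num.sqrt `|s - r| <= e / (C + 1).
  rewrite -(@ger0_norm _ (e / (C + 1))) ?divr_ge0 ?addr_ge0 ?(ltW e0)//.
  rewrite -[leRHS]sqrtr_sqr ler_wsqrtr//; near: r.
  apply/nbhs_ballP; exists ((e / (C + 1)) ^+ 2); first by rewrite /= exprn_gt0// divr_gt0// ltr_wpDl.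
  by move=> r; rewrite /ball/= => /ltW.
apply: (@le_trans _ _ (C * (e / (C + 1)))); first by rewrite ler_wpM2l.
rewrite mulrCA ler_piMr ?(ltW e0)// ler_pdivrMr ?mul1r ?lerDl//.
by rewrite ltr_wpDl.
Unshelve. all: by end_near. Qed.

Lemma source_time_cvg s y : 0 < s < T -> f (u r y) @[r --> s] --> f (u s y).
Proof.
move=> sT; apply: continuous_cvg; last exact: solution_time_cvg.
exact: lipschitz_continuous.
Qed.

End smoothing.

(** * Bounded mild solutions are classical *)

Section restart.
Context {R : realType} {n : nat}.
Implicit Types (x y z v w : 'rV[R]_n) (t s c : R).
Context (u H : R -> 'rV[R]_n -> R) (t1 T M N L : R).
Context (mu_ : measurable_fun [set: 'rV[R]_n] (u t1)).
Context (uM : forall y, `|u t1 y| <= M).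
Context (mH : measurable_fun [set: R * 'rV[R]_n] (fun p => H p.1 p.2)).
Context (HN : forall s y, t1 < s < T -> `|H s y| <= N).
Context (HL : forall s, t1 < s < T -> lipschitz_rV (H s) L).
Context (L0 : 0 <= L).
Context (Hc : forall s y, t1 < s < T -> H r y @[r --> s] --> H s y).

(** For the Gaussian this is the solution restarted at time t1; for a space
    derivative of the Gaussian it is the same derivative of the solution. *)
Definition duhamel K t x : R := gconv (K (t - t1)) (u t1) x + volterra H t1 K t x.

Lemma sqrt_bounded_d v : sqrt_bounded H t1 T (gauss_d v) (n%:R * `|v| * domC n * N).
Proof.
move=> r s x /andP[r0 rT] sT.
rewrite -[leRHS]mulrAC.
by apply: (conv_bound x (gkernel_gauss_d v) r0 (measurable_slice mH s) _).2 => y; exact: HN.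
Qed.

Lemma sqrt_bounded_dd v w :
  sqrt_bounded H t1 T (gauss_dd v w) ((n%:R ^+ 2 + n%:R) * `|v| * `|w| * domC n * L).
Proof.
move=> r s x /andP[r0 rT] sT.
by apply: (conv_gauss_dd_lip v w x r0 (measurable_slice mH s) _ (HL sT) L0) => y; exact: HN.
Qed.

Lemma duhamel_cvg K A c x t : gkernel K A -> sqrt_bounded H t1 T K c -> t1 < t < T ->
  duhamel K z.2 z.1 @[z --> (x, t)] --> duhamel K t x.
Proof.
move=> gK Kc /[dup] tT /andP[t1t _].
apply: (@continuous_at_seq R _ (fun z : 'rV[R]_n * R => duhamel K z.2 z.1) (x, t)) => w wxt.
have w1 : (w k).1 @[k --> \oo] --> x by apply: (cvg_comp _ _ wxt); exact: cvg_fst.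
have w2 : (w k).2 @[k --> \oo] --> t by apply: (cvg_comp _ _ wxt); exact: cvg_snd.
apply: cvgD; last exact: (volterra_cvg mH HN Hc gK Kc tT w2 w1).
apply: (@conv_cvg R n K A (fun=> u t1) (u t1) M (fun k => (w k).2 - t1) (fun k => (w k).1)) => //.
- by move=> y; exact: cvg_cst.
- by rewrite subr_gt0.
- by apply: cvgB => //; exact: cvg_cst.
Qed.

Lemma duhamel_is_derive K A K' A' c c' v x t : gkernel K A -> gkernel K' A' ->
  (forall (r : R) z (s : R), 0 < r -> is_derive s 1 (fun s => K r (z + s *: v)) (K' r (z + s *: v))) ->
  sqrt_bounded H t1 T K c -> sqrt_bounded H t1 T K' c' -> t1 < t <= T ->
  is_derive x v (duhamel K t) (duhamel K' t x).
Proof.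
move=> gK gK' KK' Kc K'c tT; have /andP[t1t _] := tT.
have tt1 : 0 < t - t1 by rewrite subr_gt0.
apply: is_deriveD.
- by apply: (conv_is_derive x gK gK' _ mu_ uM tt1) => z s; exact: KK'.
- exact: (volterra_is_derive mH HN x gK gK' KK' Kc K'c tT).
Qed.

Lemma duhamel_is_derive_t x t : t1 < t < T ->
  is_derive t 1 (fun t => duhamel gauss t x) (duhamel gauss_dt t x + H t x).
Proof.
move=> tT; have /andP[t1t _] := tT.
have tt1 : 0 < t - t1 by rewrite subr_gt0.
rewrite /duhamel -addrA [volterra _ _ _ _ _ + _]addrC.
apply: is_deriveD; last exact: (volterra_is_derive_t mH HN HL L0 Hc x tT).
have d1 : is_derive t (1 : R) (fun t : R => t - t1) 1 by exact: is_derive_shift.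
have d0 (z : 'rV[R]_n) (s : R) : 0 < s -> is_derive s 1 (gauss ^~ z) (gauss_dt s z).
  exact: is_derive_gauss_t.
have d2 := conv_is_derive_t x gkernel_gauss gkernel_gauss_dt d0 mu_ uM tt1.
have := @is_derive1_comp R (fun t : R => gconv (gauss t) (u t1) x) (fun t : R => t - t1) t _ _ d2 d1.
by rewrite mulr1.
Qed.

Lemma volterra_dtE x t : t1 < t < T ->
  volterra H t1 gauss_dt t x = \sum_i volterra H t1 (gauss_dd (basis_rV i) (basis_rV i)) t x.
Proof.
move=> /andP[t1t tT]; have tT' : t1 < t <= T by rewrite t1t ltW.
transitivity (\int[@lebesgue_measure R]_(s in `]t1, t[)
   \sum_i gconv (gauss_dd (basis_rV i) (basis_rV i) (t - s)) (H s) x).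
  apply: eq_Rintegral => s /set_mem; rewrite /= in_itv/= => /andP[t1s st].
  apply: (@conv_gauss_dtE R n _ _ x N _ (measurable_slice mH s)); first by rewrite subr_gt0.
  by move=> y; apply: HN; rewrite t1s (lt_trans st).
have I i := (integrable_volterra mH x (gkernel_gauss_dd (basis_rV i) (basis_rV i))
   (@sqrt_bounded_dd (basis_rV i) (basis_rV i)) tT').1.
exact: (@Rintegral_sum R _ _ (@lebesgue_measure R) _ (index_enum 'I_n) _ _ (measurable_itv _) I).2.
Qed.

Lemma duhamel_dtE x t : t1 < t < T ->
  duhamel gauss_dt t x = \sum_i duhamel (gauss_dd (basis_rV i) (basis_rV i)) t x.
Proof.
move=> tT; have /andP[t1t _] := tT.
rewrite /duhamel big_split/= volterra_dtE//; congr (_ + _).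
by apply: (@conv_gauss_dtE R n _ _ x M _ mu_ uM); rewrite subr_gt0.
Qed.

End restart.

Section classical_regularity.
Context {R : realType} {n : nat}.
Implicit Types (x y z v w : 'rV[R]_n) (t s c : R).
Context (f : R -> R) (f_lip : locally_lipschitz f) (f_mono : {homo f : x y / x <= y})
  (f0 : f 0 = 0).
Context (u : R -> 'rV[R]_n -> R) (T : R).
Context (mu_ : measurable_fun [set: R * 'rV[R]_n] (fun p => u p.1 p.2)).
Context (u_bnd : forall t1 : R, 0 < t1 ->
  exists M : R, forall t y, t1 <= t < T -> `|u t y| <= M).
Local Notation H := (fun s y => f (u s y)).
Context (duh : forall t1 t x, 0 < t1 -> t1 < t < T ->
  u t x = gconv (gauss (t - t1)) (u t1) x + volterra H t1 gauss t x).

(** Everything that the restart at time t1 gives: the kernels in the Duhamel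
    formula may be differentiated, and the resulting functions are continuous. *)
Lemma regular_from (t1 : R) : 0 < t1 < T ->
  [/\ forall x t v, t1 < t < T -> is_derive x v (u t) (duhamel u H t1 (gauss_d v) t x),
      forall x t v w, t1 < t < T ->
        is_derive x w (duhamel u H t1 (gauss_d v) t) (duhamel u H t1 (gauss_dd v w) t x),
      forall x t, t1 < t < T -> is_derive t 1 (u ^~ x) (duhamel u H t1 gauss_dt t x + f (u t x)),
      forall x t, t1 < t < T -> duhamel u H t1 gauss_dt t x =
        \sum_i duhamel u H t1 (gauss_dd (basis_rV i) (basis_rV i)) t x &
      forall K, K = gauss \/ K = gauss_dt \/ (exists v, K = gauss_d v) \/
         (exists v w, K = gauss_dd v w) ->
        forall x t, t1 < t < T ->
        duhamel u H t1 K z.2 z.1 @[z --> (x, t)] --> duhamel u H t1 K t x].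
Proof.
move=> /[dup] t1T' /andP[t10 t1T].
have [M HM] := u_bnd t10.
have uM y : `|u t1 y| <= M by apply: HM; rewrite lexx.
have [N HN'] := source_bound f_lip f_mono f0 u_bnd t10.
have HN s y : t1 < s < T -> `|H s y| <= N by move=> /andP[a b]; apply: HN'; rewrite ltW.
have mH := measurable_source f_lip mu_.
have [L L0 HL] := source_lipschitz f_lip f_mono f0 mu_ u_bnd duh t1T'.
have Hc s y : t1 < s < T -> H r y @[r --> s] --> H s y.
  move=> /andP[a b]; apply: (source_time_cvg f_lip f_mono f0 mu_ u_bnd duh).
  by rewrite b (lt_trans t10).
have mu1 := measurable_slice mu_ t1.
have E t x : t1 < t < T -> u t x = duhamel u H t1 gauss t x by move=> tT; exact: duh.
split.
- move=> x t v tT; have /andP[t1t tT'] := tT.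
  rewrite (_ : u t = duhamel u H t1 gauss t); last by apply/funext => y; exact: E.
  apply: (duhamel_is_derive mu1 uM mH HN x gkernel_gauss (gkernel_gauss_d v)
    (fun r z s r0 => is_derive_gauss v z s r0) (sqrt_bounded_gauss mH HN) (sqrt_bounded_d mH HN v)).
  by rewrite t1t ltW.
- move=> x t v w /andP[t1t tT'].
  apply: (duhamel_is_derive mu1 uM mH HN x (gkernel_gauss_d v) (gkernel_gauss_dd v w)
    (fun r z s r0 => is_derive_gauss_d v w z s r0) (sqrt_bounded_d mH HN v) (sqrt_bounded_dd mH HN HL L0 v w)).
  by rewrite t1t ltW.
- move=> x t tT; have /andP[t1t tT'] := tT.
  apply: (near_eq_is_derive _ (duhamel_is_derive_t mu1 uM mH HN HL L0 Hc x tT)).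
  near=> s; apply/esym/E; apply/andP; split; near: s; [exact: lt_nbhsr|exact: lt_nbhsl].
- by move=> x t tT; exact: (duhamel_dtE mu1 uM mH HN HL L0).
- move=> K [->|[->|[[v ->]|[v [w ->]]]]] x t tT.
  + exact: (duhamel_cvg mu1 uM mH HN Hc gkernel_gauss (sqrt_bounded_gauss mH HN)).
  + exact: (duhamel_cvg mu1 uM mH HN Hc gkernel_gauss_dt (sqrt_bounded_dt mH HN HL L0)).
  + exact: (duhamel_cvg mu1 uM mH HN Hc (gkernel_gauss_d v) (sqrt_bounded_d mH HN v)).
  + exact: (duhamel_cvg mu1 uM mH HN Hc (gkernel_gauss_dd v w) (sqrt_bounded_dd mH HN HL L0 v w)).
Unshelve. all: by end_near. Qed.

Lemma QT_half x t : QT T (x, t) -> [/\ 0 < t / 2, t / 2 < t, 0 < t / 2 < T & t / 2 < t < T].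
Proof.
move=> [_]; rewrite /= in_itv/= => /andP[t0 tT]; have h : 0 < t / 2 by rewrite divr_gt0.
by split; [|lra|apply/andP; split; lra|apply/andP; split; lra].
Qed.

Lemma partialE i x t t1 : 0 < t1 < T -> t1 < t < T ->
  partial i (u t) x = duhamel u H t1 (gauss_d (basis_rV i)) t x.
Proof. by move=> t1T tT; have [h _ _ _ _] := regular_from t1T; have [_] := h x t (basis_rV i) tT. Qed.

Lemma partial2E i j x t t1 : 0 < t1 < T -> t1 < t < T ->
  partial j (partial i (u t)) x = duhamel u H t1 (gauss_dd (basis_rV i) (basis_rV j)) t x.
Proof.
move=> t1T tT; rewrite (_ : partial i (u t) = duhamel u H t1 (gauss_d (basis_rV i)) t).
  by have [_ h _ _ _] := regular_from t1T; have [_] := h x t (basis_rV i) (basis_rV j) tT.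
by apply/funext => y; exact: partialE.
Qed.

Lemma dtE x t t1 : 0 < t1 < T -> t1 < t < T ->
  dt u t x = duhamel u H t1 gauss_dt t x + f (u t x).
Proof.
by move=> t1T tT; have [_ _ h _ _] := regular_from t1T; rewrite /dt derive1E; have [_] := h x t tT.
Qed.

Lemma heat_equation x t : QT T (x, t) -> dt u t x = laplacian (u t) x + f (u t x).
Proof.
move=> /QT_half[_ _ t1T tT]; rewrite (dtE x t1T tT); congr (_ + _).
have [_ _ _ -> // _] := regular_from t1T.
by rewrite /laplacian; apply: eq_bigr => i _; rewrite (partial2E i i x t1T tT).
Qed.

Lemma open_QT : open (QT T : set ('rV[R]_n * R)).
Proof.
rewrite (_ : QT T = snd @^-1` `]0, T[%classic); last first.
  by apply/seteqP; split => [z []|z]//=; split.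
by apply: open_comp; [move=> z _; exact: cvg_snd|exact: interval_open].
Qed.

(** Every point (x, t) has a neighbourhood on which the restart at time t / 2
    is possible. *)
Lemma continuous_QT (g : 'rV[R]_n * R -> R) (h : R -> 'rV[R]_n * R -> R) :
  (forall t1 x t, 0 < t1 < T -> t1 < t < T -> g (x, t) = h t1 (x, t)) ->
  (forall t1 x t, 0 < t1 < T -> t1 < t < T -> h t1 z @[z --> (x, t)] --> h t1 (x, t)) ->
  {within QT T, continuous g}.
Proof.
move=> gh hc; rewrite continuous_open_subspace; last exact: open_QT.
move=> [x t] /set_mem /QT_half[_ _ t1T tT].
rewrite /continuous_at (gh _ x t t1T tT); apply: cvg_trans (hc _ x t t1T tT).
apply: near_eq_cvg; near=> z.
rewrite [z]surjective_pairing; apply: esym; apply: gh => //.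
have /andP[t1t tT'] := tT.
have zI : (`]t / 2, T[%classic : set R) z.2.
  near: z; apply: (@cvg_snd _ _ (nbhs x) (nbhs t)).
  change (nbhs t (`]t / 2, T[%classic : set R)).
  by apply: open_nbhs_nbhs; split; [exact: interval_open|rewrite /= in_itv].
by move: zI; rewrite /= in_itv.
Unshelve. all: by end_near. Qed.

Lemma solution_continuous : {within QT T, continuous (fun z : 'rV[R]_n * R => u z.2 z.1)}.
Proof.
refine (@continuous_QT (fun p => u p.2 p.1) (fun t1 p => duhamel u H t1 gauss p.2 p.1) _ _) => t1 x t t1T tT/=.
  by apply: duh => //; case/andP : t1T.
by have [_ _ _ _ h] := regular_from t1T; apply: (h gauss) => //; left.
Qed.

Lemma solution_C21 : C21 T u.
Proof.
split.
- move=> x t /QT_half[_ _ t1T tT]; have [h1 h2 h3 _ _] := regular_from t1T; split.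
  + by have [] := h3 x t tT.
  + by move=> i; have [] := h1 x t (basis_rV i) tT.
  + move=> i j; rewrite (_ : partial i (u t) = duhamel u H (t / 2) (gauss_d (basis_rV i)) t).
      by have [] := h2 x t (basis_rV i) (basis_rV j) tT.
    by apply/funext => y; exact: partialE.
- exact: solution_continuous.
- refine (@continuous_QT (fun p => dt u p.2 p.1) (fun t1 p => duhamel u H t1 gauss_dt p.2 p.1 + f (u p.2 p.1)) _ _) => t1 x t t1T tT/=.
    exact: dtE.
  apply: cvgD.
    by have [_ _ _ _ h] := regular_from t1T; apply: (h gauss_dt) => //; right; left.
  apply: continuous_cvg; first exact: lipschitz_continuous.
  move: solution_continuous; rewrite continuous_open_subspace; last exact: open_QT.
  move=> /(_ (x, t)) h; apply: h; apply/mem_set; split => //=; rewrite in_itv/=.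
  by case/andP: tT => a ->; case/andP: t1T => b _; rewrite (lt_trans b).
- move=> i; refine (@continuous_QT (fun p => partial i (u p.2) p.1) (fun t1 p => duhamel u H t1 (gauss_d (basis_rV i)) p.2 p.1) _ _) => t1 x t t1T tT/=.
    exact: partialE.
  have [_ _ _ _ h] := regular_from t1T; apply: (h (gauss_d (basis_rV i))) => //.
  by right; right; left; exists (basis_rV i).
- move=> i j; refine (@continuous_QT (fun p => partial j (partial i (u p.2)) p.1) (fun t1 p => duhamel u H t1 (gauss_dd (basis_rV i) (basis_rV j)) p.2 p.1) _ _) => t1 x t t1T tT/=.
    exact: partial2E.
  have [_ _ _ _ h] := regular_from t1T; apply: (h (gauss_dd (basis_rV i) (basis_rV j))) => //.
  by right; right; right; exists (basis_rV i), (basis_rV j).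
Qed.

End classical_regularity.

(** * Strong measurability with values in the bounded functions *)

Section Linfty.
Context {R : realType} {n : nat}.
Local Notation mu := (@lebesgue_rV R n).
Implicit Types (x y : 'rV[R]_n) (t s : R).

Lemma Linfty_le (g : 'rV[R]_n -> R) (M : R) : 0 <= M -> (forall y, `|g y| <= M) ->
  ('N[mu]_(+oo) [EFin \o g] <= M%:E)%E.
Proof.
move=> M0 gM; rewrite unlock /Lnorm; case: ifPn => _; last by rewrite lee_fin.
by apply: ess_sup_ler => y; rewrite lee_fin.
Qed.

Lemma Linfty_bounded (g : 'rV[R]_n -> R) (M : R) : 0 <= M ->
  measurable_fun [set: 'rV[R]_n] g -> (forall y, `|g y| <= M) -> g \in Lfun mu +oo%E.
Proof.
move=> M0 mg gM; rewrite inE; apply/andP; split; first by rewrite inE.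
by rewrite inE/= /finite_norm (le_lt_trans (Linfty_le M0 gM))// ltry.
Qed.

Context (u : R -> 'rV[R]_n -> R) (T : R).
Context (mu_ : measurable_fun [set: R * 'rV[R]_n] (fun p => u p.1 p.2)).
Context (u_bnd : forall t1 : R, 0 < t1 ->
  exists M : R, forall t y, t1 <= t < T -> `|u t y| <= M).
Context (u_holder : forall t1 : R, 0 < t1 < T ->
  exists2 C : R, 0 <= C & forall t t' x, t1 <= t -> t <= t' -> t' < T ->
    `|u t' x - u t x| <= C * Num.sqrt (t' - t)).

(** The value of u at a point of the grid of mesh 1 / (k + 1); at time zero, where
    u may be unbounded, and from T on, it is replaced by 0. *)
Definition grid_value (k m : nat) : 'rV[R]_n -> R :=
  if (0 < m)%N && (m%:R / k.+1%:R < T) then u (m%:R / k.+1%:R) else fun=> 0.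

Definition grid_approx (k : nat) t : 'rV[R]_n -> R :=
  if 0 < t < T then grid_value k (Num.truncn (t * k.+1%:R)) else fun=> 0.

Lemma grid_value_Linfty k m : grid_value k m \in Lfun mu +oo%E.
Proof.
rewrite /grid_value; case: ifPn => [/andP[m0 mT]|_].
  have h : 0 < m%:R / k.+1%:R :> R by rewrite divr_gt0// ltr0n.
  have [M HM] := u_bnd h.
  have hM y : `|u (m%:R / k.+1%:R) y| <= M by apply: HM; rewrite lexx.
  apply: Linfty_bounded (le_trans (normr_ge0 _) (hM 0)) (measurable_slice mu_ _) hM.
by apply: (@Linfty_bounded _ 0) => // y; rewrite normr0.
Qed.

Lemma measurable_grid_cell k m :
  measurable ([set t : R | 0 < t < T /\ Num.truncn (t * k.+1%:R) = m] : set (measurableTypeR R)).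
Proof.
rewrite (_ : [set t | _] = `]0, T[%classic `&` `[m%:R / k.+1%:R, m.+1%:R / k.+1%:R[%classic).
  by apply: measurableI; exact: measurable_itv.
apply/seteqP; split => t /=; rewrite !in_itv/= ler_pdivrMr// ltr_pdivlMr//.
  move=> [h <-]; split=> //.
  by apply: truncn_itv; rewrite mulr_ge0//; case/andP : h => /ltW.
by move=> [h1 h2]; split=> //; exact: truncn_def.
Qed.

Lemma grid_approx_simple k : @simple_Linfty R n (grid_approx k).
Proof.
split.
- apply: (@sub_finite_set _ _ ((fun=> 0) |` (grid_value k @` `I_(Num.truncn (T * k.+1%:R)).+1))).
    move=> _ [t _ <-]; rewrite /grid_approx; case: ifPn => [/andP[t0 tT]|_]; last by left.
    right; exists (Num.truncn (t * k.+1%:R)) => //=.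
    by rewrite ltnS le_truncn// ler_wpM2r// ltW.
  rewrite finite_setU; split; first exact: finite_set1.
  by apply: finite_image; exact: finite_II.
- move=> t; rewrite /grid_approx; case: ifPn => _; first exact: grid_value_Linfty.
  by apply: (@Linfty_bounded _ 0) => // y; rewrite normr0.
move=> g.
have mP (P : Prop) : measurable ([set t : R | P] : set (measurableTypeR R)).
  have [p|p] := pselect P.
    by rewrite (_ : [set t | P] = setT)//; apply/seteqP; split.
  by rewrite (_ : [set t | P] = set0)//; apply/seteqP; split.
rewrite (_ : _ @^-1` _ = (\bigcup_m ([set t : R | 0 < t < T /\ Num.truncn (t * k.+1%:R) = m] `&` [set t | grid_value k m = g])) `|` (~` `]0, T[%classic `&` [set t | (fun=> 0) = g])).
  apply: measurableU.
    by apply: bigcupT_measurable => m; apply: measurableI; [exact: measurable_grid_cell|exact: mP].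
  by apply: measurableI; [apply: measurableC; exact: measurable_itv|exact: mP].
apply/seteqP; split => t /=; rewrite /grid_approx.
  case: ifPn => [h e|h e]; last by right; split=> //; rewrite in_itv/=; exact/negP.
  by left; exists (Num.truncn (t * k.+1%:R)).
move=> [[m _ [[-> <-]//]]|[]]; rewrite in_itv/= => /negP h e.
by rewrite (negbTE h).
Qed.

(** By the Hoelder bound in time, rounding the time down to the grid changes u by
    O(1 / sqrt k) uniformly in space; for large k the grid point is at least t / 2. *)
Lemma grid_approx_cvg t : 0 < t < T ->
  'N[mu]_(+oo) [EFin \o (grid_approx k t \- u t)%R]%E @[k --> \oo] --> 0%E.
Proof.
move=> /[dup] tT /andP[t0 tT'].
have t1T : 0 < t / 2 < T by apply/andP; split; [rewrite divr_gt0|lra].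
have [C C0 HC] := u_holder t1T.
have cv : (C * Num.sqrt (k.+1%:R^-1))%:E @[k --> \oo] --> 0%E.
  rewrite -[0%E]/((0 : R)%:E); apply: cvg_EFin; first exact: nearW.
  rewrite -[0](mulr0 C) -(@sqrtr0 R); apply: cvgM; first exact: cvg_cst.
  apply: continuous_cvg; first exact: sqrt_continuous.
  exact: (@cvg_harmonic R).
apply: (squeeze_cvge _ (cvg_cst 0%E) cv).
near=> k; rewrite Lnorm_ge0/=; apply: Linfty_le; first by rewrite mulr_ge0 ?sqrtr_ge0.
move=> y; rewrite /grid_approx tT /grid_value.
set m := Num.truncn _.
have k0 : 0 < k.+1%:R :> R by rewrite ltr0n.
have /andP[h1 h2] : m%:R <= t * k.+1%:R < m.+1%:R by apply: truncn_itv; rewrite mulr_ge0// ltW.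
have kt : 1 <= t / 2 * k.+1%:R.
  rewrite -ler_pdivrMl ?mulr1 ?divr_gt0// invf_div.
  apply: (@le_trans _ _ k%:R); last by rewrite ler_nat.
  by near: k; exact: nbhs_infty_ger.
have m1 : t / 2 <= m%:R / k.+1%:R.
  rewrite ler_pdivlMr//; move: h2; rewrite -natr1 => h2; lra.
have m2 : m%:R / k.+1%:R <= t by rewrite ler_pdivrMr.
have m0 : (0 < m)%N.
  rewrite -(ltr_nat R); rewrite -(@pmulr_lgt0 _ (k.+1%:R^-1)) ?invr_gt0//.
  by apply: lt_le_trans m1; rewrite divr_gt0.
rewrite m0 (le_lt_trans m2 tT')/= distrC; apply: (le_trans (HC _ _ y m1 m2 tT')).
rewrite ler_wpM2l// ler_wsqrtr// -(ler_pM2r k0) mulVf ?gt_eqF// mulrBl divfK ?gt_eqF//.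
by move: h2; rewrite -natr1 => h2; lra.
Unshelve. all: by end_near. Qed.

Lemma solution_Linftyloc : Linftyloc_Linfty T u.
Proof.
split.
  exists grid_approx; first exact: grid_approx_simple.
  by apply: nearW => t; rewrite /= in_itv/=; exact: grid_approx_cvg.
move=> K cK KT; have [->|/set0P[a Ka]] := eqVneq K set0.
  by exists 0; apply: nearW.
have cinf : exists2 t1 : R, 0 < t1 & K `<=` [set t | t1 <= t].
  have : \forall e \near 0^'+, K `<=` [set t | e <= t].
    have /compact_near_coveringP cK' := cK.
    apply: (cK' R (0^'+) (fun e t => e <= t)) => t Kt.
    have t0 : 0 < t by move: (KT _ Kt); rewrite /= in_itv/= => /andP[].
    have th : t / 2 < t by rewrite ltr_pdivrMr// ltr_pMr// ltr1n.
    near=> t' e => /=; apply: (@le_trans _ _ (t / 2)).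
      by near: e; apply: nbhs_right_le; rewrite divr_gt0.
    by apply: ltW; near: t'; exact: lt_nbhsr.
  move=> h; near (0 : R)^'+ => e; exists e; first by near: e; exact: nbhs_right_gt.
  by near: e; exact: h.
have [t1 t10 Kt1] := cinf.
have [M HM] := u_bnd t10; exists M; apply: nearW => t Kt.
have /andP[t0 tT] : 0 < t < T by move: (KT _ Kt); rewrite /= in_itv.
have hM y : `|u t y| <= M by apply: HM; rewrite tT andbT; exact: Kt1.
have M0 := le_trans (normr_ge0 _) (hM 0).
split; last exact: Linfty_le.
exact: (Linfty_bounded M0 (measurable_slice mu_ _) hM).
Unshelve. all: by end_near. Qed.

End Linfty.

(** * The growth condition *)

Section growth.
Context {R : realType} (f : R -> R).
Context (f_lip : locally_lipschitz f) (f_mono : {homo f : x y / x <= y}) (f0 : f 0 = 0).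

Lemma quotient_ge0 (t : R) : 0 <= f t / t.
Proof.
have [t0|t0] := leP 0 t; first by rewrite divr_ge0// -f0 f_mono.
by rewrite mulr_le0// ?invr_le0 ?(ltW t0)// -f0 f_mono// ltW.
Qed.

Lemma quotient_ubound (s : R) : has_ubound [set f t / t | t in [set t | 0 < `|t| <= s]].
Proof.
have [L L0 HL] := lipschitz_bounded f_lip f_mono s.
exists L => _ [t /= /andP[t0 ts] <-].
have s0 : `|0 : R| <= s by rewrite normr0 (le_trans (ltW t0)).
have := HL 0 t s0 ts; rewrite f0 !subr0 => h.
by rewrite (le_trans (ler_norm _))// normrM normfV ler_pdivrMr.
Qed.

Lemma quotient_le_ell (s t : R) : 0 < `|t| <= s -> f t / t <= ell f s.
Proof.
move=> ts; have s0 : 0 < s by case/andP : ts => /lt_le_trans; exact.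
rewrite /ell gt_eqF//; apply: ub_le_sup; first exact: quotient_ubound.
by exists t.
Qed.

Lemma ell_ge0 (s : R) : 0 <= ell f s.
Proof.
have [s0|s0] := ltP 0 s.
  apply: le_trans (quotient_ge0 s) _; apply: quotient_le_ell.
  by rewrite gtr0_norm// s0 lexx.
rewrite /ell; case: eqVneq => // _; rewrite (_ : [set _ | _ in _] = set0) ?sup0//.
by apply/seteqP; split=> // _ [t /= /andP[t0 ts] _]; move: (lt_le_trans t0 (le_trans ts s0)); rewrite ltxx.
Qed.

Lemma le_ell (s t : R) : `|t| <= s -> `|f t| <= ell f s * `|t|.
Proof.
move=> ts; have [->|t0] := eqVneq t 0; first by rewrite f0 normr0 mulr0.
have nt : 0 < `|t| by rewrite normr_gt0.
rewrite -ler_pdivrMr// -normfV -normrM ger0_norm ?quotient_ge0//.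
by apply: quotient_le_ell; rewrite nt.
Qed.

(** The supremum is taken over a set that grows with s. *)
Lemma ell_homo : {homo ell f : x y / x <= y}.
Proof.
move=> x y xy; have [x0|x0] := ltP 0 x; last first.
  apply: le_trans (ell_ge0 y); rewrite /ell; case: eqVneq => // _; rewrite (_ : [set _ | _ in _] = set0) ?sup0//.
  by apply/seteqP; split=> // _ [t /= /andP[t0 tx] _]; move: (lt_le_trans t0 (le_trans tx x0)); rewrite ltxx.
rewrite {1}/ell gt_eqF//; apply: ge_sup.
  by exists (f x / x), x => //=; rewrite gtr0_norm// x0 lexx.
move=> _ [t /= /andP[t0 tx] <-]; apply: quotient_le_ell.
by rewrite t0 (le_trans tx).
Qed.

Lemma measurable_ell : measurable_fun [set: R] (ell f).
Proof. by apply: nondecreasing_measurable => //; exact: ell_homo. Qed.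

End growth.

Section growth_integral.
Context {R : realType}.
Local Notation leb := (@lebesgue_measure R).
Context (L : R -> R) (b k : R).
Context (L_ge0 : forall s, 0 <= L s) (L_homo : {homo L : x y / x <= y}).
Context (mL : measurable_fun [set: R] L).
Context (b0 : 0 < b) (k0 : 0 < k).
Context (L_int : (\int[leb]_(s in `[1%R, +oo[) (s `^ (- (1 + b)) * L s)%:E < +oo)%E).

Let w (r : R) : R := r `^ (- (1 + b)) * L r.
Let rad (s : R) : R := (k / s) `^ b^-1.
Let C : R := 2 `^ (1 + b) * k.
Let Q (p : R * R) : R :=
  if [&& 0 < p.1, p.1 < k, rad p.1 <= p.2 & p.2 <= 2 * rad p.1] then C * (p.1^-1 * w p.2) else 0.

Let w0 r : 0 <= w r. Proof. by rewrite mulr_ge0 ?powR_ge0. Qed.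

Let C0 : 0 <= C. Proof. by rewrite mulr_ge0 ?powR_ge0 ?ltW. Qed.

Let radE (s : R) : 0 < s -> rad s `^ b = k / s.
Proof. by move=> s0; rewrite -powRrM mulVf ?gt_eqF// powRr1// divr_ge0// ltW. Qed.

Let rad1 (s : R) : 0 < s < k -> 1 <= rad s.
Proof.
move=> /andP[s0 sk]; have <- : 1 `^ b^-1 = 1 :> R by rewrite powR1.
rewrite ge0_ler_powR ?invr_ge0 ?(ltW b0)//.
- by rewrite nnegrE.
- by rewrite nnegrE divr_ge0// ltW.
- by rewrite ler_pdivlMr// mul1r ltW.
Qed.

Let mw : measurable_fun [set: R] w.
Proof. by apply: measurable_funM => //; exact: measurable_powR. Qed.

Let mrad : measurable_fun [set: R] rad.
Proof.
apply: (@measurableT_comp _ _ _ _ _ _ (fun x : R => x `^ b^-1)); first exact: measurable_powR.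
by apply: measurable_funM => //; exact: measurable_invr.
Qed.

Let mQ : measurable_fun [set: R * R] Q.
Proof.
have m1 : measurable_fun [set: R * R] (fun p : R * R => p.1) by exact: measurable_fst.
have m2 : measurable_fun [set: R * R] (fun p : R * R => p.2) by exact: measurable_snd.
have mr : measurable_fun [set: R * R] (fun p : R * R => rad p.1) by exact: measurableT_comp.
apply: measurable_fun_ifT => //.
  apply: measurable_and; first exact: measurable_fun_ltr.
  apply: measurable_and; first exact: measurable_fun_ltr.
  apply: measurable_and; apply: measurable_fun_ler => //.
  exact: measurable_funM.
apply: measurable_funM => //; apply: measurable_funM; last exact: measurableT_comp.
by apply: (@measurableT_comp _ _ _ _ _ _ (@GRing.inv R)) => //; exact: measurable_invr.
Qed.

Let kern0 (s r : R) : 0 < s -> 0 <= C * (s^-1 * w r).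
Proof. by move=> s0; rewrite (mulr_ge0 C0)// mulr_ge0 ?w0// invr_ge0 ltW. Qed.

Let Q0 p : 0 <= Q p.
Proof. by rewrite /Q; case: ifPn => // /and4P[p0 _ _ _]; exact: kern0. Qed.

Let C20 : 0 <= C * 2 `^ b.
Proof. exact: (mulr_ge0 C0 (powR_ge0 _ _)). Qed.

Let lower (s : R) : 0 < s < k -> ((L (rad s))%:E <= \int[leb]_r (Q (s, r))%:E)%E.
Proof.
move=> /[dup] sk /andP[s0 sk']; have r1 := rad1 sk; have r0 := lt_le_trans ltr01 r1.
set r := rad s in r1 r0 *.
have r2 : r <= 2 * r by rewrite ler_peMl// ?ler1n// ltW.
have r20 : 0 < 2 * r by rewrite mulr_gt0.
have E : (\int[leb]_x (Q (s, x))%:E = \int[leb]_(x in `[r, (2 * r)%R]) (C * (s^-1 * w x))%:E)%E.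
  rewrite [RHS]integral_mkcond; apply: eq_integral => x _; rewrite patchE /Q/= s0 sk'/=.
  rewrite mem_setE in_itv/= -/r; by case: ifPn.
pose lo : R := C * (s^-1 * ((2 * r) `^ (- (1 + b)) * L r)).
have lo0 : 0 <= lo by rewrite (mulr_ge0 C0)// mulr_ge0 ?invr_ge0 ?(ltW s0)// mulr_ge0 ?powR_ge0.
rewrite E; apply: (@le_trans _ _ (\int[leb]_(x in `[r, (2 * r)%R]) (cst lo%:E x))%E).
  rewrite integral_cst//= lebesgue_measure_itv/= lte_fin ltr_pMl// ltr1n -EFinD -EFinM lee_fin.
  rewrite (_ : 2 * r - r = r); last by ring.
  have Er : r `^ (1 + b) = r * (k / s).
    by rewrite powRD ?(gt_eqF r0) ?implybT// powRr1 ?(ltW r0)// radE.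
  have t0 : 0 < 2 `^ (1 + b) :> R by rewrite powR_gt0.
  rewrite /lo /C powRN powRM ?(ltW r0)// Er.
  suff -> : 2 `^ (1 + b) * k * (s^-1 * ((2 `^ (1 + b) * (r * (k / s)))^-1 * L r)) * r = L r by [].
  by move: t0; set c := 2 `^ (1 + b) => t0; field; rewrite !gt_eqF.
apply: ge0_le_integral => //=.
- by apply/measurable_EFinP; apply: measurable_funTS; do 2 apply: measurable_funM => //.
move=> x; rewrite in_itv/= => /andP[rx x2r]; rewrite lee_fin ler_wpM2l// ler_wpM2l ?invr_ge0 ?(ltW s0)//.
have x0 := lt_le_trans r0 rx.
rewrite /w ler_pM ?powR_ge0 ?L_homo// !powRN lef_pV2 ?posrE ?powR_gt0// ge0_ler_powR ?nnegrE ?(ltW x0) ?(ltW r20)//.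
by rewrite addr_ge0// ltW.
Qed.

Let upper (r : R) : (\int[leb]_s (Q (s, r))%:E <= (C * 2 `^ b)%:E * ((w r)%:E * (\1_(`[1%R, +oo[%classic : set R) r)%:E))%E.
Proof.
have [r1|r1] := ltP r 1.
  rewrite integral0_eq ?mule_ge0 ?lee_fin// => s _.
  rewrite /Q/=; case: ifPn => // /and4P[s0 sk h _].
  by move: (le_lt_trans h r1); rewrite ltNge rad1// s0.
have r0 := lt_le_trans ltr01 r1.
rewrite indicE mem_set/= ?in_itv/= ?r1// mule1.
pose p : R := k / r `^ b.
have rb0 : 0 < r `^ b by rewrite powR_gt0.
have p0 : 0 < p by rewrite divr_gt0.
have b2 : 1 <= 2 `^ b by rewrite -[leLHS](powRr0 2) ler_powR ?ler1n// ltW.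
apply: (@le_trans _ _ (\int[leb]_(s in `[p, (2 `^ b * p)%R]) (cst ((C * (p^-1 * w r))%:E) s))%E).
  rewrite [leRHS]integral_mkcond; apply: ge0_le_integral => //=.
  - by move=> s _; rewrite lee_fin.
  - apply/measurable_EFinP; apply: (@measurableT_comp _ _ _ _ _ _ Q _ (fun s => (s, r))) => //.
  - by apply/(measurable_restrictT _ _).1 => //; exact: measurable_cst.
  move=> s _; rewrite patchE /Q/=; case: ifPn => [/and4P[s0 sk h1 h2]|_]; last first.
    by case: ifPn => // _; rewrite lee_fin kern0.
  have rs0 : 0 < rad s by apply: lt_le_trans ltr01 (rad1 _); rewrite s0.
  have ps : p <= s.
    rewrite /p ler_pdivrMr// -ler_pdivrMl// mulrC -radE// ge0_ler_powR ?nnegrE ?(ltW b0) ?(ltW rs0) ?(ltW r0)//.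
  have sp : s <= 2 `^ b * p.
    rewrite /p mulrA ler_pdivlMr// mulrC -ler_pdivlMr// -mulrA -radE// -powRM ?(ltW rs0)//.
    by rewrite ge0_ler_powR ?nnegrE ?(ltW b0) ?(ltW r0)// mulr_ge0// ltW.
  rewrite mem_set ?lee_fin/=; last by rewrite in_itv/= ps.
  by rewrite ler_wpM2l// ler_wpM2r// lef_pV2.
rewrite integral_cst//= lebesgue_measure_itv/= lte_fin.
case: ifPn => _; last by rewrite mule0 mule_ge0 ?lee_fin.
rewrite -EFinD -!EFinM lee_fin.
rewrite (_ : C * (p^-1 * w r) * (2 `^ b * p - p) = C * (2 `^ b - 1) * w r); last first.
  by field; rewrite gt_eqF.
by rewrite ler_wpM2r// ler_wpM2l// gerBl.
Qed.

(** In place of the substitution r = rad s, a dyadic average: since L is nondecreasing,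
    L (rad s) is at most a multiple of the integral of w / s over
    [rad s, 2 rad s]. After Tonelli, the s with rad s <= r <= 2 rad s form an
    interval on which 1 / s integrates to O(1), and what remains is the integral of w. *)
Lemma ge0_integral_growth : (\int[leb]_(s in `]0%R, k[) (L ((k / s) `^ b^-1))%:E < +oo)%E.
Proof.
apply: (@le_lt_trans _ _ (\int[leb]_s \int[leb]_r (Q (s, r))%:E)%E).
  rewrite integral_mkcond; apply: ge0_le_integral => //=.
  - by move=> s _; rewrite patchE; case: ifPn => // _; rewrite lee_fin.
  - apply/(measurable_restrictT _ _).1 => //; apply/measurable_EFinP; apply: measurable_funTS.
    exact: (@measurableT_comp _ _ _ _ _ _ L).
  - exact: (@measurable_fun_fubini_tonelli_F _ _ (measurableTypeR R) (measurableTypeR R) R leb (EFin \o Q) (measurableT_comp _ mQ) _).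
  move=> s _; rewrite patchE; case: ifPn => [/set_mem|_]; last by apply: integral_ge0 => r _; rewrite lee_fin.
  by rewrite /= in_itv/=; exact: lower.
rewrite (@fubini_tonelli _ _ (measurableTypeR R) (measurableTypeR R) R leb leb (EFin \o Q)); last 2 first.
- exact/measurable_EFinP.
- by move=> p; rewrite /= lee_fin.
apply: (@le_lt_trans _ _ (\int[leb]_r ((C * 2 `^ b)%:E * ((w r)%:E * (\1_(`[1%R, +oo[%classic : set R) r)%:E)))%E).
  apply: ge0_le_integral => //=.
  - by move=> r _; apply: integral_ge0 => s _; rewrite lee_fin.
  - exact: (@measurable_fun_fubini_tonelli_G _ _ (measurableTypeR R) (measurableTypeR R) R leb (EFin \o Q) (measurableT_comp _ mQ) _).
  - apply/measurable_EFinP; apply: measurable_funM => //; apply: measurable_funM => //.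
rewrite ge0_integralZl//=; last 2 first.
- by apply/measurable_EFinP; apply: measurable_funM => //; exact: measurable_indic.
- by move=> r _; rewrite mule_ge0 ?lee_fin.
apply: lte_mul_pinfty; rewrite ?lee_fin//.
rewrite (_ : (\int[leb]_r _)%E = (\int[leb]_(s in `[1%R, +oo[) (s `^ (- (1 + b)) * L s)%:E)%E)//.
rewrite [RHS]integral_mkcond; apply: eq_integral => r _; rewrite patchE indicE.
by case: ifP; rewrite ?mule1 ?mule0.
Qed.

End growth_integral.

(** * The heat flow of an integrable function *)

Section superposition.
Context {R : realType} {n : nat} d (S : measurableType d).
Context (nu : {sigma_finite_measure set S -> \bar R}).
Local Notation mu := (@lebesgue_rV R n).
Context (tau h : S -> R) (xi : S -> 'rV[R]_n).
Context (mtau : measurable_fun [set: S] tau) (mh : measurable_fun [set: S] h).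
Context (mxi : measurable_fun [set: S] xi).

(** A superposition of heat kernels, with weights h p and centres xi p, evolves by
    lengthening the time of each kernel. Kernels at nonpositive times vanish and
    have to stay zero, whence the case distinction. *)
Lemma conv_superpose (theta : R) (x : 'rV[R]_n) : 0 < theta ->
  (forall z, nu.-integrable [set: S] (EFin \o (fun p => gauss (tau p) (z - xi p) * h p))) ->
  nu.-integrable [set: S]
    (EFin \o (fun p => (if 0 < tau p then gauss (theta + tau p) (x - xi p) else 0) * h p)) ->
  mu.-integrable [set: 'rV[R]_n] (EFin \o (fun z => gauss theta (x - z) *
    \int[nu]_p (gauss (tau p) (z - xi p) * h p))) /\
  gconv (gauss theta) (fun z => \int[nu]_p (gauss (tau p) (z - xi p) * h p)) x =
  \int[nu]_p ((if 0 < tau p then gauss (theta + tau p) (x - xi p) else 0) * h p).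
Proof.
move=> th0 iz ix.
pose Q (q : 'rV[R]_n * S) : R := gauss theta (x - q.1) * (gauss (tau q.2) (q.1 - xi q.2) * h q.2).
have mQ : measurable_fun [set: 'rV[R]_n * S] Q.
  apply: measurable_funM; first by apply: measurable_gauss => //; apply: measurable_rVB; mproj.
  apply: measurable_funM; last by apply: (measurableT_comp mh); mproj.
  apply: measurable_gauss; first by apply: (measurableT_comp mtau); mproj.
  by apply: measurable_rVB; [mproj|apply: (measurableT_comp mxi); mproj].
have CK p (c : R) : 0 <= c -> (\int[mu]_z (gauss theta (x - z) * (gauss (tau p) (z - xi p) * c))%:E =
    ((if 0 < tau p then gauss (theta + tau p) (x - xi p) else 0) * c)%:E)%E.
  move=> c0; case: ifPn => [t0|nt0]; last first.
    rewrite mul0r integral0_eq// => z _.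
    by rewrite [gauss (tau p) _]/gauss (negbTE nt0) mul0r mulr0.
  under eq_integral do rewrite mulrA EFinM.
  rewrite ge0_integralZr//; last 2 first.
  - apply/measurable_EFinP; apply: measurable_funM; first exact: measurable_gaussB.
    by apply: measurable_gauss => //; exact: measurable_rVB.
  - by move=> z _; rewrite lee_fin mulr_ge0 ?gauss_ge0.
  by rewrite gauss_conv// EFinM.
have iQ1 z : nu.-integrable [set: S] (fun p => (Q (z, p))%:E).
  rewrite (_ : (fun _ => _) = (fun p => ((gauss theta (x - z))%:E * (gauss (tau p) (z - xi p) * h p)%:E)%E)).
    by apply: integrableZl => //; exact: iz.
  by apply/funext => p; rewrite -EFinM.
have iz2 p : mu.-integrable [set: 'rV[R]_n] (fun z => (gauss theta (x - z) * gauss (tau p) (z - xi p))%:E).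
  have mg : measurable_fun [set: 'rV[R]_n] (fun z => gauss theta (x - z) * gauss (tau p) (z - xi p)).
    apply: measurable_funM; first exact: measurable_gaussB.
    by apply: measurable_gauss => //; exact: measurable_rVB.
  apply/integrableP; split; first exact/measurable_EFinP.
  have := CK p 1 ler01; rewrite mulr1 => E.
  rewrite (_ : integral _ _ _ = (\int[mu]_z (gauss theta (x - z) * (gauss (tau p) (z - xi p) * 1))%:E)%E).
    by rewrite E ltry.
  by apply: eq_integral => z _; rewrite mulr1/= ger0_norm ?mulr_ge0 ?gauss_ge0.
have iQ2 p : mu.-integrable [set: 'rV[R]_n] (fun z => (Q (z, p))%:E).
  rewrite (_ : (fun _ => _) = (fun z => ((gauss theta (x - z) * gauss (tau p) (z - xi p))%:E * (h p)%:E)%E)).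
    exact: integrableZr.
  by apply/funext => z; rewrite -EFinM /Q/= mulrA.
have iQ : (mu \x nu)%E.-integrable setT (EFin \o Q).
  apply/integrable21ltyP; first exact/measurable_EFinP.
  rewrite (_ : integral _ _ _ = (\int[nu]_p `|((if 0 < tau p then gauss (theta + tau p) (x - xi p) else 0) * h p)%:E|)%E).
    by have /integrableP[] := ix.
  apply: eq_integral => p _; rewrite abse_EFin normrM ger0_norm; last by case: ifP => // _; exact: gauss_ge0.
  rewrite -CK//; apply: eq_integral => z _.
  rewrite /= /Q/= !normrM (ger0_norm (gauss_ge0 theta _)) (ger0_norm (gauss_ge0 (tau p) _)).
  by [].
split.
  have := integrable_Rfubini1 iQ iQ1; apply: eq_integrable => // z _ /=.
  by rewrite /Q/= RintegralZl.
transitivity (\int[mu]_z \int[nu]_p Q (z, p)).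
  by apply: eq_Rintegral => z _; rewrite /Q/= RintegralZl.
rewrite (Rfubini iQ iQ1 iQ2); apply: eq_Rintegral => p _.
have iz2' : mu.-integrable [set: 'rV[R]_n] (EFin \o (fun z => gauss theta (x - z) * gauss (tau p) (z - xi p))) := iz2 p.
transitivity (\int[mu]_z (gauss theta (x - z) * gauss (tau p) (z - xi p) * h p)).
  by apply: eq_Rintegral => z _; rewrite /Q/= mulrA.
rewrite RintegralZr//; congr (_ * _).
have := CK p 1 ler01; rewrite mulr1 => E; rewrite /Rintegral.
rewrite (_ : integral _ _ _ = (\int[mu]_z (gauss theta (x - z) * (gauss (tau p) (z - xi p) * 1))%:E)%E).
  by rewrite E.
by apply: eq_integral => z _; rewrite mulr1.
Qed.

End superposition.

Section heat_of_L1.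
Context {R : realType} {n : nat}.
Local Notation mu := (@lebesgue_rV R n).
Implicit Types (x y z : 'rV[R]_n) (t s : R).

Lemma measurable_heat (h : 'rV[R]_n -> R) d (S : measurableType d) (tau : S -> R) (xi : S -> 'rV[R]_n) :
  measurable_fun [set: 'rV[R]_n] h -> measurable_fun [set: S] tau -> measurable_fun [set: S] xi ->
  measurable_fun [set: S] (fun p => gconv (gauss (tau p)) h (xi p)).
Proof.
move=> mh mtau mxi.
apply: (@measurable_Rintegral_param R _ _ S _ mu (fun q : S * 'rV[R]_n => gauss (tau q.1) (xi q.1 - q.2) * h q.2)).
apply: measurable_funM; last by apply: (measurableT_comp mh); mproj.
apply: measurable_gauss; first by apply: (measurableT_comp mtau); mproj.
by apply: measurable_rVB; [apply: (measurableT_comp mxi)|]; mproj.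
Qed.

Context (phi : 'rV[R]_n -> R) (iphi : mu.-integrable setT (EFin \o phi)).

Lemma measurable_of_integrable : measurable_fun [set: 'rV[R]_n] phi.
Proof. by have /integrableP[/measurable_EFinP] := iphi. Qed.

Lemma heat_L1 t x : mu.-integrable setT (EFin \o (fun y => gauss t (x - y) * phi y)) /\
  `|gconv (gauss t) phi x| <= gconv (gauss t) (fun y => `|phi y|) x.
Proof.
have mphi := measurable_of_integrable.
have iabs : mu.-integrable setT (EFin \o (fun y => `|phi y|)).
  exact: (integrable_norm iphi).
have [t0|t0] := ltP 0 t; last first.
  have E (g : 'rV[R]_n -> R) : (fun y => gauss t (x - y) * g y) = fun=> 0.
    by apply/funext => y; rewrite gauss_le0// mul0r.
  rewrite /gconv !E; split; first exact: integrable0.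
  by rewrite /Rintegral integral0 normr0.
have i1 : mu.-integrable setT (EFin \o (fun y => gauss t (x - y) * `|phi y|)).
  have ic : mu.-integrable setT (EFin \o (fun y => peak t ^+ n * `|phi y|)).
    exact: integrable_scale.
  apply: (@Rintegral_bound R _ _ mu _ _ setT measurableT _ ic _).1 => [|y _].
    by apply: measurable_funM; [exact: measurable_gaussB|exact: measurableT_comp].
  by rewrite normrM normr_id (ger0_norm (gauss_ge0 _ _)) ler_wpM2r// gauss_le.
apply: (@Rintegral_bound R _ _ mu _ _ setT measurableT _ i1 _) => [|y _].
  by apply: measurable_funM; [exact: measurable_gaussB|].
by rewrite normrM (ger0_norm (gauss_ge0 _ _)).
Qed.

Lemma heat_L1_le t x : 0 < t ->
  gconv (gauss t) (fun y => `|phi y|) x <= peak t ^+ n * \int[mu]_y `|phi y|.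
Proof.
move=> t0.
have iabs : mu.-integrable setT (EFin \o (fun y => `|phi y|)).
  exact: (integrable_norm iphi).
rewrite -RintegralZl//; apply: le_Rintegral => //.
- have ic : mu.-integrable setT (EFin \o (fun y => gauss t (x - y) * phi y)) := (heat_L1 t x).1.
  have := integrable_norm ic; apply: eq_integrable => // y _ /=.
  by rewrite normrM (ger0_norm (gauss_ge0 _ _)).
- exact: integrable_scale.
- by move=> y _; rewrite ler_wpM2r// gauss_le.
Qed.

Lemma heat_ge0 t x : 0 <= gconv (gauss t) (fun y => `|phi y|) x.
Proof. exact: le_trans (normr_ge0 _) (heat_L1 t x).2. Qed.

Lemma heat_semigroup s t x : 0 < s -> 0 < t ->
  mu.-integrable setT (EFin \o (fun z => gauss s (x - z) * gconv (gauss t) phi z)) /\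
  gconv (gauss s) (gconv (gauss t) phi) x = gconv (gauss (s + t)) phi x.
Proof.
move=> s0 t0.
have := @conv_superpose R n _ _ mu (fun=> t) phi id (measurable_cst _) measurable_of_integrable (@measurable_id _ _ _) s x s0 (fun z => (heat_L1 t z).1).
by rewrite t0; apply; exact: (heat_L1 (s + t) x).1.
Qed.

End heat_of_L1.

(** * The fixed point *)

Section product_sigma_finite.
Context {R : realType} d1 d2 (T1 : measurableType d1) (T2 : measurableType d2).
Context (m1 : {sigma_finite_measure set T1 -> \bar R}) (m2 : {sigma_finite_measure set T2 -> \bar R}).

(** A copy of the product measure on which sigma-finiteness can be declared. *)
Definition prod_sf : set (T1 * T2) -> \bar R := (m1 \x m2)%E.

HB.instance Definition _ := Measure.copy prod_sf (m1 \x m2)%E.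

Let sigma_finite_prod : sigma_finite setT prod_sf.
Proof.
have /sigma_finiteP[F [TF ndF Foo]] := sigma_finiteT m1.
have /sigma_finiteP[G [TG ndG Goo]] := sigma_finiteT m2.
exists (fun k => F k `*` G k).
  apply/esym; rewrite -subTset => -[x y] _.
  have [i _ Fi] : (\bigcup_i F i) x by rewrite -TF.
  have [j _ Gj] : (\bigcup_i G i) y by rewrite -TG.
  exists (maxn i j) => //; split.
  - by move: Fi; apply/subsetPset/ndF/leq_maxl.
  - by move: Gj; apply/subsetPset/ndG/leq_maxr.
move=> k; have [mF Fk] := Foo k; have [mG Gk] := Goo k; split; first exact: measurableX.
by rewrite /prod_sf product_measure1E// lte_mul_pinfty// ge0_fin_numE.
Qed.

HB.instance Definition _ := Measure_isSigmaFinite.Build _ _ _ prod_sf sigma_finite_prod.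

End product_sigma_finite.

Lemma Rintegral_prod {R : realType} d1 d2 (T1 : measurableType d1) (T2 : measurableType d2)
    (m1 : {sigma_finite_measure set T1 -> \bar R}) (m2 : {sigma_finite_measure set T2 -> \bar R})
    (Q : T1 * T2 -> R) : (m1 \x m2)%E.-integrable setT (EFin \o Q) ->
  (forall a, m2.-integrable setT (fun b => (Q (a, b))%:E)) ->
  \int[(m1 \x m2)%E]_p Q p = \int[m1]_a \int[m2]_b Q (a, b).
Proof.
move=> iQ i1; rewrite /Rintegral; congr fine.
rewrite -(integral12_prod_meas1 iQ); apply: eq_integral => a _.
by rewrite fineK//; exact: (integrable_fin_num measurableT (i1 a)).
Qed.

Section fixed_point.
Context {R : realType} {n : nat}.
Local Notation mu := (@lebesgue_rV R n).
Local Notation leb := (@lebesgue_measure R).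
Local Notation st := (leb \x mu)%E.
Local Notation ST := (measurableTypeR R * 'rV[R]_n)%type.
Implicit Types (x y z : 'rV[R]_n) (t s : R).
Context (phi : 'rV[R]_n -> R) (iphi : mu.-integrable setT (EFin \o phi)).
Context (f : R -> R) (f_lip : locally_lipschitz f) (f_mono : {homo f : x y / x <= y})
  (f0 : f 0 = 0).
Context (T : R) (a : R -> R) (a_ge0 : forall s, 0 <= a s) (ma : measurable_fun [set: R] a).
Context (a_int : (\int[leb]_(s in `]0%R, T[) (a s)%:E <= (2^-1)%:E)%E).
Local Notation V := (fun s y => gconv (gauss s) (fun z => `|phi z|) y).
Context (hfa : forall s y (r : R), 0 < s < T -> `|r| <= 2 * V s y -> `|f r| <= a s * (2 * V s y)).

Definition majorant s y : R := if 0 < s < T then 2 * V s y else 0.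

Definition duhamel_op (U : R -> 'rV[R]_n -> R) t x : R :=
  if 0 < t < T then
    gconv (gauss t) phi x + \int[st]_p (gauss (t - p.1) (x - p.2) * f (U p.1 p.2))
  else 0.

Let V0 s y : 0 <= V s y. Proof. exact: heat_ge0. Qed.

Let iabs : mu.-integrable setT (EFin \o (fun y => `|phi y|)).
Proof. exact: (integrable_norm iphi). Qed.

Let mabs : measurable_fun [set: 'rV[R]_n] (fun y => `|phi y|).
Proof. exact: (measurable_of_integrable iabs). Qed.

Let m1 : measurable_fun [set: ST] (fun p : ST => p.1). Proof. exact: measurable_fst. Qed.
Let m2 : measurable_fun [set: ST] (fun p : ST => p.2). Proof. exact: measurable_snd. Qed.

Lemma majorant_ge0 s y : 0 <= majorant s y.
Proof. by rewrite /majorant; case: ifP => // _; rewrite mulr_ge0 ?V0. Qed.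

Lemma measurable_majorant : measurable_fun [set: ST] (fun p : ST => majorant p.1 p.2).
Proof.
apply: measurable_fun_ifT => //.
  by apply: measurable_and; exact: measurable_fun_ltr.
by apply: measurable_funM => //; exact: measurable_heat.
Qed.

Definition dominator t x (p : ST) : R := gauss (t - p.1) (x - p.2) * (a p.1 * majorant p.1 p.2).

Lemma dominator_ge0 t x p : 0 <= dominator t x p.
Proof. by rewrite mulr_ge0 ?gauss_ge0// mulr_ge0 ?majorant_ge0. Qed.

Lemma measurable_gauss_diff t x : measurable_fun [set: ST] (fun p : ST => gauss (t - p.1) (x - p.2)).
Proof. by apply: measurable_gauss; [exact: measurable_funB|exact: measurable_rVB]. Qed.

Lemma measurable_dominator t x : measurable_fun [set: ST] (dominator t x).
Proof.
apply: measurable_funM; first exact: measurable_gauss_diff.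
by apply: measurable_funM; [exact: measurableT_comp|exact: measurable_majorant].
Qed.

(** The semigroup law: spreading V s for the time t - s gives V t. *)
Lemma dominator_slice t x s :
  mu.-integrable setT (EFin \o (fun y => dominator t x (s, y))) /\
  \int[mu]_y dominator t x (s, y) = if (0 < s < T) && (s < t) then 2 * a s * V t x else 0.
Proof.
have [h|h] := boolP ((0 < s < T) && (s < t)); last first.
  rewrite (_ : (fun y => _) = fun=> 0); last first.
    apply/funext => y; rewrite /dominator /majorant/=; move: h.
    case: ifP => //= [_|_ _]; last by rewrite !mulr0.
    by rewrite -leNgt => ts; rewrite gauss_le0 ?subr_le0// mul0r.
  by split; [exact: integrable0|rewrite /Rintegral integral0].
move/andP : h => [sT st]; have /andP[s0 _] := sT.
have ts0 : 0 < t - s by rewrite subr_gt0.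
have [i E] := heat_semigroup iabs x ts0 s0.
rewrite subrK in E.
have D y : dominator t x (s, y) = 2 * a s * (gauss (t - s) (x - y) * V s y).
  by rewrite /dominator /majorant/= sT; ring.
split.
  rewrite (_ : (fun y => _) = (fun y => 2 * a s * (gauss (t - s) (x - y) * V s y))); last exact/funext.
  exact: integrable_scale.
under eq_Rintegral do rewrite D.
by rewrite RintegralZl//; congr (_ * _).
Qed.

Lemma dominator_integral t x :
  (\int[st]_p (dominator t x p)%:E <= (2 * V t x)%:E * \int[leb]_(s in `]0%R, t[) (a s)%:E)%E.
Proof.
rewrite (@fubini_tonelli1 _ _ (measurableTypeR R) 'rV[R]_n R leb mu (EFin \o dominator t x)); last 2 first.
- by apply/measurable_EFinP; exact: measurable_dominator.
- by move=> p; rewrite lee_fin dominator_ge0.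
apply: (@le_trans _ _ (\int[leb]_(s in `]0%R, t[) ((2 * V t x)%:E * (a s)%:E))%E).
  rewrite [leRHS]integral_mkcond; apply: ge0_le_integral => //=.
  - by move=> s _; apply: integral_ge0 => y _; rewrite lee_fin dominator_ge0.
  - apply: (@measurable_fun_fubini_tonelli_F _ _ (measurableTypeR R) 'rV[R]_n R mu (EFin \o dominator t x)).
      by apply/measurable_EFinP; exact: measurable_dominator.
    by move=> p; rewrite lee_fin dominator_ge0.
  - apply/(measurable_restrictT _ _).1 => //; apply: measurable_funTS.
    by apply/measurable_EFinP; apply: measurable_funM.
  move=> s _; have [i E] := dominator_slice t x s.
  rewrite /fubini_F/= -(fineK (integrable_fin_num measurableT i)).
  rewrite [fine _]E patchE; case: ifPn => [/andP[/andP[s0 _] st]|_].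
    by rewrite mem_set/= ?in_itv/= ?s0// -EFinM lee_fin mulrAC.
  by case: ifP => // _; rewrite -EFinM lee_fin mulr_ge0// mulr_ge0.
rewrite ge0_integralZl//=.
- by apply: measurable_funTS; apply/measurable_EFinP.
- by move=> s _; rewrite lee_fin.
- by rewrite lee_fin mulr_ge0.
Qed.

Lemma dominator_integral_le t x : 0 < t < T ->
  (\int[st]_p (dominator t x p)%:E <= (V t x)%:E)%E.
Proof.
move=> /andP[t0 tT]; apply: (le_trans (dominator_integral t x)).
apply: (@le_trans _ _ ((2 * V t x)%:E * (2^-1)%:E)%E).
  apply: lee_wpmul2l; first by rewrite lee_fin mulr_ge0.
  apply: le_trans a_int; apply: ge0_subset_integral => //.
  - by apply: measurable_funTS; apply/measurable_EFinP.
  - by move=> s _; rewrite lee_fin.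
  - by move=> s; rewrite /= !in_itv/= => /andP[-> st]; exact: lt_trans tT.
by rewrite -EFinM lee_fin mulrAC divff// mul1r.
Qed.

Lemma dominator_integrable t x : 0 < t < T ->
  st.-integrable setT (EFin \o dominator t x) /\ \int[st]_p dominator t x p <= V t x.
Proof.
move=> tT; have h := dominator_integral_le x tT.
have i : st.-integrable setT (EFin \o dominator t x).
  apply/integrableP; split; first by apply/measurable_EFinP; exact: measurable_dominator.
  apply: (@le_lt_trans _ _ (V t x)%:E); last by rewrite ltry.
  apply: le_trans h; rewrite le_eqVlt; apply/orP; left; apply/eqP; apply: eq_integral => p _.
  by rewrite /= ger0_norm// dominator_ge0.
by split=> //; rewrite -lee_fin fineK//; exact: (integrable_fin_num measurableT i).
Qed.

Section bounded_by_majorant.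
Context (U : R -> 'rV[R]_n -> R) (mU : measurable_fun [set: ST] (fun p : ST => U p.1 p.2)).
Context (UM : forall s y, `|U s y| <= majorant s y).

Lemma source_le s y : `|f (U s y)| <= a s * majorant s y.
Proof.
have := UM s y; rewrite /majorant; case: ifPn => [sT|_].
  by move=> h; exact: hfa.
by rewrite normr_le0 => /eqP ->; rewrite f0 normr0 mulr0.
Qed.

Lemma measurable_fU : measurable_fun [set: ST] (fun p : ST => f (U p.1 p.2)).
Proof. by apply: (@measurableT_comp _ _ _ _ _ _ f) => //; exact: lipschitz_measurable. Qed.

Lemma integrand_bound t x p : `|gauss (t - p.1) (x - p.2) * f (U p.1 p.2)| <= dominator t x p.
Proof. by rewrite normrM (ger0_norm (gauss_ge0 _ _)) ler_wpM2l ?gauss_ge0// source_le. Qed.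

Lemma measurable_integrand t x : measurable_fun [set: ST] (fun p : ST => gauss (t - p.1) (x - p.2) * f (U p.1 p.2)).
Proof. by apply: measurable_funM; [exact: measurable_gauss_diff|exact: measurable_fU]. Qed.

Lemma integrand_integrable t x : 0 < t < T ->
  st.-integrable setT (EFin \o (fun p => gauss (t - p.1) (x - p.2) * f (U p.1 p.2))) /\
  `|\int[st]_p (gauss (t - p.1) (x - p.2) * f (U p.1 p.2))| <= V t x.
Proof.
move=> tT; have [iD leD] := dominator_integrable x tT.
have [i h] := @Rintegral_bound R _ _ st _ _ setT measurableT (measurable_integrand t x) iD (fun p _ => integrand_bound t x p).
by split=> //; exact: le_trans leD.
Qed.

(** The free term and the Duhamel term are both at most V t, so that the order
    interval between minus and plus the majorant is stable. *)
Lemma duhamel_op_bound t x : `|duhamel_op U t x| <= majorant t x.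
Proof.
rewrite /duhamel_op /majorant; case: ifPn => [tT|_]; last by rewrite normr0.
rewrite (le_trans (ler_normD _ _))// (_ : 2 * V t x = V t x + V t x); last by ring.
rewrite lerD//.
  exact: (heat_L1 iphi t x).2.
exact: (integrand_integrable x tT).2.
Qed.

Lemma measurable_duhamel_op : measurable_fun [set: ST] (fun p : ST => duhamel_op U p.1 p.2).
Proof.
apply: measurable_fun_ifT => //.
  by apply: measurable_and; exact: measurable_fun_ltr.
apply: measurable_funD; first by apply: measurable_heat => //; exact: measurable_of_integrable.
have h := @measurable_Rintegral_param R _ _ ST ST
  [the {sigma_finite_measure set ST -> \bar R} of prod_sf leb mu]
  (fun q : ST * ST => gauss (q.1.1 - q.2.1) (q.1.2 - q.2.2) * f (U q.2.1 q.2.2)).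
apply: h.
apply: measurable_funM; last by apply: (measurableT_comp measurable_fU); mproj.
by apply: measurable_gauss; [apply: measurable_funB|apply: measurable_rVB]; mproj.
Qed.

End bounded_by_majorant.

Lemma duhamel_op_le (U U' : R -> 'rV[R]_n -> R) :
  measurable_fun [set: ST] (fun p : ST => U p.1 p.2) ->
  measurable_fun [set: ST] (fun p : ST => U' p.1 p.2) ->
  (forall s y, `|U s y| <= majorant s y) -> (forall s y, `|U' s y| <= majorant s y) ->
  (forall s y, U s y <= U' s y) -> forall s y, duhamel_op U s y <= duhamel_op U' s y.
Proof.
move=> mU mU' UM U'M UU' t x; rewrite /duhamel_op; case: ifPn => // tT.
rewrite lerD2l; apply: le_Rintegral => //.
- exact: (integrand_integrable mU UM x tT).1.
- exact: (integrand_integrable mU' U'M x tT).1.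
- by move=> p _; rewrite ler_wpM2l ?gauss_ge0// f_mono.
Qed.

(** The first iterate is the majorant, an upper solution: the iterates decrease. *)
Fixpoint picard k : R -> 'rV[R]_n -> R :=
  if k is k'.+1 then duhamel_op (picard k') else majorant.

Lemma picard_bound k : measurable_fun [set: ST] (fun p : ST => picard k p.1 p.2) /\
  forall s y, `|picard k s y| <= majorant s y.
Proof.
elim: k => [|k [mU UM]] /=.
  by split; [exact: measurable_majorant|move=> s y; rewrite ger0_norm ?majorant_ge0].
by split; [exact: measurable_duhamel_op|exact: duhamel_op_bound].
Qed.

Lemma picard_decr k s y : picard k.+1 s y <= picard k s y.
Proof.
elim: k s y => [|k IH] s y.
  by have [_ /(_ s y)] := picard_bound 1; exact: le_trans (ler_norm _).
have [h1 h2] := picard_bound k; have [h3 h4] := picard_bound k.+1.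
exact: duhamel_op_le.
Qed.

Definition mild t x : R := limn (fun k => picard k t x).

Lemma picard_cvg t x : picard k t x @[k --> \oo] --> mild t x.
Proof.
apply: nonincreasing_is_cvgn.
  by apply/nonincreasing_seqP => k; exact: picard_decr.
exists (- majorant t x) => _ [k _ <-].
by have [_ /(_ t x)] := picard_bound k; rewrite ler_norml => /andP[].
Qed.

Lemma mild_bound t x : `|mild t x| <= majorant t x.
Proof.
have h : `|picard k t x| @[k --> \oo] --> `|mild t x| by apply: cvg_norm; exact: picard_cvg.
rewrite -(cvg_lim _ h)//; apply: limr_le; first by apply/cvg_ex; exists `|mild t x|.
by apply: nearW => k; have [_] := picard_bound k; exact.
Qed.

Lemma measurable_mild : measurable_fun [set: ST] (fun p : ST => mild p.1 p.2).
Proof.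
apply: (@measurable_fun_cvg _ _ _ _ (fun k p => picard k p.1 p.2)).
  by move=> k; exact: (picard_bound k).1.
by move=> p _; exact: picard_cvg.
Qed.

Lemma mild_fixed t x : 0 < t < T ->
  mild t x = gconv (gauss t) phi x +
    \int[st]_p (gauss (t - p.1) (x - p.2) * f (mild p.1 p.2)).
Proof.
move=> tT; apply: (@cvg_unique _ _ (picard k.+1 t x @[k --> \oo])) => //.
  by have := @picard_cvg t x; rewrite -(cvg_shiftS (fun k => picard k t x)).
rewrite /= /duhamel_op tT; apply: cvgD; first exact: cvg_cst.
apply: (@Rdominated_cvg _ _ _ st _ _ (dominator t x) setT measurableT).
- by move=> k; have [h _] := picard_bound k; exact: measurable_integrand.
- exact: (dominator_integrable x tT).1.
- by apply: nearW => k p _; have [_ h] := picard_bound k; exact: integrand_bound.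
- move=> p _; apply: cvgM; first exact: cvg_cst.
  by apply: continuous_cvg; [exact: lipschitz_continuous|exact: picard_cvg].
Qed.

End fixed_point.

(** * Restarting a mild solution *)

Section mild_restart.
Context {R : realType} {n : nat}.
Local Notation mu := (@lebesgue_rV R n).
Local Notation leb := (@lebesgue_measure R).
Local Notation st := (leb \x mu)%E.
Local Notation ST := (measurableTypeR R * 'rV[R]_n)%type.
Implicit Types (x y z : 'rV[R]_n) (t s : R).
Context (phi : 'rV[R]_n -> R) (iphi : mu.-integrable setT (EFin \o phi)).
Context (h : R -> 'rV[R]_n -> R) (mh : measurable_fun [set: ST] (fun p : ST => h p.1 p.2)).
Context (T : R) (D : R -> 'rV[R]_n -> ST -> R).
Context (iD : forall t x, 0 < t < T -> st.-integrable setT (EFin \o D t x)).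
Context (iDs : forall t x s, mu.-integrable setT (EFin \o (fun y => D t x (s, y)))).
Context (hD : forall t x p, `|gauss (t - p.1) (x - p.2) * h p.1 p.2| <= D t x p).
Context (u : R -> 'rV[R]_n -> R).
Context (uE : forall t x, 0 < t < T -> u t x = gconv (gauss t) phi x +
  \int[st]_p (gauss (t - p.1) (x - p.2) * h p.1 p.2)).

Let m1 : measurable_fun [set: ST] (fun p : ST => p.1). Proof. exact: measurable_fst. Qed.
Let m2 : measurable_fun [set: ST] (fun p : ST => p.2). Proof. exact: measurable_snd. Qed.

Let mI t x : measurable_fun [set: ST] (fun p : ST => gauss (t - p.1) (x - p.2) * h p.1 p.2).
Proof.
by apply: measurable_funM => //; apply: measurable_gauss; [exact: measurable_funB|exact: measurable_rVB].
Qed.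

Let iI t x : 0 < t < T ->
  st.-integrable setT (EFin \o (fun p => gauss (t - p.1) (x - p.2) * h p.1 p.2)).
Proof.
move=> tT; exact: (@Rintegral_bound R _ _ st _ _ setT measurableT (mI t x) (iD x tT) (fun p _ => hD t x p)).1.
Qed.

Let mIs t x s : measurable_fun [set: 'rV[R]_n] (fun y => gauss (t - s) (x - y) * h s y).
Proof.
apply: (@measurableT_comp _ _ _ _ _ _ (fun p : ST => gauss (t - p.1) (x - p.2) * h p.1 p.2) _ (fun y => (s, y))) => //.
exact: measurable_pair1.
Qed.

Let iIs t x s : mu.-integrable setT (EFin \o (fun y => gauss (t - s) (x - y) * h s y)).
Proof.
exact: (@Rintegral_bound R _ _ mu _ _ setT measurableT (mIs t x s) (iDs t x s) (fun y _ => hD t x (s, y))).1.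
Qed.

(** The Duhamel integral is split at time t1. Its part before t1 is the heat flow,
    for the time t - t1, of the Duhamel integral at t1, by [conv_superpose]. *)
Lemma mild_duhamel t1 t x : 0 < t1 -> t1 < t < T ->
  u t x = gconv (gauss (t - t1)) (u t1) x + volterra h t1 gauss t x.
Proof.
move=> t10 /andP[t1t tT].
have tT' : 0 < t < T by rewrite tT (lt_trans t10).
have t1T : 0 < t1 < T by rewrite t10 (lt_trans t1t).
have tt1 : 0 < t - t1 by rewrite subr_gt0.
pose I0 (p : ST) : R := gauss (t - p.1) (x - p.2) * h p.1 p.2.
pose I1 (p : ST) : R := (if 0 < t1 - p.1 then gauss (t - t1 + (t1 - p.1)) (x - p.2) else 0) * h p.1 p.2.
have I1E p : I1 p = if p.1 < t1 then I0 p else 0.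
  by rewrite /I1 subr_gt0; case: ifP => _; rewrite ?mul0r// addrA subrK.
have mI1 : measurable_fun [set: ST] I1.
  rewrite (_ : I1 = fun p => if p.1 < t1 then I0 p else 0); last by apply/funext.
  apply: measurable_fun_ifT => //; first exact: measurable_fun_ltr.
  exact: mI.
have iI1 : st.-integrable setT (EFin \o I1).
  apply: (@Rintegral_bound R _ _ st _ _ setT measurableT mI1 (iD x tT') _).1 => p _.
  rewrite I1E; case: ifP => _; first exact: hD.
  by rewrite normr0 (le_trans _ (hD t x p)).
have mtau : measurable_fun [set: ST] (fun p : ST => t1 - p.1) by exact: measurable_funB.
have [J1 J2] := @conv_superpose R n _ ST [the {sigma_finite_measure set ST -> \bar R} of prod_sf leb mu]
  (fun p : ST => t1 - p.1) (fun p : ST => h p.1 p.2) (fun p : ST => p.2) mtau mh m2 (t - t1) x tt1 (fun z => iI z t1T) iI1.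
pose J z : R := \int[st]_p (gauss (t1 - p.1) (z - p.2) * h p.1 p.2).
have J1' : mu.-integrable setT (EFin \o (fun z => gauss (t - t1) (x - z) * J z)) := J1.
have J2' : gconv (gauss (t - t1)) J x = \int[st]_p I1 p := J2.
have [K1 K2] := heat_semigroup iphi x tt1 t10.
rewrite subrK in K2.
have -> : gconv (gauss (t - t1)) (u t1) x = gconv (gauss t) phi x + \int[st]_p I1 p.
  rewrite -K2 -J2' [in RHS]/gconv -RintegralD// [LHS]/gconv.
  by apply: eq_Rintegral => z _; rewrite (uE z t1T) mulrDr.
rewrite (uE x tT') -addrA; congr (_ + _).
pose I2 (p : ST) : R := if p.1 < t1 then 0 else I0 p.
have mI2 : measurable_fun [set: ST] I2.
  by apply: measurable_fun_ifT => //; [exact: measurable_fun_ltr|exact: mI].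
have iI2 : st.-integrable setT (EFin \o I2).
  apply: (@Rintegral_bound R _ _ st _ _ setT measurableT mI2 (iD x tT') _).1 => p _.
  rewrite /I2; case: ifP => _; last exact: hD.
  by rewrite normr0 (le_trans _ (hD t x p)).
transitivity (\int[st]_p (I1 p + I2 p)).
  by apply: eq_Rintegral => p _; rewrite I1E /I2; case: ifP => _; rewrite ?addr0 ?add0r.
rewrite RintegralD//; congr (_ + _).
have iI2s s : mu.-integrable setT (fun y => (I2 (s, y))%:E).
  have [st1|st1] := boolP (s < t1).
    rewrite (_ : (fun y => _) = cst 0%E); first exact: integrable0.
    by apply/funext => y; rewrite /I2/= st1.
  rewrite (_ : (fun y => _) = (EFin \o (fun y => gauss (t - s) (x - y) * h s y))); first exact: iIs.
  by apply/funext => y; rewrite /I2/= (negbTE st1).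
transitivity (\int[leb]_s \int[mu]_y I2 (s, y)); first exact: (Rintegral_prod iI2 iI2s).
have E s : \int[mu]_y I2 (s, y) = if s < t1 then 0 else gconv (gauss (t - s)) (h s) x.
  case: ifPn => st1.
    rewrite (_ : (fun y => _) = cst 0); first by rewrite /Rintegral integral0.
    by apply/funext => y; rewrite /I2/= st1.
  by rewrite /gconv; apply: eq_Rintegral => y _; rewrite /I2/= (negbTE st1).
rewrite /volterra.
transitivity (\int[leb]_(s in `[t1, t[) gconv (gauss (t - s)) (h s) x).
  rewrite [RHS]Rintegral_mkcond; apply: eq_Rintegral => s _; rewrite E patchE mem_setE in_itv/=.
  case: ltP => //= t1s; case: ltP => //= ts.
  by rewrite gconv_gauss_le0 ?subr_le0.
apply/esym; apply: Rintegral_itv_obnd_cbnd.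
have iF : leb.-integrable [set: measurableTypeR R] (EFin \o (fun s : R => \int[mu]_y I2 (s, y))) :=
  integrable_Rfubini1 iI2 iI2s.
have := integrable_itvS `]t1, t[ iF; apply: eq_integrable => //.
by move=> s; rewrite inE/= in_itv/= => /andP[t1s _]; rewrite E ltNge (ltW t1s).
Qed.

End mild_restart.

(** * Oscillation of a function against a symmetric kernel *)

Section oscillation.
Context {R : realType} d (X : measurableType d) (m : {sigma_finite_measure set X -> \bar R}).
Implicit Types (psi g : X -> R) (k : X * X -> R).
Local Open Scope ereal_scope.

Definition mkernel k := [/\ measurable_fun [set: X * X] k, (forall p, 0 <= k p)%R,
  forall x y, k (x, y) = k (y, x) & forall x, \int[m]_y (k (x, y))%:E = 1].

(** It bounds the L1 distance from psi to its average against k, and being a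
    double integral of a nonnegative function it passes to products by Tonelli. *)
Definition osc k psi : \bar R := \int[m]_x \int[m]_y (k (x, y) * `|psi y - psi x|)%:E.

Context (k : X * X -> R) (kk : mkernel k).

Let mk : measurable_fun [set: X * X] k. Proof. by case: kk. Qed.
Let k0 p : (0 <= k p)%R. Proof. by case: kk. Qed.
Let kC x y : k (x, y) = k (y, x). Proof. by case: kk. Qed.
Let k1 x : \int[m]_y (k (x, y))%:E = 1. Proof. by case: kk. Qed.
Let k1' y : \int[m]_x (k (x, y))%:E = 1.
Proof. by rewrite -(k1 y); apply: eq_integral => x _; rewrite kC. Qed.

Let p1 : measurable_fun [set: X * X] (fun p : X * X => p.1). Proof. exact: measurable_fst. Qed.
Let p2 : measurable_fun [set: X * X] (fun p : X * X => p.2). Proof. exact: measurable_snd. Qed.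

Let mkE : measurable_fun [set: X * X] (EFin \o k). Proof. exact/measurable_EFinP. Qed.

Lemma measurable_osc_integrand psi : measurable_fun setT psi ->
  measurable_fun [set: X * X] (fun p : X * X => k p * `|psi p.2 - psi p.1|)%R.
Proof.
move=> mpsi; apply: measurable_funM => //; apply: measurableT_comp => //.
by apply: measurable_funB; exact: measurableT_comp.
Qed.

Lemma osc_integrand_ge0 psi p : (0 <= k p * `|psi p.2 - psi p.1|)%R.
Proof. by rewrite mulr_ge0. Qed.

Lemma osc_ge0 psi : 0 <= osc k psi.
Proof. by do 2 (apply: integral_ge0 => ? _); rewrite lee_fin osc_integrand_ge0. Qed.

Lemma kernel_snd g : measurable_fun setT g -> (forall x, 0 <= g x)%R ->
  \int[m]_x \int[m]_y (k (x, y) * g y)%:E = \int[m]_y (g y)%:E.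
Proof.
move=> mg g0.
rewrite (@fubini_tonelli _ _ X X R m m (fun p => (k p * g p.2)%:E)); last 2 first.
- by apply/measurable_EFinP; apply: measurable_funM => //; exact: measurableT_comp.
- by move=> p; rewrite lee_fin mulr_ge0.
apply: eq_integral => y _ /=.
under eq_integral do rewrite mulrC EFinM.
rewrite ge0_integralZl_EFin//; first by rewrite k1' mule1.
- by move=> x _; rewrite lee_fin.
- by apply/measurable_EFinP; apply: (measurableT_comp mk); exact: measurable_pair2.
Qed.

Lemma kernel_fst g : measurable_fun setT g -> (forall x, 0 <= g x)%R ->
  \int[m]_x \int[m]_y (k (x, y) * g x)%:E = \int[m]_x (g x)%:E.
Proof.
move=> mg g0; apply: eq_integral => x _ /=.
under eq_integral do rewrite mulrC EFinM.
rewrite ge0_integralZl_EFin//; first by rewrite k1 mule1.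
- by move=> y _; rewrite lee_fin.
- by apply/measurable_EFinP; apply: (measurableT_comp mk); exact: measurable_pair1.
Qed.

Let mslice (F : X * X -> R) x : measurable_fun setT F -> measurable_fun setT (fun y => (F (x, y))%:E).
Proof. by move=> mF; apply/measurable_EFinP; apply: (measurableT_comp mF); exact: measurable_pair1. Qed.

Let minner (F : X * X -> R) : measurable_fun setT F -> (forall p, 0 <= F p)%R ->
  measurable_fun setT (fun x => \int[m]_y (F (x, y))%:E).
Proof.
move=> mF F0; apply: (@measurable_fun_fubini_tonelli_F _ _ X X R m (EFin \o F)).
  exact/measurable_EFinP.
by move=> p; rewrite lee_fin.
Qed.

Lemma double_le (F G : X * X -> R) : measurable_fun setT F -> measurable_fun setT G ->
  (forall p, 0 <= F p)%R -> (forall p, F p <= G p)%R ->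
  \int[m]_x \int[m]_y (F (x, y))%:E <= \int[m]_x \int[m]_y (G (x, y))%:E.
Proof.
move=> mF mG F0 FG; have G0 p : (0 <= G p)%R := le_trans (F0 p) (FG p).
apply: ge0_le_integral => //.
- by move=> x _; apply: integral_ge0 => y _; rewrite lee_fin.
- exact: minner.
- exact: minner.
move=> x _; apply: ge0_le_integral => //.
- by move=> y _; rewrite lee_fin.
- exact: mslice.
- exact: mslice.
- by move=> y _; rewrite lee_fin.
Qed.

Lemma double_add (F G : X * X -> R) : measurable_fun setT F -> measurable_fun setT G ->
  (forall p, 0 <= F p)%R -> (forall p, 0 <= G p)%R ->
  \int[m]_x \int[m]_y (F (x, y) + G (x, y))%:E =
  \int[m]_x \int[m]_y (F (x, y))%:E + \int[m]_x \int[m]_y (G (x, y))%:E.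
Proof.
move=> mF mG F0 G0; rewrite -ge0_integralD//; last 4 first.
- by move=> x _; apply: integral_ge0 => y _; rewrite lee_fin.
- exact: minner.
- by move=> x _; apply: integral_ge0 => y _; rewrite lee_fin.
- exact: minner.
apply: eq_integral => x _; under eq_integral do rewrite EFinD.
rewrite ge0_integralD//; [by move=> y _; rewrite lee_fin|exact: mslice|by move=> y _; rewrite lee_fin|exact: mslice].
Qed.

Let mabs psi : measurable_fun setT psi -> measurable_fun setT (fun x => `|psi x|)%R.
Proof. by move=> mpsi; exact: measurableT_comp. Qed.

Let mk2 g : measurable_fun setT g -> measurable_fun [set: X * X] (fun p => k p * g p.2)%R.
Proof. by move=> mg; apply: measurable_funM => //; exact: measurableT_comp. Qed.

Let mk1 g : measurable_fun setT g -> measurable_fun [set: X * X] (fun p => k p * g p.1)%R.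
Proof. by move=> mg; apply: measurable_funM => //; exact: measurableT_comp. Qed.

Lemma osc_le psi : measurable_fun setT psi -> osc k psi <= 2%:E * \int[m]_x (`|psi x|)%:E.
Proof.
move=> mpsi.
apply: (@le_trans _ _ (\int[m]_x \int[m]_y (k (x, y) * `|psi y| + k (x, y) * `|psi x|)%:E)).
  apply: (@double_le (fun p => k p * `|psi p.2 - psi p.1|)%R (fun p => k p * `|psi p.2| + k p * `|psi p.1|)%R).
  - exact: measurable_osc_integrand.
  - by apply: measurable_funD; [exact: (mk2 (mabs mpsi))|exact: (mk1 (mabs mpsi))].
  - exact: osc_integrand_ge0.
  - by move=> p; rewrite -mulrDr ler_wpM2l// ler_normB.
rewrite (@double_add (fun p => k p * `|psi p.2|)%R (fun p => k p * `|psi p.1|)%R); last 4 first.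
- exact: (mk2 (mabs mpsi)).
- exact: (mk1 (mabs mpsi)).
- by move=> p; rewrite mulr_ge0.
- by move=> p; rewrite mulr_ge0.
by rewrite /= (kernel_snd (mabs mpsi))// (kernel_fst (mabs mpsi))// mule_natl mule2n.
Qed.

Lemma osc_sub psi g : measurable_fun setT psi -> measurable_fun setT g ->
  osc k psi <= osc k g + 2%:E * \int[m]_x (`|psi x - g x|)%:E.
Proof.
move=> mpsi mg.
have md : measurable_fun setT (psi \- g)%R by exact: measurable_funB.
apply: (@le_trans _ _ (osc k g + osc k (psi \- g)%R)); last by rewrite leeD2l// osc_le.
rewrite /osc -(@double_add (fun p => k p * `|g p.2 - g p.1|)%R
  (fun p => k p * `|(psi \- g)%R p.2 - (psi \- g)%R p.1|)%R); last 4 first.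
- exact: measurable_osc_integrand.
- exact: measurable_osc_integrand.
- exact: osc_integrand_ge0.
- exact: osc_integrand_ge0.
apply: (@double_le (fun p => k p * `|psi p.2 - psi p.1|)%R (fun p => k p * `|g p.2 - g p.1| +
  k p * `|(psi \- g)%R p.2 - (psi \- g)%R p.1|)%R).
- exact: measurable_osc_integrand.
- by apply: measurable_funD; exact: measurable_osc_integrand.
- exact: osc_integrand_ge0.
- move=> p; rewrite -mulrDr ler_wpM2l//.
  rewrite (_ : psi p.2 - psi p.1 = (g p.2 - g p.1) + ((psi \- g)%R p.2 - (psi \- g)%R p.1))%R ?ler_normD//=.
  by ring.
Qed.

(** Pairs of points outside E contribute nothing; the pairs with first point in E
    and those with second point in E contribute equally, by symmetry of k. *)
Lemma osc_supp psi (E : set X) : measurable E -> measurable_fun setT psi ->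
  (forall x, ~ E x -> psi x = 0%R) ->
  osc k psi <= 2%:E * \int[m]_(x in E) \int[m]_y (k (x, y) * `|psi y - psi x|)%:E.
Proof.
move=> mE mpsi psi0; pose e x : R := \1_E x.
have me : measurable_fun setT e by exact: measurable_indic.
have e0 x : (0 <= e x)%R by rewrite /e indicE ler0n.
pose F (p : X * X) : R := (e p.1 * (k p * `|psi p.2 - psi p.1|))%R.
pose G (p : X * X) : R := (e p.2 * (k p * `|psi p.2 - psi p.1|))%R.
have mF : measurable_fun setT F.
  by apply: measurable_funM; [exact: measurableT_comp|exact: measurable_osc_integrand].
have mG : measurable_fun setT G.
  by apply: measurable_funM; [exact: measurableT_comp|exact: measurable_osc_integrand].
have F0 p : (0 <= F p)%R by rewrite mulr_ge0// osc_integrand_ge0.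
have G0 p : (0 <= G p)%R by rewrite mulr_ge0// osc_integrand_ge0.
have FG p : (k p * `|psi p.2 - psi p.1| <= F p + G p)%R.
  rewrite /F /G -mulrDl /e !indicE.
  have [p1E|p1E] := boolP (p.1 \in E).
    by rewrite ler_peMl ?osc_integrand_ge0// lerDl ler0n.
  have [p2E|] := boolP (p.2 \in E).
    by rewrite add0r mul1r.
  move: p1E; rewrite !notin_setE => n1 n2.
  by rewrite (psi0 _ n1) (psi0 _ n2) subrr normr0 !mulr0.
apply: (@le_trans _ _ (\int[m]_x \int[m]_y (F (x, y) + G (x, y))%:E)).
  apply: (@double_le (fun p => k p * `|psi p.2 - psi p.1|)%R (fun p => F p + G p)%R) => //.
  - exact: measurable_osc_integrand.
  - exact: measurable_funD.
  - exact: osc_integrand_ge0.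
rewrite double_add//.
have EF : \int[m]_x \int[m]_y (F (x, y))%:E =
    \int[m]_(x in E) \int[m]_y (k (x, y) * `|psi y - psi x|)%:E.
  rewrite [RHS]integral_mkcond; apply: eq_integral => x _; rewrite patchE.
  case: ifPn => xE; first by apply: eq_integral => y _; rewrite /F /e/= indicE xE mul1r.
  by rewrite integral0_eq// => y _; rewrite /F /e/= indicE (negbTE xE) mul0r.
have EG : \int[m]_x \int[m]_y (G (x, y))%:E = \int[m]_x \int[m]_y (F (x, y))%:E.
  rewrite (@fubini_tonelli _ _ X X R m m (EFin \o G)); last 2 first.
  - exact/measurable_EFinP.
  - by move=> p; rewrite lee_fin.
  apply: eq_integral => y _; apply: eq_integral => x _ /=.
  by rewrite /F /G/= kC distrC.
by rewrite EG EF mule_natl mule2n.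
Qed.

End oscillation.

Section product_oscillation.
Context {R : realType} d1 d2 (X : measurableType d1) (Y : measurableType d2).
Context (m1 : {sigma_finite_measure set X -> \bar R}) (m2 : {sigma_finite_measure set Y -> \bar R}).
Context (k1 : X * X -> R) (kk1 : mkernel m1 k1) (k2 : Y * Y -> R) (kk2 : mkernel m2 k2).
Local Open Scope ereal_scope.
Context (psi : X * Y -> R) (mpsi : measurable_fun setT psi).

Let F (q : X * (X * Y)) : R := (k1 (q.1, q.2.1) * `|psi q.2 - psi (q.1, q.2.2)|)%R.
Let G (q : (X * Y) * Y) : R := (k2 (q.1.2, q.2) * `|psi (q.1.1, q.2) - psi q.1|)%R.

Let k10 p : (0 <= k1 p)%R. Proof. by case: kk1. Qed.
Let k20 p : (0 <= k2 p)%R. Proof. by case: kk2. Qed.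
Let mk1 : measurable_fun setT k1. Proof. by case: kk1. Qed.
Let mk2 : measurable_fun setT k2. Proof. by case: kk2. Qed.

Let F0 q : (0 <= F q)%R. Proof. by rewrite mulr_ge0. Qed.
Let G0 q : (0 <= G q)%R. Proof. by rewrite mulr_ge0. Qed.

Let mF : measurable_fun setT F.
Proof.
apply: measurable_funM; first by apply: (measurableT_comp mk1); mproj.
by apply: measurableT_comp => //; apply: measurable_funB; apply: (measurableT_comp mpsi); mproj.
Qed.

Let mG : measurable_fun setT G.
Proof.
apply: measurable_funM; first by apply: (measurableT_comp mk2); mproj.
by apply: measurableT_comp => //; apply: measurable_funB; apply: (measurableT_comp mpsi); mproj.
Qed.

Let m := [the {sigma_finite_measure set (X * Y)%type -> \bar R} of prod_sf m1 m2].

Let k2sum y : \int[m2]_x (k2 (x, y))%:E = 1.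
Proof. by case: kk2 => _ _ kC k2i; rewrite -(k2i y); apply: eq_integral => x _; rewrite kC. Qed.

Let k1sum a : \int[m1]_b (k1 (a, b))%:E = 1. Proof. by case: kk1 => _ _ _ ->. Qed.

Let mA : measurable_fun setT (fun r : (X * Y) * (X * Y) => k2 (r.1.2, r.2.2) * F (r.1.1, r.2))%R.
Proof. by apply: measurable_funM; [apply: (measurableT_comp mk2)|apply: (measurableT_comp mF)]; mproj. Qed.

Let mB : measurable_fun setT (fun r : (X * Y) * (X * Y) => k1 (r.1.1, r.2.1) * G (r.1, r.2.2))%R.
Proof. by apply: measurable_funM; [apply: (measurableT_comp mk1)|apply: (measurableT_comp mG)]; mproj. Qed.

Let mF1 a : measurable_fun setT (fun q : X * Y => F (a, q)).
Proof. by apply: (measurableT_comp mF); exact: measurable_pair1. Qed.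

Let mF2 : measurable_fun setT (fun r : (X * Y) * X => F (r.1.1, (r.2, r.1.2))).
Proof. by apply: (measurableT_comp mF); mproj. Qed.

Let intA : \int[m]_p \int[m]_q (k2 (p.2, q.2) * F (p.1, q))%:E =
  \int[m2]_y osc m1 k1 (fun a => psi (a, y)).
Proof.
rewrite (@fubini_tonelli1 _ _ X Y R m1 m2 (fun p => \int[m]_q (k2 (p.2, q.2) * F (p.1, q))%:E)); last 2 first.
- apply: (@measurable_fun_fubini_tonelli_F _ _ (X * Y)%type (X * Y)%type R m (fun r => (k2 (r.1.2, r.2.2) * F (r.1.1, r.2))%:E)).
    exact/measurable_EFinP.
  by move=> r; rewrite lee_fin mulr_ge0.
- by move=> p; apply: integral_ge0 => q _; rewrite lee_fin mulr_ge0.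
transitivity (\int[m1]_a \int[m2]_y \int[m1]_b (F (a, (b, y)))%:E).
  apply: eq_integral => a _; rewrite /fubini_F/=.
  rewrite (@fubini_tonelli _ _ Y (X * Y)%type R m2 m (fun r => (k2 (r.1, r.2.2) * F (a, r.2))%:E)); last 2 first.
  - apply/measurable_EFinP; apply: measurable_funM.
      by apply: (measurableT_comp mk2); mproj.
    by apply: (measurableT_comp (mF1 a)); mproj.
  - by move=> r; rewrite lee_fin mulr_ge0.
  transitivity (\int[m]_q (F (a, q))%:E).
    apply: eq_integral => q _ /=; under eq_integral do rewrite mulrC EFinM.
    rewrite ge0_integralZl_EFin//; first by rewrite k2sum mule1.
    - by move=> x _; rewrite lee_fin.
    - by apply/measurable_EFinP; apply: (measurableT_comp mk2); exact: measurable_pair2.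
  apply: (@fubini_tonelli2 _ _ X Y R m1 m2 (fun q => (F (a, q))%:E)).
    by apply/measurable_EFinP; exact: mF1.
  by move=> q; rewrite lee_fin.
apply: (@fubini_tonelli _ _ X Y R m1 m2 (fun p => \int[m1]_b (F (p.1, (b, p.2)))%:E)).
  apply: (@measurable_fun_fubini_tonelli_F _ _ (X * Y)%type X R m1 (fun r => (F (r.1.1, (r.2, r.1.2)))%:E)).
    exact/measurable_EFinP.
  by move=> r; rewrite lee_fin.
by move=> p; apply: integral_ge0 => b _; rewrite lee_fin.
Qed.

Let intB : \int[m]_p \int[m]_q (k1 (p.1, q.1) * G (p, q.2))%:E =
  \int[m1]_a osc m2 k2 (fun y => psi (a, y)).
Proof.
have mG1 p : measurable_fun setT (fun y => (G (p, y))%:E).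
  by apply/measurable_EFinP; apply: (measurableT_comp mG); exact: measurable_pair1.
transitivity (\int[m]_p \int[m2]_y (G (p, y))%:E).
  apply: eq_integral => p _.
  rewrite [LHS](@fubini_tonelli1 _ _ X Y R m1 m2 (fun q => (k1 (p.1, q.1) * G (p, q.2))%:E)); last 2 first.
  - apply/measurable_EFinP; apply: measurable_funM.
      apply: (measurableT_comp mk1); apply: measurable_fun_pair => //.
    apply: (measurableT_comp mG); apply: measurable_fun_pair => //.
  - by move=> q; rewrite lee_fin mulr_ge0.
  have I0 : 0 <= \int[m2]_y (G (p, y))%:E by apply: integral_ge0 => y _; rewrite lee_fin.
  transitivity (\int[m1]_b ((k1 (p.1, b))%:E * \int[m2]_y (G (p, y))%:E)).
    apply: eq_integral => b _; rewrite /fubini_F/=; under eq_integral do rewrite EFinM.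
    by rewrite ge0_integralZl_EFin// => y _; rewrite lee_fin.
  rewrite ge0_integralZr//; first by rewrite k1sum mul1e.
  - by apply/measurable_EFinP; apply: (measurableT_comp mk1); exact: measurable_pair1.
  - by move=> b _; rewrite lee_fin.
apply: (@fubini_tonelli1 _ _ X Y R m1 m2 (fun p => \int[m2]_y (G (p, y))%:E)).
  apply: (@measurable_fun_fubini_tonelli_F _ _ (X * Y)%type Y R m2 (EFin \o G)).
    exact/measurable_EFinP.
  by move=> r; rewrite lee_fin.
by move=> p; apply: integral_ge0 => b _; rewrite lee_fin.
Qed.

(** Triangle inequality through (p.1, q.2), which changes one coordinate at a time;
    the kernel in the other coordinate integrates to one. *)
Lemma osc_prod_le :
  \int[m]_p \int[m]_q (k1 (p.1, q.1) * k2 (p.2, q.2) * `|psi q - psi p|)%:E <=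
  \int[m2]_y osc m1 k1 (fun a => psi (a, y)) + \int[m1]_a osc m2 k2 (fun y => psi (a, y)).
Proof.
rewrite -intA -intB.
rewrite -(@double_add R _ (X * Y)%type m (fun r => k2 (r.1.2, r.2.2) * F (r.1.1, r.2))%R
  (fun r => k1 (r.1.1, r.2.1) * G (r.1, r.2.2))%R mA mB); last 2 first.
- by move=> r; rewrite mulr_ge0.
- by move=> r; rewrite mulr_ge0.
apply: (@double_le R _ (X * Y)%type m
  (fun r => k1 (r.1.1, r.2.1) * k2 (r.1.2, r.2.2) * `|psi r.2 - psi r.1|)%R
  (fun r => k2 (r.1.2, r.2.2) * F (r.1.1, r.2) + k1 (r.1.1, r.2.1) * G (r.1, r.2.2))%R).
- apply: measurable_funM; last first.
    by apply: measurableT_comp => //; apply: measurable_funB; apply: (measurableT_comp mpsi); mproj.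
  by apply: measurable_funM; [apply: (measurableT_comp mk1)|apply: (measurableT_comp mk2)]; mproj.
- exact: measurable_funD.
- by move=> r; rewrite mulr_ge0// mulr_ge0.
move=> [p q]; rewrite /F /G/= mulrCA !mulrA -mulrDr ler_wpM2l ?mulr_ge0//.
rewrite (_ : psi q - psi p = (psi q - psi (p.1, q.2)) + (psi (p.1, q.2) - psi p))%R; last by ring.
exact: ler_normD.
Qed.

End product_oscillation.

(** * Oscillation against the one-dimensional Gaussian *)

Lemma dominated_cvg0 {R : realType} d (X : measurableType d) (m : {measure set X -> \bar R})
    (E : set X) (h_ : nat -> X -> \bar R) (g : X -> \bar R) : measurable E ->
  (forall k, measurable_fun E (h_ k)) -> m.-integrable E g ->
  (forall k x, E x -> 0 <= h_ k x <= g x)%E ->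
  {ae m, forall x, E x -> h_ k x @[k --> \oo] --> 0%E} ->
  (\int[m]_(x in E) h_ k x)%E @[k --> \oo] --> 0%E.
Proof.
move=> mE mh ig hg h0.
have dom : {ae m, forall x k, E x -> (`|h_ k x| <= g x)%E}.
  by apply: aeW => x k Ex; have /andP[h1 h2] := hg k x Ex; rewrite gee0_abs.
have [_ _] := @dominated_convergence _ _ _ m E mE h_ (cst 0%E) g mh (measurable_cst _) h0 ig dom.
by rewrite integral0.
Qed.

Section heat_kernel_1d.
Context {R : realType}.
Local Notation leb := (@lebesgue_measure R).
Implicit Types (t a b : R).

Definition kernel1 t (p : measurableTypeR R * measurableTypeR R) : R := gauss1 t (p.1 - p.2).

Lemma mkernel1 t : 0 < t -> mkernel leb (kernel1 t).
Proof.
move=> t0; split.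
- apply: measurable_funM => //; apply: measurableT_comp => //; apply: measurableT_comp => //.
  apply: measurable_funM => //; apply: measurable_funX.
  by apply: measurable_funB; [exact: measurable_fst|exact: measurable_snd].
- by move=> p; exact: gauss1_ge0.
- by move=> x y; rewrite /kernel1/= /gauss1 -sqrrN opprB.
- by move=> x; exact: integral_gauss1.
Qed.

(** This is u exp (- u) <= 1 for u = 3 a^2 / (16 t), the difference of the two
    exponents. *)
Lemma gauss1_moment t a : 0 < t -> gauss1 t a * a ^+ 2 <= 16 * t * gauss1 (4 * t) a.
Proof.
move=> t0; have p0 := peak_gt0 t0.
have -> : gauss1 (4 * t) a = peak t / 2 * expR (- (a ^+ 2 / (16 * t))).
  rewrite /gauss1 (_ : 4 * t = 2 ^+ 2 * t) ?peakM//; last by ring.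
  by congr (_ * expR (- (_ / _))); ring.
pose u : R := 3 * a ^+ 2 / (16 * t).
have u0 : 0 <= u by apply: divr_ge0; apply: mulr_ge0; rewrite ?sqr_ge0// ltW.
have -> : gauss1 t a = peak t * (expR (- u) * expR (- (a ^+ 2 / (16 * t)))).
  rewrite /gauss1 -expRD; congr (_ * expR _); rewrite /u; field.
  by rewrite gt_eqF.
have -> : a ^+ 2 = 16 / 3 * t * u by rewrite /u; field; rewrite gt_eqF.
have ue : u * expR (- u) <= 1.
  by rewrite expRN ler_pdivrMr ?expR_gt0// mul1r (le_trans _ (expR_ge1Dx u))// lerDr.
pose e' : R := expR (- (16 / 3 * t * u / (16 * t))).
have e0 : 0 <= e' by exact: expR_ge0.
rewrite -/e'.
have c0 : 0 <= peak t * e' * t := mulr_ge0 (mulr_ge0 (ltW p0) e0) (ltW t0).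
have := ler_wpM2l c0 ue.
rewrite mulr1 => h.
rewrite (_ : peak t * (expR (- u) * e') * (16 / 3 * t * u) = 16 / 3 * (peak t * e' * t * (u * expR (- u)))); last by ring.
rewrite (_ : 16 * t * (peak t / 2 * e') = 8 * (peak t * e' * t)); last by field.
apply: (@le_trans _ _ (16 / 3 * (peak t * e' * t))); first by rewrite ler_wpM2l.
rewrite ler_wpM2r//; lra.
Qed.

(** At distance at least d from a, the difference is at most 2 M (a - b)^2 / d^2,
    whose average is O(t) by [gauss1_moment]. *)
Lemma kernel1_pointwise (psi : R -> R) (M a : R) (t_ : nat -> R) :
  measurable_fun [set: measurableTypeR R] psi -> (forall b, `|psi b| <= M) ->
  {for a, continuous psi} -> (forall k, 0 < t_ k) -> t_ k @[k --> \oo] --> 0 ->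
  (\int[leb]_b (kernel1 (t_ k) (a, b) * `|psi b - psi a|)%:E)%E @[k --> \oo] --> 0%E.
Proof.
move=> mpsi psiM cpsi t0 tc.
have M0 : 0 <= M := le_trans (normr_ge0 _) (psiM 0).
have key e : 0 < e -> exists2 C : R, 0 <= C & forall k,
   (\int[leb]_b (kernel1 (t_ k) (a, b) * `|psi b - psi a|)%:E <= (e + C * t_ k)%:E)%E.
  move=> e0.
  have /cvgrPdist_le /(_ e e0) /nbhs_ballP[d d0 dH] := cpsi.
  pose c := 2 * M / d ^+ 2.
  have c0 : 0 <= c by apply: divr_ge0; [exact: mulr_ge0|exact: sqr_ge0].
  have bd b : `|psi b - psi a| <= e + c * (a - b) ^+ 2.
    have [ab|ab] := ltP `|a - b| d.
      by rewrite distrC (le_trans (dH b ab))// lerDl mulr_ge0 ?sqr_ge0.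
    apply: (@le_trans _ _ (2 * M)).
      by rewrite (le_trans (ler_normB _ _))// mulr2n mulrDl mul1r lerD.
    rewrite -[leLHS]add0r lerD ?(ltW e0)// /c mulrAC ler_pdivlMr ?exprn_gt0//.
    rewrite ler_wpM2l ?mulr_ge0// -[leRHS]real_normK ?num_real// ler_sqr ?nnegrE//.
    exact: ltW.
  exists (c * 16); first by rewrite mulr_ge0.
  move=> k; have tk := t0 k.
  have t4 : 0 < 4 * t_ k by rewrite mulr_gt0.
  have mg (s : R) : measurable_fun [set: measurableTypeR R] (fun b : R => gauss1 s (a - b)).
    exact: measurable_gauss1.
  apply: (@le_trans _ _ (\int[leb]_b (e%:E * (gauss1 (t_ k) (a - b))%:E +
      (c * 16 * t_ k)%:E * (gauss1 (4 * t_ k) (a - b))%:E))%E).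
    apply: ge0_le_integral => //.
    - by move=> b _; rewrite lee_fin mulr_ge0 ?gauss1_ge0.
    - apply/measurable_EFinP; apply: measurable_funM; first exact: mg.
      by apply: measurableT_comp => //; exact: measurable_funB.
    - by apply/measurable_EFinP; apply: measurable_funD; apply: measurable_funM => //; exact: mg.
    move=> b _; rewrite -!EFinM -EFinD lee_fin /kernel1/=.
    apply: (le_trans (ler_wpM2l (gauss1_ge0 _ _) (bd b))).
    rewrite mulrDr [_ * e]mulrC lerD2l mulrCA.
    rewrite (_ : c * 16 * t_ k * _ = c * (16 * t_ k * gauss1 (4 * t_ k) (a - b))); last by ring.
    by rewrite ler_wpM2l//; exact: gauss1_moment.
  have ct0 : 0 <= c * 16 * t_ k by exact: (mulr_ge0 (mulr_ge0 c0 (ler0n _ 16)) (ltW tk)).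
  rewrite ge0_integralD//; last 4 first.
  - by move=> b _; rewrite mule_ge0 ?lee_fin ?gauss1_ge0 ?(ltW e0).
  - by apply/measurable_EFinP; apply: measurable_funM => //; exact: mg.
  - by move=> b _; rewrite mule_ge0 ?lee_fin ?gauss1_ge0 ?ct0.
  - by apply/measurable_EFinP; apply: measurable_funM => //; exact: mg.
  have I (c' s : R) : 0 <= c' -> 0 < s -> (\int[leb]_b (c'%:E * (gauss1 s (a - b))%:E) = c'%:E)%E.
    move=> c'0 s0; rewrite ge0_integralZl_EFin//; first by rewrite integral_gauss1// mule1.
    - by move=> b _; rewrite lee_fin gauss1_ge0.
    - by apply/measurable_EFinP; exact: mg.
  by rewrite (I _ _ (ltW e0) tk) (I _ _ ct0 t4).
apply/ge0_cvge0P => [k|e e0].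
  by apply: integral_ge0 => b _; rewrite lee_fin mulr_ge0 ?gauss1_ge0.
have e20 : 0 < e / 2 by rewrite divr_gt0.
have [C C0 HC] := key (e / 2) e20; near=> k.
have Ct : C * t_ k <= e / 2.
  have tk : t_ k <= e / 2 / (C + 1).
    apply: ltW; near: k; apply: (cvgr_lt 0) => //.
    by rewrite divr_gt0// ltr_wpDl.
  apply: (@le_trans _ _ (C * (e / 2 / (C + 1)))); first by rewrite ler_wpM2l.
  rewrite mulrCA ler_piMr ?(ltW e20)// ler_pdivrMr ?mul1r ?lerDl//.
  by rewrite ltr_wpDl.
by rewrite (le_trans (HC k))// lee_fin [leRHS]splitr lerD2l.
Unshelve. all: by end_near. Qed.

Lemma continuous_bounded_itv (g : R -> R) (N : R) : continuous g ->
  exists M : R, forall b, `|b| <= N -> `|g b| <= M.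
Proof.
move=> cg; have [N0|N0] := ltP N 0.
  by exists 0 => b bN; move: (le_lt_trans (le_trans (normr_ge0 _) bN) N0); rewrite ltxx.
have NN : - N <= N by rewrite (le_trans _ N0)// oppr_le0.
have c1 : {within `[- N, N], continuous (fun x => `|g x|)}.
  by apply: continuous_subspaceT => x; apply: cvg_norm; exact: cg.
have [c _ Hc] := EVT_max NN c1.
by exists `|g c| => b bN; apply: Hc; rewrite in_itv/= -ler_norml.
Qed.

Lemma approx_continuous (psi : R -> R) (e : R) : 0 < e ->
  leb.-integrable [set: measurableTypeR R] (EFin \o psi) ->
  exists N : R, exists2 g : R -> R, continuous g &
    (\int[leb]_x (`|psi x - g x * \1_(`[(- N), N]%classic : set R) x|)%:E <= e%:E)%E.
Proof.
move=> e0 ipsi.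
have mpsi : measurable_fun [set: measurableTypeR R] psi by have /integrableP[/measurable_EFinP] := ipsi.
have e20 : 0 < e / 2 by rewrite divr_gt0.
pose E (k : nat) : set R := `[(- k%:R), k%:R]%classic.
have mE k : measurable (E k : set (measurableTypeR R)) by exact: measurable_itv.
have mi (A : set (measurableTypeR R)) : measurable A -> measurable_fun [set: measurableTypeR R] (\1_A : _ -> R).
  by move=> mA; exact: measurable_indic.
have tail : (\int[leb]_x (`|psi x| * \1_(~` E k) x)%:E)%E @[k --> \oo] --> 0%E.
  apply: (@dominated_cvg0 _ _ _ leb setT _ (fun x => (`|psi x|)%:E)) => //.
  - move=> k; apply/measurable_EFinP; apply: measurable_funM; first exact: measurableT_comp.
    by apply: mi; exact: measurableC.
  - exact: (integrable_norm ipsi).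
  - move=> k x _; rewrite !lee_fin mulr_ge0 ?indicE ?ler0n//= ler_piMr// lern1.
    exact: leq_b1.
  apply: aeW => x _; apply: cvg_near_cst; near=> k.
  have xE : E k x by rewrite /E/= in_itv/= -ler_norml; near: k; exact: nbhs_infty_ger.
  by rewrite indicE in_setC mem_set//= mulr0.
have [k Hk] : exists k, (\int[leb]_x (`|psi x| * \1_(~` E k) x)%:E <= (e / 2)%:E)%E.
  have : \forall k \near \oo, (\int[leb]_x (`|psi x| * \1_(~` E k) x)%:E <= (e / 2)%:E)%E.
    by apply: (ge0_cvge0P _).1 e20 => // k; apply: integral_ge0 => x _; rewrite lee_fin mulr_ge0// indicE.
  by case=> N _ /(_ N (leqnn N)); exists N.
have Efin : (leb (E k) < +oo)%E.
  by rewrite /E lebesgue_measure_itv/=; case: ifP => _; rewrite ?ltry// -EFinD ltry.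
have iE : leb.-integrable (E k) (EFin \o psi) by exact: (integrableS measurableT (mE k) _ ipsi).
have [g_ [cg ig cg0]] := approximation_continuous_integrable (mE k) Efin iE.
near \oo => j.
exists k%:R, (g_ j); first exact: cg.
have Hj : (\int[leb]_(z in E k) `|(psi z - g_ j z)%:E| <= (e / 2)%:E)%E.
  near: j; apply: (ge0_cvge0P _).1 e20 => // j; exact: integral_ge0.
have mgj : measurable_fun [set: measurableTypeR R] (g_ j) by exact: continuous_measurable_fun.
rewrite (_ : (\int[leb]_x _)%E = (\int[leb]_x ((`|psi x| * \1_(~` E k) x)%:E + (`|psi x - g_ j x| * \1_(E k) x)%:E))%E).
  have hA x : (0 <= (`|psi x| * \1_(~` E k) x)%:E)%E by rewrite lee_fin mulr_ge0// indicE ler0n.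
  have hB x : (0 <= (`|psi x - g_ j x| * \1_(E k) x)%:E)%E by rewrite lee_fin mulr_ge0// indicE ler0n.
  have mA : measurable_fun [set: measurableTypeR R] (fun x => (`|psi x| * \1_(~` E k) x)%:E).
    apply/measurable_EFinP; apply: measurable_funM; first exact: measurableT_comp.
    by apply: mi; exact: measurableC.
  have mB : measurable_fun [set: measurableTypeR R] (fun x => (`|psi x - g_ j x| * \1_(E k) x)%:E).
    apply/measurable_EFinP; apply: measurable_funM; last exact: mi.
    by apply: measurableT_comp => //; exact: measurable_funB.
  have E1 : (\int[leb]_x ((`|psi x| * \1_(~` E k) x)%:E + (`|psi x - g_ j x| * \1_(E k) x)%:E) =
    \int[leb]_x (`|psi x| * \1_(~` E k) x)%:E + \int[leb]_x (`|psi x - g_ j x| * \1_(E k) x)%:E)%E.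
    exact: (ge0_integralD leb measurableT (fun x _ => hA x) mA (fun x _ => hB x) mB).
  rewrite E1.
  rewrite [e]splitr EFinD leeD//.
  rewrite (_ : (\int[leb]_x _)%E = (\int[leb]_(z in E k) `|(psi z - g_ j z)%:E|)%E)//.
  rewrite [RHS]integral_mkcond; apply: eq_integral => x _; rewrite patchE indicE.
  by case: ifP => _; rewrite ?mulr1// mulr0.
apply: eq_integral => x _; rewrite -EFinD; congr EFin.
rewrite !indicE in_setC -/(E k); case: (x \in E k) => /=.
  by rewrite mulr1 mulr0 add0r mulr1.
by rewrite !mulr0 subr0 mulr1 addr0.
Unshelve. all: by end_near. Qed.

(** Density: psi is replaced by a continuous function cut off outside an interval,
    for which [kernel1_pointwise] applies off the endpoints. *)
Lemma osc1_cvg (psi : R -> R) (t_ : nat -> R) :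
  leb.-integrable [set: measurableTypeR R] (EFin \o psi) ->
  (forall k, 0 < t_ k) -> t_ k @[k --> \oo] --> 0 ->
  osc leb (kernel1 (t_ k)) psi @[k --> \oo] --> 0%E.
Proof.
move=> ipsi t0 tc.
have mpsi : measurable_fun [set: measurableTypeR R] psi by have /integrableP[/measurable_EFinP] := ipsi.
apply/ge0_cvge0P => [k|e e0]; first exact: (osc_ge0 (mkernel1 (t0 k))).
have e40 : 0 < e / 4 by rewrite divr_gt0.
have [N [g cg Hg]] := approx_continuous e40 ipsi.
pose E : set R := `[(- N), N]%classic.
pose g' (x : R) : R := g x * \1_E x.
have mE : measurable (E : set (measurableTypeR R)) by exact: measurable_itv.
have mg' : measurable_fun [set: measurableTypeR R] g'.
  apply: measurable_funM; first exact: continuous_measurable_fun.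
  exact: measurable_indic.
have [M HM] := continuous_bounded_itv N cg.
have g'M b : `|g' b| <= `|M|.
  rewrite /g' indicE; case: (boolP (b \in E)) => [/set_mem|_]; last by rewrite mulr0 normr0.
  by rewrite /E/= in_itv/= -ler_norml mulr1 => /HM h; exact: le_trans (ler_norm M).
have Efin : (leb E < +oo)%E.
  by rewrite /E lebesgue_measure_itv/=; case: ifP => _; rewrite ?ltry// -EFinD ltry.
have conv : (\int[leb]_(x in E) \int[leb]_y (kernel1 (t_ k) (x, y) * `|g' y - g' x|)%:E)%E @[k --> \oo] --> 0%E.
  apply: (@dominated_cvg0 _ _ _ leb E _ (cst (2 * `|M|)%:E)) => //.
  - move=> k; apply: measurable_funTS.
    apply: (@measurable_fun_fubini_tonelli_F _ _ (measurableTypeR R) (measurableTypeR R) R leb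
      (fun p => (kernel1 (t_ k) p * `|g' p.2 - g' p.1|)%:E)).
      by apply/measurable_EFinP; exact: (measurable_osc_integrand (mkernel1 (t0 k))).
    by move=> p; rewrite lee_fin (osc_integrand_ge0 (mkernel1 (t0 k))).
  - have := @integrable_cst_itv R `[(- N), N] (2 * `|M|) Efin; exact: eq_integrable.
  - move=> k x _; apply/andP; split.
      by apply: integral_ge0 => y _; rewrite lee_fin mulr_ge0 ?gauss1_ge0.
    apply: (@le_trans _ _ (\int[leb]_y ((2 * `|M|)%:E * (gauss1 (t_ k) (x - y))%:E))%E).
      apply: ge0_le_integral => //.
      + by move=> y _; rewrite lee_fin mulr_ge0 ?gauss1_ge0.
      + apply/measurable_EFinP; apply: measurable_funM; first exact: measurable_gauss1.
        by apply: measurableT_comp => //; exact: measurable_funB.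
      + by apply/measurable_EFinP; apply: measurable_funM => //; exact: measurable_gauss1.
      move=> y _; rewrite -EFinM lee_fin mulrC ler_wpM2r ?gauss1_ge0//.
      by rewrite (le_trans (ler_normB _ _))// mulr2n mulrDl mul1r lerD.
    rewrite ge0_integralZl_EFin//.
    + by rewrite integral_gauss1// mule1.
    + by move=> y _; rewrite lee_fin gauss1_ge0.
    + by apply/measurable_EFinP; exact: measurable_gauss1.
  (* The cut-off function may be discontinuous at the two endpoints. *)
  have neg : leb.-negligible ([set (- N)] `|` [set N]).
    by apply: negligibleU; apply/negligibleP => //; exact: lebesgue_measure_set1.
  apply: negligibleS neg => x /= /not_implyP[Ex nc].
  apply: contrapT => /not_orP[xN1 xN2]; apply: nc.
  apply: (kernel1_pointwise mg' g'M _ t0 tc).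
  have xI : x \in (`](- N), N[%classic : set R).
    move: Ex; rewrite /E/= in_itv/= => /andP[a b]; apply/mem_set; rewrite /= in_itv/=.
    by rewrite !lt_neqAle a b !andbT eq_sym; apply/andP; split; apply/eqP.
  have : {in (`](- N), N[%classic : set R), continuous g'}.
    rewrite -continuous_open_subspace; last exact: interval_open.
    apply: (@subspace_eq_continuous _ _ _ g); last exact: continuous_subspaceT.
    move=> z /set_mem; rewrite /= in_itv/= => /andP[a b].
    change (g z = g z * \1_E z).
    by rewrite indicE mem_set ?mulr1//= /E/= in_itv/= !ltW.
  by apply.
near=> k.
have kk := mkernel1 (t0 k).
apply: (le_trans (osc_sub kk mpsi mg')).
have H1 : (\int[leb]_(x in E) \int[leb]_y (kernel1 (t_ k) (x, y) * `|g' y - g' x|)%:E <= (e / 4)%:E)%E.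
  near: k; apply: (ge0_cvge0P _).1 e40 => // k; apply: integral_ge0 => x _.
  by apply: integral_ge0 => y _; rewrite lee_fin mulr_ge0 ?gauss1_ge0.
have H2 : (osc leb (kernel1 (t_ k)) g' <= 2%:E * (e / 4)%:E)%E.
  apply: (le_trans (osc_supp kk mE mg' _)).
    by move=> x nEx; rewrite /g' indicE memNset// mulr0.
  by apply: lee_wpmul2l.
apply: (@le_trans _ _ (2%:E * (e / 4)%:E + 2%:E * (e / 4)%:E)%E).
  by apply: leeD => //; apply: lee_wpmul2l.
by rewrite -EFinM -EFinD lee_fin; lra.
Unshelve. all: by end_near. Qed.

End heat_kernel_1d.

(** * Strong continuity of the heat flow in L1 *)

Lemma squeeze0 {R : realType} (u v : nat -> \bar R) : (forall k, 0 <= u k <= v k)%E ->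
  v k @[k --> \oo] --> 0%E -> u k @[k --> \oo] --> 0%E.
Proof. by move=> uv v0; apply: (squeeze_cvge _ (cvg_cst 0%E) v0); exact: nearW. Qed.

(** Almost every slice is integrable, and its oscillation is at most twice its L1
    norm, which is integrable over the slices. *)
Lemma osc_slices {R : realType} d1 d2 (X : measurableType d1) (Y : measurableType d2)
    (m1 : {sigma_finite_measure set X -> \bar R}) (m2 : {sigma_finite_measure set Y -> \bar R})
    (k_ : nat -> X * X -> R) (psi : X * Y -> R) : (forall j, mkernel m1 (k_ j)) ->
  (m1 \x m2)%E.-integrable setT (EFin \o psi) ->
  (forall g : X -> R, m1.-integrable setT (EFin \o g) -> osc m1 (k_ j) g @[j --> \oo] --> 0%E) ->
  (\int[m2]_y osc m1 (k_ j) (fun a => psi (a, y)))%E @[j --> \oo] --> 0%E.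
Proof.
move=> kk ipsi H.
have mpsi : measurable_fun setT psi by have /integrableP[/measurable_EFinP] := ipsi.
have inorm := integrable_norm ipsi.
apply: (@dominated_cvg0 _ _ _ m2 setT _ (fun y => 2%:E * \int[m1]_a (`|psi (a, y)|)%:E)%E) => //.
- move=> j; have [mk k0 _ _] := kk j.
  apply: (@measurable_fun_fubini_tonelli_F _ _ Y X R m1 (fun r => \int[m1]_b (k_ j (r.2, b) * `|psi (b, r.1) - psi (r.2, r.1)|)%:E)%E); last first.
    by move=> r; apply: integral_ge0 => b _; rewrite lee_fin mulr_ge0.
  apply: (@measurable_fun_fubini_tonelli_F _ _ (Y * X)%type X R m1
    (fun r => (k_ j (r.1.2, r.2) * `|psi (r.2, r.1.1) - psi (r.1.2, r.1.1)|)%:E)); last first.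
    by move=> r; rewrite lee_fin mulr_ge0.
  apply/measurable_EFinP; apply: measurable_funM; first by apply: (measurableT_comp mk); mproj.
  by apply: measurableT_comp => //; apply: measurable_funB; apply: (measurableT_comp mpsi); mproj.
- apply: integrableZl => //.
  have minorm := measurable_int _ inorm.
  apply/integrableP; split; first exact: (measurable_fubini_G inorm).
  have := (integrable21ltyP _ _ minorm).1 inorm; congr (_ < _)%E.
  apply: eq_integral => y _; rewrite [RHS]gee0_abs; last first.
    by apply: integral_ge0 => x _; rewrite lee_fin.
  by apply: eq_integral => x _; rewrite /= normr_id.
- move=> j y _; apply/andP; split; first exact: (osc_ge0 (kk j)).
  apply: (osc_le (kk j)); apply: (measurableT_comp mpsi); exact: measurable_pair2.
have := ae_integrable2 ipsi; apply: filterS => y iy _.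
by apply: H.
Qed.

Section strong_continuity.
Context {R : realType}.
Local Notation leb := (@lebesgue_measure R).

Definition kernelN n t (p : 'rV[R]_n * 'rV[R]_n) : R := gauss t (p.1 - p.2).

Lemma mkernelN n t : 0 < t -> mkernel (@lebesgue_rV R n) (kernelN t).
Proof.
move=> t0; split.
- by apply: measurable_gauss => //; apply: measurable_rVB; [exact: measurable_fst|exact: measurable_snd].
- by move=> p; exact: gauss_ge0.
- by move=> x y; rewrite /kernelN/= gaussC.
- by move=> x; exact: integral_gauss.
Qed.

Lemma integral_rVS n (F : 'rV[R]_n.+1 -> \bar R) : measurable_fun setT F -> (forall x, 0 <= F x)%E ->
  (\int[lebesgue_rV n.+1]_x F x = \int[leb \x lebesgue_rV n]_p F (cons_rV p))%E.
Proof.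
by move=> mF F0; rewrite /= ge0_integral_pushforward//; last exact: measurable_cons_rV; rewrite preimage_setT.
Qed.

Lemma integrable_cons n (phi : 'rV[R]_n.+1 -> R) :
  (lebesgue_rV n.+1).-integrable setT (EFin \o phi) ->
  (leb \x lebesgue_rV n)%E.-integrable setT (EFin \o (phi \o @cons_rV R n)).
Proof.
move=> /integrableP[mphi fphi]; apply/integrableP; split.
  exact: (measurableT_comp mphi (@measurable_cons_rV R n)).
move: fphi; rewrite integral_rVS//; exact: measurableT_comp.
Qed.

(** Induction on the dimension with [osc_prod_le], both terms being handled by
    [osc_slices]. *)
Lemma osc_gauss_cvg n (phi : 'rV[R]_n -> R) (t_ : nat -> R) :
  (lebesgue_rV n).-integrable setT (EFin \o phi) ->
  (forall k, 0 < t_ k) -> t_ k @[k --> \oo] --> 0 ->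
  osc (lebesgue_rV n) (kernelN (t_ k)) phi @[k --> \oo] --> 0%E.
Proof.
move=> + t0 tc; elim: n phi => [|n IH] phi iphi.
  rewrite (_ : (fun k => _) = cst 0%E); first exact: cvg_cst.
  apply/funext => k; rewrite /osc integral0_eq// => x _; rewrite integral0_eq// => y _.
  by rewrite (thinmx0 x) (thinmx0 y) subrr normr0 mulr0.
have mphi : measurable_fun setT phi by have /integrableP[/measurable_EFinP] := iphi.
pose psi := phi \o @cons_rV R n.
have ipsi : (leb \x lebesgue_rV n)%E.-integrable setT (EFin \o psi) := integrable_cons iphi.
have mpsi : measurable_fun setT psi by have /integrableP[/measurable_EFinP] := ipsi.
pose A k := (\int[lebesgue_rV n]_y osc leb (kernel1 (t_ k)) (fun a => psi (a, y)))%E.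
pose B k := (\int[leb]_a osc (lebesgue_rV n) (kernelN (t_ k)) (fun y => psi (a, y)))%E.
have cA : A k @[k --> \oo] --> 0%E.
  apply: (osc_slices (k_ := fun k => kernel1 (t_ k)) (fun k => mkernel1 (t0 k)) ipsi).
  by move=> g ig; exact: osc1_cvg.
have cB : B k @[k --> \oo] --> 0%E.
  pose psi' (p : 'rV[R]_n * measurableTypeR R) := psi (p.2, p.1).
  have ipsi' : (lebesgue_rV n \x leb)%E.-integrable setT (EFin \o psi').
    have mpsi' : measurable_fun setT (EFin \o psi').
      by apply/measurable_EFinP; apply: (measurableT_comp mpsi); mproj.
    apply/integrable21ltyP => //.
    have m' : measurable_fun setT (EFin \o psi) by exact/measurable_EFinP.
    exact: ((integrable12ltyP _ _ m').1 ipsi).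
  apply: (osc_slices (k_ := fun k => kernelN (t_ k)) (fun k => mkernelN n (t0 k)) ipsi').
  by move=> g ig; exact: IH.
apply: (@squeeze0 _ _ (fun k => A k + B k)%E); last first.
  by rewrite -[0%E](adde0 0%E); apply: cvgeD.
move=> k; have kk := mkernelN n.+1 (t0 k); rewrite (osc_ge0 kk)/=.
have := osc_prod_le (mkernel1 (t0 k)) (mkernelN n (t0 k)) mpsi.
apply: le_trans.
have mint := measurable_osc_integrand kk mphi.
rewrite le_eqVlt; apply/orP; left; apply/eqP.
rewrite /osc integral_rVS; last 2 first.
- apply: (@measurable_fun_fubini_tonelli_F _ _ 'rV[R]_n.+1 'rV[R]_n.+1 R (lebesgue_rV n.+1)
    (fun p => (kernelN (t_ k) p * `|phi p.2 - phi p.1|)%:E)).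
    exact/measurable_EFinP.
  by move=> p; rewrite lee_fin (osc_integrand_ge0 kk).
- by move=> x; apply: integral_ge0 => y _; rewrite lee_fin mulr_ge0 ?gauss_ge0.
apply: eq_integral => p _; rewrite integral_rVS; last 2 first.
- apply/measurable_EFinP; apply: (measurableT_comp mint (g := fun y => (cons_rV p, y))).
  exact: measurable_pair1.
- by move=> y; rewrite lee_fin mulr_ge0 ?gauss_ge0.
apply: eq_integral => q _; rewrite /kernelN/kernel1/psi/=; congr (_ * _)%:E.
by case: p q => [a v] [b w]; rewrite cons_rVB gauss_cons.
Qed.

(** G t * phi - phi is the average of phi y - phi x against the Gaussian. *)
Lemma heat_cvg0 n (phi : 'rV[R]_n -> R) (t_ : nat -> R) :
  (lebesgue_rV n).-integrable setT (EFin \o phi) ->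
  (forall k, 0 < t_ k) -> t_ k @[k --> \oo] --> 0 ->
  (\int[lebesgue_rV n]_x (`|gconv (gauss (t_ k)) phi x - phi x|)%:E)%E @[k --> \oo] --> 0%E.
Proof.
move=> iphi t0 tc; apply: (squeeze0 _ (osc_gauss_cvg iphi t0 tc)) => k.
have mphi : measurable_fun setT phi by have /integrableP[/measurable_EFinP] := iphi.
have kk := mkernelN n (t0 k).
apply/andP; split; first by apply: integral_ge0 => x _; rewrite lee_fin.
apply: ge0_le_integral => //.
- apply/measurable_EFinP; apply: measurableT_comp => //; apply: measurable_funB => //.
  exact: measurable_heat.
- apply: (@measurable_fun_fubini_tonelli_F _ _ 'rV[R]_n 'rV[R]_n R (lebesgue_rV n)
    (fun p => (kernelN (t_ k) p * `|phi p.2 - phi p.1|)%:E)).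
    by apply/measurable_EFinP; exact: (measurable_osc_integrand kk).
  by move=> p; rewrite lee_fin (osc_integrand_ge0 kk).
move=> x _.
have i1 := (heat_L1 iphi (t_ k) x).1.
have i2 : (lebesgue_rV n).-integrable setT (EFin \o (fun y => gauss (t_ k) (x - y) * phi x)).
  rewrite (_ : _ \o _ = fun y => ((gauss (t_ k) (x - y))%:E * (phi x)%:E)%E); last exact/funext.
  by apply: integrableZr => //; exact: integrable_gauss.
have E : gconv (gauss (t_ k)) phi x - phi x =
    \int[lebesgue_rV n]_y (gauss (t_ k) (x - y) * phi y - gauss (t_ k) (x - y) * phi x).
  rewrite RintegralB//; congr (_ - _).
  by rewrite -[LHS](conv_gauss_cst x (phi x) (t0 k)).
have i3 : (lebesgue_rV n).-integrable setT (EFin \o (fun y => gauss (t_ k) (x - y) * phi y - gauss (t_ k) (x - y) * phi x)).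
  have := integrableB measurableT i1 i2; exact: eq_integrable.
rewrite E.
apply: (@le_trans _ _ (\int[lebesgue_rV n]_y `|(gauss (t_ k) (x - y) * phi y - gauss (t_ k) (x - y) * phi x)%:E|)%E).
  have := le_abse_integral (lebesgue_rV n) measurableT (measurable_int _ i3).
  by rewrite -[X in (`|X| <= _)%E -> _](fineK (integrable_fin_num measurableT i3)).
rewrite le_eqVlt; apply/orP; left; apply/eqP; apply: eq_integral => y _.
by rewrite /kernelN/= -mulrBr normrM (ger0_norm (gauss_ge0 _ _)).
Qed.

End strong_continuity.

(** * The solution *)

Section heat_mass.
Context {R : realType} {n : nat}.
Local Notation mu := (@lebesgue_rV R n).
Implicit Types (x y : 'rV[R]_n) (t s : R).
Context (phi : 'rV[R]_n -> R) (iphi : mu.-integrable setT (EFin \o phi)).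
Local Notation V := (fun s y => gconv (gauss s) (fun z => `|phi z|) y).

Let iabs : mu.-integrable setT (EFin \o (fun y => `|phi y|)).
Proof. exact: (integrable_norm iphi). Qed.

Let mabs : measurable_fun [set: 'rV[R]_n] (fun y => `|phi y|).
Proof. exact: (measurable_of_integrable iabs). Qed.

Lemma heat_mass t : 0 < t -> (\int[mu]_x (V t x)%:E = \int[mu]_x (`|phi x|)%:E)%E.
Proof.
move=> t0; rewrite -(kernel_snd (mkernelN n t0) mabs)//; apply: eq_integral => x _.
by rewrite /gconv /Rintegral fineK//; exact: (integrable_fin_num measurableT (heat_L1 iabs t x).1).
Qed.

Lemma heat_integrable t : 0 < t -> mu.-integrable setT (EFin \o V t).
Proof.
move=> t0; apply/integrableP; split.
  by apply/measurable_EFinP; exact: measurable_heat.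
have := heat_mass t0.
rewrite (_ : (\int[mu]_x (V t x)%:E = \int[mu]_x `|(EFin \o V t) x|)%E); last first.
  by apply: eq_integral => x _; rewrite /= ger0_norm// heat_ge0.
by move=> ->; have /integrableP[_] := iphi.
Qed.

(** [gauss_locdom] without shift, which bounds the heat flow near time t0 by one
    integrable function. *)
Lemma heat_locdom t0 : 0 < t0 -> exists2 C : R, 0 <= C &
  forall t x, t0 / 2 <= t <= 2 * t0 -> V t x <= C * V (4 * t0) x.
Proof.
move=> t00; have t04 : 0 < t0 / 4 by rewrite divr_gt0.
have [C C0 HC] := @gauss_locdom R n (t0 / 4) 0 t04 (lexx _).
exists C => // t x /andP[t1 t2].
have B (z : 'rV[R]_n) : gauss t z <= C * gauss (4 * t0) z.
  have := HC (t / 4) z 0; rewrite normr0 lexx addr0 => h.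
  have E1 : 4 * (t / 4) = t by field.
  have E2 : 16 * (t0 / 4) = 4 * t0 by field.
  by rewrite E1 E2 in h; apply: h => //; apply/andP; split; lra.
have i1 := (heat_L1 iabs t x).1; have i2 := (heat_L1 iabs (4 * t0) x).1.
rewrite /gconv -RintegralZl//; apply: le_Rintegral => //.
- exact: integrable_scale.
- by move=> y _; rewrite mulrA ler_wpM2r.
Qed.

End heat_mass.

Lemma normrB_le4 {R : realType} (p q A B D : R) :
  `|p| <= 2 * A -> `|q| <= 2 * B -> A <= D -> B <= D -> `|p - q| <= 4 * D.
Proof. by move=> hp hq AD BD; apply: (le_trans (ler_normB _ _)); lra. Qed.

Lemma integral_itv_cvg0 {R : realType} (a : R -> R) (T : R) (w : nat -> R) :
  (forall s, 0 <= a s) -> measurable_fun [set: R] a -> 0 < T ->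
  (\int[lebesgue_measure]_(s in `]0%R, T[) (a s)%:E < +oo)%E -> w k @[k --> \oo] --> 0 ->
  (\int[lebesgue_measure]_(s in `]0%R, w k[) (a s)%:E)%E @[k --> \oo] --> 0%E.
Proof.
move=> a0 ma T0 aT w0.
have mb k : measurable_fun [set: R] (fun s => if s < w k then a s else 0).
  by apply: measurable_fun_ifT => //; exact: measurable_fun_ltr.
have b0 : (\int[lebesgue_measure]_(s in `]0%R, T[) (if (s < w k)%R then a s else 0%R)%:E)%E @[k --> \oo] --> 0%E.
  apply: (@dominated_cvg0 _ _ _ lebesgue_measure `]0, T[%classic _ (EFin \o a)) => //.
  - by move=> k; apply/measurable_EFinP; apply: measurable_funTS; exact: mb.
  - apply/integrableP; split; first by apply/measurable_EFinP; exact: measurable_funTS.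
    by under eq_integral do rewrite /= ger0_norm//.
  - by move=> k s _; case: ifP => _; rewrite !lee_fin ?a0 ?lexx.
  apply: aeW => s; rewrite /= in_itv/= => /andP[s0 _].
  apply: cvg_near_cst; near=> k.
  have ws : w k < s by near: k; have := w0 _ (lt_nbhsl s0).
  by rewrite ltNge (ltW ws).
apply: (squeeze_cvge _ (cvg_cst 0%E) b0); near=> k.
have wT : w k < T by near: k; have := w0 _ (lt_nbhsl T0).
rewrite integral_ge0 => [|s _]; last by rewrite lee_fin.
rewrite integral_mkcond [leRHS]integral_mkcond; apply: ge0_le_integral => //.
- by move=> s _; rewrite patchE; case: ifP => _; rewrite ?lee_fin.
- by apply/(measurable_restrictT _ _).1 => //; apply: measurable_funTS; apply/measurable_EFinP.
- by apply/(measurable_restrictT _ _).1 => //; apply: measurable_funTS; apply/measurable_EFinP; exact: mb.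
move=> s _; rewrite !patchE !mem_setE !in_itv/=.
case: ltP => //= s0; case: ltP => //= sw; first by rewrite (lt_trans sw wT).
by case: ifP.
Unshelve. all: by end_near. Qed.

Section solution.
Context {R : realType} {n : nat}.
Local Notation mu := (@lebesgue_rV R n).
Local Notation leb := (@lebesgue_measure R).
Local Notation st := (leb \x mu)%E.
Local Notation ST := (measurableTypeR R * 'rV[R]_n)%type.
Implicit Types (x y z : 'rV[R]_n) (t s : R).
Context (phi : 'rV[R]_n -> R) (iphi : mu.-integrable setT (EFin \o phi)).
Context (f : R -> R) (f_lip : locally_lipschitz f) (f_mono : {homo f : x y / x <= y})
  (f0 : f 0 = 0).
Context (T : R) (a : R -> R) (a_ge0 : forall s, 0 <= a s) (ma : measurable_fun [set: R] a).
Context (a_int : (\int[leb]_(s in `]0%R, T[) (a s)%:E <= (2^-1)%:E)%E).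
Local Notation V := (fun s y => gconv (gauss s) (fun z => `|phi z|) y).
Context (hfa : forall s y (r : R), 0 < s < T -> `|r| <= 2 * V s y -> `|f r| <= a s * (2 * V s y)).

Definition sol t x : R := if t == 0 then phi x else mild phi f T t x.

Let mphi : measurable_fun [set: 'rV[R]_n] phi. Proof. exact: (measurable_of_integrable iphi). Qed.

Let mm := measurable_mild iphi f_lip f_mono f0 a_ge0 ma a_int hfa.
Let mb := mild_bound iphi f_lip f_mono f0 a_ge0 ma a_int hfa.
Let mfix := mild_fixed iphi f_lip f_mono f0 a_ge0 ma a_int hfa.

Lemma sol0 : sol 0 = phi.
Proof. by apply/funext => x; rewrite /sol eqxx. Qed.

Lemma solE t : 0 < t -> sol t = mild phi f T t.
Proof. by move=> t0; apply/funext => x; rewrite /sol gt_eqF. Qed.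

Lemma sol_le t x : 0 < t < T -> `|sol t x| <= 2 * V t x.
Proof.
by move=> tT; rewrite solE; [have := mb t x; rewrite /majorant tT|case/andP: tT].
Qed.

Lemma measurable_sol : measurable_fun [set: R * 'rV[R]_n] (fun p => sol p.1 p.2).
Proof.
have E : (fun p : ST => sol p.1 p.2) = fun p : ST => if (p.1 <= 0) && (0 <= p.1) then phi p.2 else mild phi f T p.1 p.2.
  by apply/funext => p; rewrite /sol eq_le.
have h : measurable_fun [set: ST] (fun p : ST => sol p.1 p.2).
  rewrite E; apply: measurable_fun_ifT => //.
    by apply: measurable_and; apply: measurable_fun_ler => //; exact: measurable_fst.
  by apply: (measurableT_comp mphi); exact: measurable_snd.
exact: h.
Qed.

Lemma sol_bounded (t1 : R) : 0 < t1 ->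
  exists M : R, forall t y, t1 <= t < T -> `|sol t y| <= M.
Proof.
move=> t10; exists (2 * (peak t1 ^+ n * \int[mu]_y `|phi y|)) => t y /andP[t1t tT].
have t0 := lt_le_trans t10 t1t.
have tT' : 0 < t < T by rewrite t0.
apply: (le_trans (sol_le y tT')); rewrite ler_wpM2l//.
apply: (le_trans (heat_L1_le iphi y t0)); rewrite ler_wpM2r//.
  by apply: Rintegral_ge0 => z _.
apply: lerXn2r; rewrite ?nnegrE; [exact: ltW (peak_gt0 t0)|exact: ltW (peak_gt0 t10)|].
rewrite /peak.
by rewrite lef_pV2 ?posrE ?sqrtr_gt0 ?mulr_gt0 ?pi_gt0// ler_wsqrtr// ler_wpM2l// mulr_ge0// pi_ge0.
Qed.

Lemma sol_duhamel (t1 t : R) x : 0 < t1 -> t1 < t < T ->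
  sol t x = gconv (gauss (t - t1)) (sol t1) x + volterra (fun s y => f (sol s y)) t1 gauss t x.
Proof.
move=> t10 tT; have /andP[t1t _] := tT.
have mh : measurable_fun [set: ST] (fun p : ST => f (mild phi f T p.1 p.2)).
  exact: (measurable_fU f_lip mm).
have iD r z : 0 < r < T -> st.-integrable setT (EFin \o dominator phi T a r z).
  by move=> rT; exact: (dominator_integrable iphi a_ge0 ma a_int z rT).1.
have sD r z s : mu.-integrable setT (EFin \o (fun y => dominator phi T a r z (s, y))).
  exact: (dominator_slice iphi T a r z s).1.
have bD r z p := integrand_bound f0 hfa mb r z p.
have := @mild_duhamel R n phi iphi (fun s y => f (mild phi f T s y)) mh T _ iD sD bD _ mfix t1 t x t10 tT.
rewrite (solE t10) (solE (lt_trans t10 t1t)) => ->; congr (_ + _).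
apply: eq_Rintegral => s /set_mem; rewrite /= in_itv/= => /andP[t1s _].
by apply: eq_Rintegral => y _; rewrite (solE (lt_trans t10 t1s)).
Qed.

Lemma sol_integrable t : 0 <= t < T -> mu.-integrable setT (EFin \o sol t).
Proof.
move=> /andP[]; rewrite le_eqVlt => /predU1P[<- _|t0 tT]; first by rewrite sol0.
have i2 : mu.-integrable setT (EFin \o (fun x => 2 * V t x)).
  by apply: integrable_scale => //; exact: heat_integrable.
apply: (@Rintegral_bound R _ _ mu _ _ setT measurableT _ i2 _).1 => [|x _].
  exact: (measurable_slice measurable_sol t).
by apply: sol_le; rewrite t0.
Qed.

Lemma dist_integrable t t' : 0 <= t < T -> 0 <= t' < T ->
  mu.-integrable setT (EFin \o (fun x => `|sol t x - sol t' x|)).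
Proof.
move=> tT t'T; have i : mu.-integrable setT (EFin \o (fun x => sol t x - sol t' x)).
  have := integrableB measurableT (sol_integrable tT) (sol_integrable t'T); exact: eq_integrable.
exact: (integrable_norm i).
Qed.

Definition dist1 t t' : R := \int[mu]_x `|sol t x - sol t' x|.

Lemma N1_dist t t' : 0 <= t < T -> 0 <= t' < T ->
  'N[mu]_1 [EFin \o (sol t \- sol t')%R]%E = (dist1 t t')%:E.
Proof.
move=> tT t'T; rewrite Lnorm1 /dist1 /Rintegral fineK//.
exact: (integrable_fin_num measurableT (dist_integrable tT t'T)).
Qed.

Lemma dist1_ge0 t t' : 0 <= dist1 t t'.
Proof. exact: Rintegral_ge0. Qed.

Lemma dist1_cvg t0 : 0 < t0 < T -> dist1 t t0 @[t --> t0] --> 0.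
Proof.
move=> /[dup] t0T /andP[t00 t0T'].
have d00 : dist1 t0 t0 = 0.
  by rewrite /dist1 /Rintegral integral0_eq// => x _; rewrite subrr normr0.
rewrite -[X in _ --> X]d00.
apply: (@continuous_at_seq R R (dist1 ^~ t0) t0) => w wt.
rewrite [X in _ --> X](_ : _ = \int[mu]_x `|sol t0 x - sol t0 x|)//.
have [C C0 HC] := heat_locdom iphi t00.
have t0in : t0 / 2 <= t0 <= 2 * t0 by apply/andP; split; lra.
have t04 : 0 < 4 * t0 by rewrite mulr_gt0.
have iV := heat_integrable iphi t04.
have iG : mu.-integrable setT (EFin \o (fun x => 4 * C * V (4 * t0) x)).
  exact: integrable_scale.
apply: (@Rdominated_cvg _ _ _ mu (fun k x => `|sol (w k) x - sol t0 x|) _ _ setT measurableT _ iG).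
- move=> k; apply: measurableT_comp => //; apply: measurable_funB; exact: (measurable_slice measurable_sol).
- have nw : \forall t \near t0, t0 / 2 < t /\ t < Num.min (2 * t0) T.
    near=> t; split; near: t; first by apply: lt_nbhsr; lra.
    by apply: lt_nbhsl; rewrite lt_min t0T' andbT; lra.
  have nk : \forall k \near \oo, t0 / 2 < w k /\ w k < Num.min (2 * t0) T := wt _ nw.
  apply: filterS nk => k [w1]; rewrite lt_min => /andP[w2 w3] x _.
  have w0 : 0 < w k by apply: lt_trans w1; rewrite divr_gt0.
  have wT : 0 < w k < T by rewrite w0.
  have h1 := sol_le x wT; have h2 := sol_le x t0T.
  have h3 : V (w k) x <= C * V (4 * t0) x by apply: HC; rewrite !ltW.
  have h4 : V t0 x <= C * V (4 * t0) x by exact: HC.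
  rewrite normr_id -mulrA.
  exact: (normrB_le4 h1 h2 h3 h4).
move=> x _.
have c : sol (w k) x @[k --> \oo] --> sol t0 x.
  apply: (@cvg_comp _ _ _ w (fun r => sol r x) _ _ _ wt).
  exact: (solution_time_cvg f_lip f_mono f0 measurable_sol sol_bounded sol_duhamel).
by apply: cvg_norm; apply: cvgB => //; exact: cvg_cst.
Unshelve. all: by end_near. Qed.

(** The first term is the error of the heat flow; the second bounds the Duhamel
    term by integrating [dominator_integral] in x, with the mass of V t. *)
Lemma dist1_init t : 0 < t < T -> ((dist1 t 0)%:E <=
  \int[mu]_x (`|gconv (gauss t) phi x - phi x|)%:E +
  (2 * \int[mu]_x `|phi x|)%:E * \int[leb]_(s in `]0%R, t[) (a s)%:E)%E.
Proof.
move=> /[dup] tT /andP[t0 tT']; set A := (\int[leb]_(s in `]0%R, t[) (a s)%:E)%E.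
have A0 : (0 <= A)%E by apply: integral_ge0 => s _; rewrite lee_fin.
have tT0 : 0 <= t < T by rewrite (ltW t0).
have T0 : 0 <= (0 : R) < T by apply/andP; split=> //; exact: lt_trans tT'.
have mV : measurable_fun [set: 'rV[R]_n] (V t) := measurable_of_integrable (heat_integrable iphi t0).
have mg : measurable_fun [set: 'rV[R]_n] (gconv (gauss t) phi) by apply: measurable_heat.
rewrite /dist1 /Rintegral fineK; last exact: (integrable_fin_num measurableT (dist_integrable tT0 T0)).
apply: (@le_trans _ _ (\int[mu]_x ((`|gconv (gauss t) phi x - phi x|)%:E + (2%:E * (V t x)%:E) * A))%E).
  apply: ge0_le_integral => //.
  - by have := dist_integrable tT0 T0 => /integrableP[].
  - apply: emeasurable_funD.
      by apply/measurable_EFinP; apply: measurableT_comp => //; exact: measurable_funB.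
    by apply: emeasurable_funM => //; apply: emeasurable_funM => //; apply/measurable_EFinP.
  move=> x _; rewrite sol0 (solE t0) (mfix x tT).
  have [iD _] := dominator_integrable iphi a_ge0 ma a_int x tT.
  have mI := measurable_integrand f_lip mm t x.
  have [_ hI] := @Rintegral_bound R _ _ st _ _ setT measurableT mI iD (fun p _ => integrand_bound f0 hfa mb t x p).
  have hD := dominator_integral iphi T a_ge0 ma t x.
  apply: le_trans (_ : (`|gconv (gauss t) phi x - phi x|)%:E + (\int[st]_p dominator phi T a t x p)%:E <= _)%E.
    by rewrite -EFinD lee_fin addrAC (le_trans (ler_normD _ _))// lerD2l.
  apply: leeD2l; rewrite /Rintegral fineK -?EFinM//.
  exact: (integrable_fin_num measurableT iD).
rewrite ge0_integralD//=; last 3 first.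
- by apply/measurable_EFinP; apply: measurableT_comp => //; exact: measurable_funB.
- by move=> x _; rewrite mule_ge0// -EFinM lee_fin mulr_ge0// heat_ge0.
- by apply: emeasurable_funM => //; apply: emeasurable_funM => //; apply/measurable_EFinP.
apply: leeD2l; rewrite ge0_integralZr//; last 2 first.
- by apply: emeasurable_funM => //; apply/measurable_EFinP.
- by move=> x _; rewrite -EFinM lee_fin mulr_ge0// heat_ge0.
rewrite ge0_integralZl//; last 2 first.
- by apply/measurable_EFinP.
- by move=> x _; rewrite lee_fin heat_ge0.
rewrite heat_mass// EFinM /Rintegral fineK//.
exact: (integrable_fin_num measurableT (integrable_norm iphi)).
Qed.

(** Both terms of [dist1_init] tend to zero, along every sequence of times. *)
Lemma dist1_cvg0 : 0 < T -> dist1 t 0 @[t --> 0^'+] --> 0.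
Proof.
move=> T0; apply/cvg_at_rightP => w [w0 wt].
apply: (@fine_cvg _ _ _ _ (fun k => (dist1 (w k) 0)%:E)).
have aT : (\int[leb]_(s in `]0%R, T[) (a s)%:E < +oo)%E by apply: le_lt_trans a_int _; rewrite ltry.
have h1 := heat_cvg0 iphi w0 wt; have h2 := integral_itv_cvg0 a_ge0 ma T0 aT wt.
have h3 := cvgeZl (y := (2 * \int[mu]_x `|phi x|)%:E) isT h2.
rewrite mule0 in h3.
have h4 : (\int[mu]_x (`|gconv (gauss (w k)) phi x - phi x|)%:E +
    (2 * \int[mu]_x `|phi x|)%:E * \int[leb]_(s in `]0%R, w k[) (a s)%:E)%E @[k --> \oo] --> 0%E.
  by rewrite -[X in _ --> X](adde0 0%E); apply: cvgeD.
suff : (dist1 (w k) 0)%:E @[k --> \oo] --> 0%E by [].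
apply: (squeeze_cvge _ (cvg_cst 0%E) h4); near=> k.
rewrite lee_fin dist1_ge0/=; apply: dist1_init; rewrite w0/=.
by near: k; have := wt _ (lt_nbhsl T0).
Unshelve. all: by end_near. Qed.

Lemma sol_C_L1 : C_L1 T sol.
Proof.
split=> [t|t0].
  by rewrite /= in_itv/= => tT; apply/Lfun1_integrable; exact: sol_integrable.
rewrite /= in_itv/= => t0T.
suff key : dist1 t t0 @[t --> within `[0, T[%classic (nbhs t0)] --> 0.
  have h : (dist1 t t0)%:E @[t --> within `[0, T[%classic (nbhs t0)] --> 0%E.
    by apply: cvg_EFin => //; exact: nearW.
  apply: cvg_trans h; apply: near_eq_cvg; apply: (@filterS _ (nbhs t0) _ _ _ _ filterT) => t _.
  by rewrite /= in_itv/= => tT; rewrite N1_dist.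
move: t0T => /[dup] t0T /andP[]; rewrite le_eqVlt => /predU1P[<- T0|t00 t0T'].
  apply/cvgrPdist_le => e e0.
  have /cvgrPdist_le/(_ e e0) := dist1_cvg0 T0.
  rewrite /at_right !near_withinE; apply: filterS => t + tT; rewrite /= in_itv/= in tT.
  have [t00|t00|<-] := ltgtP 0 t; first exact.
    by move=> _; move: tT; rewrite leNgt t00.
  move=> _; rewrite /dist1 /Rintegral integral0_eq => [|x _]; first by rewrite subrr normr0 ltW.
  by rewrite subrr normr0.
have t0T1 : 0 < t0 < T by rewrite t00.
apply: cvg_trans (dist1_cvg t0T1).
by apply: cvg_app; exact: cvg_within.
Qed.

Lemma sol_classical : classical_L1_solution f phi T sol.
Proof.
split.
- exact: (solution_C21 f_lip f_mono f0 measurable_sol sol_bounded sol_duhamel).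
- by move=> x t xt; exact: (heat_equation f_lip f_mono f0 measurable_sol sol_bounded sol_duhamel).
- exact: sol_C_L1.
- apply: (solution_Linftyloc measurable_sol sol_bounded).
  exact: (time_holder f_lip f_mono f0 measurable_sol sol_bounded sol_duhamel).
- by rewrite sol0; exact: aeW.
Qed.

End solution.

(** * Decay of the uniform norm and choice of the time *)

Section decay.
Context {R : realType} {n : nat}.
Local Notation mu := (@lebesgue_rV R n).
Implicit Types (x y : 'rV[R]_n) (t k : R).
Context (phi : 'rV[R]_n -> R) (iphi : mu.-integrable setT (EFin \o phi)).
Local Notation V := (fun s y => gconv (gauss s) (fun z => `|phi z|) y).

Let iabs : mu.-integrable setT (EFin \o (fun y => `|phi y|)).
Proof. exact: (integrable_norm iphi). Qed.

Definition excess k y : R := Num.max (`|phi y| - k) 0.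

Lemma excess_ge0 k y : 0 <= excess k y.
Proof. by rewrite le_max lexx orbT. Qed.

Lemma measurable_excess k : measurable_fun [set: 'rV[R]_n] (excess k).
Proof.
apply: measurable_maxr => //; apply: measurable_funB => //.
exact: (measurable_of_integrable iabs).
Qed.

Lemma excess_le k y : 0 <= k -> excess k y <= `|phi y|.
Proof. by move=> k0; rewrite ge_max normr_ge0 andbT gerBl. Qed.

Lemma excess_integrable k : 0 <= k -> mu.-integrable setT (EFin \o excess k).
Proof.
move=> k0; apply: (Rintegral_bound measurableT (measurable_excess k) iabs _).1 => y _.
by rewrite ger0_norm ?excess_ge0// excess_le.
Qed.

Lemma excess_cvg0 : \int[mu]_y excess j%:R y @[j --> \oo] --> 0.
Proof.
have -> : 0 = \int[mu]_y (0 : R) :> R by rewrite /Rintegral integral0.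
apply: (@Rdominated_cvg _ _ _ mu (fun j y => excess j%:R y) _ _ setT measurableT _ iabs).
- by move=> j; exact: measurable_excess.
- by apply: nearW => j y _; rewrite ger0_norm ?excess_ge0// excess_le.
move=> y _; apply: cvg_near_cst; near=> j.
apply/max_idPr; rewrite subr_le0; near: j; exact: nbhs_infty_ger.
Unshelve. all: by end_near. Qed.

(** The values of |phi| below k are averaged to at most k, and the excess is
    spread out by the bound from L1 to the bounded functions. *)
Lemma heat_split t x k : 0 < t -> 0 <= k ->
  V t x <= k + peak t ^+ n * \int[mu]_y excess k y.
Proof.
move=> t0 k0; have ie := excess_integrable k0.
have iG := integrable_gauss x t0.
have ih := (heat_L1 ie t x).1.
have ik : mu.-integrable setT (EFin \o (fun y => k * gauss t (x - y))).
  exact: integrable_scale.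
have E : \int[mu]_y excess k y = \int[mu]_y `|excess k y|.
  by apply: eq_Rintegral => y _; rewrite ger0_norm// excess_ge0.
apply: (@le_trans _ _ (k + gconv (gauss t) (excess k) x)); last first.
  rewrite lerD2l E; apply: le_trans (heat_L1_le ie x t0).
  by rewrite (le_trans (ler_norm _))//; exact: (heat_L1 ie t x).2.
have Ek : \int[mu]_y (k * gauss t (x - y)) = k.
  rewrite RintegralZl//.
  by rewrite /Rintegral integral_gauss//= mulr1.
rewrite -{1}Ek /gconv -RintegralD//; apply: le_Rintegral => //.
- exact: (heat_L1 iabs t x).1.
- have := integrableD measurableT ik ih; exact: eq_integrable.
move=> y _; rewrite (mulrC k) -mulrDr ler_wpM2l ?gauss_ge0//.
by rewrite -lerBlDl le_max lexx.
Qed.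

Lemma powR_half t : 0 <= t -> t `^ (n%:R / 2) = Num.sqrt t ^+ n.
Proof. by move=> t0; rewrite mulrC powRrM powR12_sqrt// powR_mulrn ?sqrtr_ge0. Qed.

Lemma decay_rate t : 0 < t -> t `^ (n%:R / 2) * peak t ^+ n = @peak R 1 ^+ n.
Proof.
move=> t0; rewrite powR_half ?ltW// -exprMn /peak mulr1.
rewrite sqrtrM ?mulr_ge0 ?pi_ge0// invfM mulrCA divff ?mulr1//.
by rewrite gt_eqF ?sqrtr_gt0.
Qed.

Context (n_gt0 : (0 < n)%N) (T : R) (T0 : 0 < T) (u : R -> 'rV[R]_n -> R).
Context (u_le : forall t x, 0 < t < T -> `|u t x| <= 2 * V t x).

(** By [heat_split] and [decay_rate], the quantity is at most
    2 (k t^(n/2) + c * |excess k|_1): first k is chosen large, and then t small. *)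
Lemma Linfty_decay :
  ((t `^ (n%:R / 2))%:E * 'N[mu]_(+oo) [EFin \o u t])%E @[t --> 0^'+] --> 0%E.
Proof.
pose c : R := @peak R 1 ^+ n.
have c0 : 0 < c by rewrite exprn_gt0// peak_gt0.
have bnd t k : 0 < t < T -> 0 <= k ->
    ((t `^ (n%:R / 2))%:E * 'N[mu]_(+oo) [EFin \o u t] <=
     (2 * (t `^ (n%:R / 2) * k + c * \int[mu]_y excess k y))%:E)%E.
  move=> /[dup] tT /andP[t0 _] k0; set I := \int[mu]_y _.
  have I0 : 0 <= I by apply: Rintegral_ge0 => y _; exact: excess_ge0.
  have M0 : 0 <= 2 * (k + peak t ^+ n * I).
    by rewrite mulr_ge0// addr_ge0// mulr_ge0// exprn_ge0// ltW// peak_gt0.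
  have h : ('N[mu]_(+oo) [EFin \o u t] <= (2 * (k + peak t ^+ n * I))%:E)%E.
    apply: (Linfty_le M0) => x; apply: (le_trans (u_le x tT)).
    by rewrite ler_wpM2l//; exact: heat_split.
  apply: (@le_trans _ _ ((t `^ (n%:R / 2))%:E * (2 * (k + peak t ^+ n * I))%:E)%E).
    by apply: lee_wpmul2l => //; rewrite lee_fin powR_ge0.
  rewrite -EFinM lee_fin /c -(decay_rate t0) le_eqVlt; apply/orP; left; apply/eqP; ring.
have F0 t : (0 <= (t `^ (n%:R / 2))%:E * 'N[mu]_(+oo) [EFin \o u t])%E.
  by rewrite mule_ge0 ?lee_fin ?powR_ge0// Lnorm_ge0.
apply/ge0_cvge0P => // e e0.
have e8 : 0 < e / 4 / c by rewrite !divr_gt0.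
have [k _ /(_ k (leqnn _)) Hk] := (cvgrPdist_le _ _).1 excess_cvg0 _ e8.
have I0 : 0 <= \int[mu]_y excess k%:R y by apply: Rintegral_ge0 => y _; exact: excess_ge0.
rewrite sub0r normrN ger0_norm// ler_pdivlMr// mulrC in Hk.
have sq0 : Num.sqrt t @[t --> (0 : R)^'+] --> (0 : R).
  by rewrite -[X in _ --> X](@sqrtr0 R); apply: cvg_at_right_filter; exact: sqrt_continuous.
have k4 : 0 < e / 4 / (k%:R + 1) by rewrite !divr_gt0// ltr_wpDl.
near=> t.
have tT : 0 < t < T.
  by apply/andP; split; [near: t; exact: nbhs_right_gt|near: t; exact: nbhs_right_lt].
have s1 : Num.sqrt t <= 1.
  rewrite -(@sqrtr1 R) ler_wsqrtr// ltW//; near: t; exact: nbhs_right_lt.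
have s2 : Num.sqrt t <= e / 4 / (k%:R + 1).
  have : `|0 - Num.sqrt t| <= e / 4 / (k%:R + 1).
    by near: t; exact: ((cvgrPdist_le _ _).1 sq0 _ k4).
  by rewrite sub0r normrN ger0_norm ?sqrtr_ge0.
have t0 : 0 <= t by case/andP : tT => /ltW.
have p1 : t `^ (n%:R / 2) <= Num.sqrt t.
  rewrite powR_half//; case: n n_gt0 => // m _.
  by rewrite exprS ler_piMr ?sqrtr_ge0// exprn_ile1// sqrtr_ge0.
have p2 : t `^ (n%:R / 2) * k%:R <= e / 4.
  apply: (@le_trans _ _ (e / 4 / (k%:R + 1) * (k%:R + 1))).
    by apply: ler_pM; rewrite ?powR_ge0 ?ler0n// ?(le_trans p1)// lerDl.
  by rewrite divfK// gt_eqF// ltr_wpDl.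
have b := bnd t k%:R tT (ler0n _ _).
apply: (le_trans b); rewrite lee_fin; lra.
Unshelve. all: by end_near. Qed.

End decay.

Section bounded_data.
Context {R : realType} {n : nat} (n_gt0 : (0 < n)%N).
Local Notation mu := (@lebesgue_rV R n).
Local Notation leb := (@lebesgue_measure R).
Implicit Types (s t : R).
Context (f : R -> R) (f_lip : locally_lipschitz f) (f_mono : {homo f : x y / x <= y})
  (f0 : f 0 = 0).
Context (f_int : (\int[leb]_(s in `[1%R, +oo[)
  (s `^ (- (1 + 2 / n%:R)) * ell f s)%:E < +oo)%E).

(** By [speedE] this is ell f at the size that 2 V can reach at time s, written in
    the form to which [ge0_integral_growth] applies. *)
Definition speed (c s : R) : R := ell f ((c `^ (2 / n%:R) / (4 * pi) / s) `^ (2 / n%:R)^-1).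

Lemma speedE (c s : R) : 0 <= c -> 0 < s -> speed c s = ell f (c * peak s ^+ n).
Proof.
move=> c0 s0; rewrite /speed; congr (ell f _).
have n0 : n%:R != 0 :> R by rewrite pnatr_eq0 -lt0n.
have s4 : 0 <= 4 * pi * s by rewrite !mulr_ge0 ?pi_ge0// ltW.
rewrite -mulrA -invfM powRM ?powR_ge0 ?invr_ge0//.
rewrite -powRrM divff ?mulf_neq0 ?invr_eq0// powRr1//; congr (_ * _).
by rewrite invf_div powR_half ?invr_ge0// sqrtrV.
Qed.

Lemma speed_ge0 c s : 0 <= speed c s.
Proof. exact: ell_ge0. Qed.

Lemma measurable_speed c : measurable_fun [set: R] (speed c).
Proof.
apply: (@measurableT_comp _ _ _ _ _ _ (ell f)); first exact: measurable_ell.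
apply: (@measurableT_comp _ _ _ _ _ _ (fun x : R => x `^ (2 / n%:R)^-1)); first exact: measurable_powR.
by apply: measurable_funM => //; exact: measurable_invr.
Qed.

Lemma speed_integral c : 0 < c -> exists2 T : R, 0 < T &
  (\int[leb]_(s in `]0%R, T[) (speed c s)%:E <= (2^-1)%:E)%E.
Proof.
move=> c0; set k := c `^ (2 / n%:R) / (4 * pi).
have k0 : 0 < k by rewrite divr_gt0 ?powR_gt0// mulr_gt0// pi_gt0.
have b0 : 0 < 2 / n%:R :> R by rewrite divr_gt0// ltr0n.
have fin : (\int[leb]_(s in `]0%R, k[) (speed c s)%:E < +oo)%E.
  exact: (ge0_integral_growth (ell_ge0 f_lip f_mono f0) (ell_homo f_lip f_mono f0) (measurable_ell f_lip f_mono f0) b0 k0 f_int).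
have h := integral_itv_cvg0 (speed_ge0 c) (measurable_speed c) k0 fin (@cvg_harmonic R).
have e0 : 0 < 2^-1 :> R by [].
have [] := (ge0_cvge0P _).1 h _ e0; first by move=> j; apply: integral_ge0 => s _; rewrite lee_fin speed_ge0.
by move=> N _ /(_ N (leqnn N)) hN; exists (harmonic N) => //; rewrite invr_gt0.
Qed.

Context (phi : 'rV[R]_n -> R) (iphi : mu.-integrable setT (EFin \o phi)).
Local Notation V := (fun s y => gconv (gauss s) (fun z => `|phi z|) y).

(** 2 V s is at most the argument of ell f in [speedE], and ell f bounds the
    quotient f r / r. *)
Lemma speed_bound (m : R) : \int[mu]_y `|phi y| <= m -> forall s y (r : R), 0 < s ->
  `|r| <= 2 * V s y -> `|f r| <= speed (2 * m) s * (2 * V s y).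
Proof.
move=> phim s y r s0 rV.
have m0 : 0 <= m by apply: le_trans phim; apply: Rintegral_ge0 => z _.
have rm : `|r| <= 2 * m * peak s ^+ n.
  apply: (le_trans rV); rewrite -mulrA ler_wpM2l// mulrC.
  apply: (le_trans (heat_L1_le iphi y s0)); rewrite ler_wpM2l//.
  by rewrite exprn_ge0// ltW// peak_gt0.
have h := le_ell f_lip f_mono f0 rm.
rewrite speedE ?mulr_ge0//; apply: (le_trans h); rewrite ler_wpM2l//.
exact: ell_ge0.
Qed.

End bounded_data.

Theorem theorem2p2 (R : realType) (n : nat) (n_ge1 : (1 <= n)%N) (f : R -> R)
  (f_lip : locally_lipschitz f)
  (f_mono : {homo f : x y / x <= y})
  (f0 : f 0 = 0)
  (f_int : (\int[lebesgue_measure]_(s in `[1%R, +oo[)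
     (s `^ (- (1 + 2 / n%:R)) * ell f s)%:E < +oo)%E)
  (B : set ('rV[R]_n -> R)) (B_bnd : bounded_in_L1 B) :
  exists2 TB : R, 0 < TB &
  forall phi, B phi ->
  exists ulow uup : R -> 'rV[R]_n -> R,
  [/\ classical_L1_solution f phi TB ulow,
      classical_L1_solution f phi TB uup,
      forall (t : R) (x : 'rV[R]_n), 0 <= t < TB -> ulow t x <= uup t x,
      ((t `^ (n%:R / 2))%:E * 'N[lebesgue_rV n]_(+oo) [EFin \o ulow t])%E
        @[t --> 0^'+] --> 0%E &
      ((t `^ (n%:R / 2))%:E * 'N[lebesgue_rV n]_(+oo) [EFin \o uup t])%E
        @[t --> 0^'+] --> 0%E].

Proof.
have [BL [M BM]] := B_bnd.
pose m : R := Num.max M 1.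
have m0 : 0 < m by rewrite lt_max ltr01 orbT.
have m20 : 0 < 2 * m by rewrite mulr_gt0.
have [T T0 aT] := speed_integral n_ge1 f_lip f_mono f0 f_int m20.
exists T => // phi Bphi.
have iphi : (lebesgue_rV n).-integrable setT (EFin \o phi).
  by apply/Lfun1_integrable; exact: BL.
have phim : \int[lebesgue_rV n]_y `|phi y| <= m.
  have := BM _ Bphi; rewrite Lnorm1 => h.
  rewrite le_max -lee_fin /Rintegral fineK ?h//.
  exact: (integrable_fin_num measurableT (integrable_norm iphi)).
have hfa s y (r : R) : 0 < s < T ->
    `|r| <= 2 * gconv (gauss s) (fun z => `|phi z|) y ->
    `|f r| <= speed (n:=n) f (2 * m) s * (2 * gconv (gauss s) (fun z => `|phi z|) y).
  by move=> /andP[s0 _]; exact: (speed_bound n_ge1 f_lip f_mono f0 iphi phim).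
have a0 s : 0 <= speed (n:=n) f (2 * m) s by exact: speed_ge0.
have ma : measurable_fun [set: R] (speed (n:=n) f (2 * m)) by exact: measurable_speed.
have cl := sol_classical iphi f_lip f_mono f0 a0 ma aT hfa.
have dec := Linfty_decay iphi n_ge1 T0 (fun t x tT => sol_le iphi f_lip f_mono f0 a0 ma aT hfa x tT).
by exists (sol phi f T), (sol phi f T).
Qed.
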